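(* Consider $(S^3,g_\mu)$ with $\mu>0$, and let $\lambda>0$. If $4-\mu+\dfrac{(\mu-4)^2}{\lambda}<0$, or equivalently, if $\lambda>\mu-4$ and $\mu>4$, then the Hopf vector field $V^\mu$ is an unstable critical point of the generalized energy $E_{g_\lambda}$.
   Context: $S^{3}\subset\mathbb{R}^{4}\cong\mathbb{C}^{2}$ is the unit sphere, $g$ its usual metric, $N$ the outward unit normal ($N(p)=p$), $J$ the usual complex structure of $\mathbb{R}^4$, and $V=JN$ (so $V(p)=ip$). For $\mu>0$ the Riemannian Berger metric $g_\mu$ on $S^3$ is defined by $g_\mu|_{V^\perp}=g|_{V^\perp}$, $g_\mu(V,V)=\mu\, g(V,V)$, $g_\mu(V,V^\perp)=0$. The Hopf vector field is the $g_\mu$-unit field $V^\mu=\frac{1}{\sqrt{\mu}}V$. Let $\nabla^\mu$ be the Levi-Civita connection of $g_\mu$. For $\lambda>0$ the generalized energy of a $g_\mu$-unit smooth vector field $X$ on $(S^3,g_\mu)$ is $E_{g_\lambda}(X)=\frac12\int_{S^3}\operatorname{tr}(L_{(g_\lambda,X)})\,\mathrm{dv}_{g_\lambda}$, where the endomorphism $L_{(g_\lambda,X)}$ is determined by $g_\lambda(L_{(g_\lambda,X)}Y,Z)=g_\mu(Y,Z)+g_\mu(\nabla^\mu_YX,\nabla^\mu_ZX)$ (the right-hand side is the pull-back by $X$ of the Sasaki metric of $g_\mu$) and $\mathrm{dv}_{g_\lambda}$ is the volume measure of $g_\lambda$ (the Berger metric with parameter $\lambda$). $E_{g_\lambda}$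 is restricted to the set of $g_\mu$-unit vector fields, and $V^\mu$ is a critical point of this restriction. The Hessian of $E_{g_\lambda}$ at the critical point $V^\mu$, acting on a smooth vector field $A$ that is $g_\mu$-orthogonal to $V^\mu$, is $\frac{d^2}{dt^2}\big|_{t=0}E_{g_\lambda}(X_t)$ for any smooth variation $X_t$ by unit vector fields with $X_0=V^\mu$, $\frac{d}{dt}|_{t=0}X_t=A$. The critical point is stable if the Hessian is positive semi-definite, and unstable otherwise, i.e. if the Hessian is negative on some $A$. *)

(* Defs.v *)
From mathcomp Require Import all_boot all_order all_algebra.
From mathcomp Require Import all_classical all_reals all_analysis.

Set Implicit Arguments.
Unset Strict Implicit.
Unset Printing Implicit Defensive.

Import Order.TTheory GRing.Theory Num.Theory.
Import numFieldNormedType.Exports.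

Local Open Scope classical_set_scope.
Local Open Scope ring_scope.

(* For U open in a finite-dimensional space this is the usual class C^n:
   all iterated directional derivatives up to order n exist and are
   continuous on U. *)
Fixpoint Ck (R : realType) (V W : normedModType R) (n : nat) (U : set V)
    (f : V -> W) : Prop :=
  (forall x, U x -> {for x, continuous f}) /\
  (if n is m.+1 then
     forall v : V, (forall x, U x -> derivable f x v) /\ Ck m U ('D_v f)
   else True).

Definition smooth (R : realType) (V W : normedModType R) (U : set V)
  (f : V -> W) : Prop := forall n, Ck n U f.

Section Sphere.
Variable R : realType.
Notation R4 := 'rV[R]_4.

(* The norm `|u| that MathComp puts on 'rV[R]_4 is the sup norm (used here
   only through its topology); the Euclidean structure is given by dot. *)
Definition dot (u v : R4) : R := \sum_(i < 4) u ord0 i * v ord0 i.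

Definition S3 : set R4 := [set p | dot p p = 1].

Definition tangent (p v : R4) : Prop := dot p v = 0.

(* Multiplication by the imaginary unit under
   (x0, x1, x2, x3) = (x0 + i x1, x2 + i x3). *)
Definition J (u : R4) : R4 :=
  \row_(i < 4) [:: - u ord0 (inord 1); u ord0 (inord 0);
                   - u ord0 (inord 3); u ord0 (inord 2)]`_i.

Definition hopf (p : R4) : R4 := J p.

(* Component of u orthogonal to the unit vector hopf p, for p in S3. *)
Definition horizontal (p u : R4) : R4 := u - dot u (hopf p) *: hopf p.

Definition berger (mu : R) (p u v : R4) : R :=
  dot (horizontal p u) (horizontal p v)
  + mu * (dot u (hopf p) * dot v (hopf p)).

Definition hopf_unit (mu : R) (p : R4) : R4 := (Num.sqrt mu)^-1 *: hopf p.

(* Maps on S3 are represented by maps on R^4, of which only the values on S3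
   matter. They are differentiated through their 0-homogeneous extension
   p |-> f (p / |p|); as the radial projection is a smooth retraction of
   R^4 \ {0} onto S3, f is smooth on S3 iff this extension is smooth. *)
Definition radial (p : R4) : R4 := (Num.sqrt (dot p p))^-1 *: p.

Definition smooth_on_S3 (W : normedModType R) (f : R4 -> W) : Prop :=
  smooth [set p | p != 0] (f \o radial).

Definition dS3 (W : normedModType R) (f : R4 -> W) (p v : R4) : W :=
  'D_v (f \o radial) p.

Definition vector_field (X : R4 -> R4) : Prop :=
  smooth_on_S3 X /\ (forall p, S3 p -> tangent p (X p)).

Definition lie_bracket (X Y : R4 -> R4) (p : R4) : R4 :=
  dS3 Y p (X p) - dS3 X p (Y p).

(* nabla X p v stands for the covariant derivative at p of the vector field X
   in the direction v. *)
Record affine_connection (nabla : (R4 -> R4) -> R4 -> R4 -> R4) : Prop := {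
  connection_smooth : forall X Y, vector_field X -> vector_field Y ->
    vector_field (fun p => nabla X p (Y p));
  connection_linear : forall X p (a : R) u v, vector_field X -> S3 p ->
    tangent p u -> tangent p v ->
    nabla X p (a *: u + v) = a *: nabla X p u + nabla X p v;
  connection_add : forall X Y p v, vector_field X -> vector_field Y ->
    S3 p -> tangent p v ->
    nabla (fun q => X q + Y q) p v = nabla X p v + nabla Y p v;
  connection_leibniz : forall (f : R4 -> R^o) X p v, smooth_on_S3 f ->
    vector_field X -> S3 p -> tangent p v ->
    nabla (fun q => f q *: X q) p v = dS3 f p v *: X p + f p *: nabla X p v
}.

Record levi_civita (mu : R) (nabla : (R4 -> R4) -> R4 -> R4 -> R4) : Prop := {
  levi_civita_connection : affine_connection nabla;
  levi_civita_torsion_free : forall X Y p, vector_field X -> vector_field Y ->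
    S3 p -> nabla Y p (X p) - nabla X p (Y p) = lie_bracket X Y p;
  levi_civita_metric : forall X Y p v, vector_field X -> vector_field Y ->
    S3 p -> tangent p v ->
    dS3 (fun q => berger mu q (X q) (Y q) : R^o) p v
    = berger mu p (nabla X p v) (Y p) + berger mu p (X p) (nabla Y p v)
}.

(* Hopf coordinates (cos s e^(ia), sin s e^(ib)): a diffeomorphism from
   ]0, pi/2[ x ]0, 2 pi[ x ]0, 2 pi[ onto a subset of S3 with negligible
   complement. *)
Definition hopf_coord (s a b : R) : R4 :=
  \row_(i < 4) [:: cos s * cos a; cos s * sin a;
                   sin s * cos b; sin s * sin b]`_i.

Definition hopf_partial (s a b : R) (i : 'I_3) : R4 :=
  nth 0 [:: derive1 (fun x => hopf_coord x a b) s;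
            derive1 (fun x => hopf_coord s x b) a;
            derive1 (fun x => hopf_coord s a x) b] i.

Definition volume_density (lambda s a b : R) : R :=
  Num.sqrt (\det (\matrix_(i < 3, j < 3)
    berger lambda (hopf_coord s a b)
      (hopf_partial s a b i) (hopf_partial s a b j))).

Definition integral_S3 (lambda : R) (f : R4 -> R) : R :=
  \int[lebesgue_measure]_(s in `[0, pi / 2])
   \int[lebesgue_measure]_(a in `[0, pi *+ 2])
    \int[lebesgue_measure]_(b in `[0, pi *+ 2])
      (f (hopf_coord s a b) * volume_density lambda s a b).

Section Energy.
Variables (mu lambda : R) (nabla : (R4 -> R4) -> R4 -> R4 -> R4).

(* An endomorphism of the tangent space at p is represented by the matrix
   (acting on row vectors) of its extension by 0 to the normal line through p;
   this extension has the same trace. *)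
Definition is_energy_endo (X : R4 -> R4) (p : R4) (L : 'M[R]_4) : Prop :=
  [/\ p *m L = 0,
      forall u, tangent p u -> tangent p (u *m L) &
      forall u v, tangent p u -> tangent p v ->
        berger lambda p (u *m L) v
        = berger mu p u v + berger mu p (nabla X p u) (nabla X p v)].

Definition energy_endo (X : R4 -> R4) (p : R4) : 'M[R]_4 :=
  xget 0 [set L | is_energy_endo X p L].

Definition energy (X : R4 -> R4) : R :=
  2^-1 * integral_S3 lambda (fun p => \tr (energy_endo X p)).

Definition unit_field (X : R4 -> R4) : Prop :=
  vector_field X /\ (forall p, S3 p -> berger mu p (X p) (X p) = 1).

Definition variation (X0 A : R4 -> R4) (X : R -> R4 -> R4) : Prop :=
  exists e : R, [/\ 0 < e,
    smooth [set tp : R^o * R4 | `|tp.1| < e /\ tp.2 != 0]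
           (fun tp => X tp.1 (radial tp.2)),
    forall t, `|t| < e -> unit_field (X t) &
    forall p, S3 p -> X 0 p = X0 p /\ is_derive (0 : R) 1 (X ^~ p) (A p)].

Definition critical_point (X0 : R4 -> R4) : Prop :=
  unit_field X0 /\
  forall A X, variation X0 A X ->
    is_derive (0 : R) 1 (fun t => energy (X t)) 0.

Definition admissible_direction (X0 A : R4 -> R4) : Prop :=
  vector_field A /\ (forall p, S3 p -> berger mu p (A p) (X0 p) = 0).

(* h is the Hessian of the energy at X0 evaluated on A. *)
Definition hessian_at (X0 A : R4 -> R4) (h : R) : Prop :=
  (exists X, variation X0 A X) /\
  forall X, variation X0 A X ->
    (\forall t \near (0 : R), derivable (fun t => energy (X t)) t 1) /\
    is_derive (0 : R) 1 (derive1 (fun t => energy (X t))) h.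

Definition unstable_critical_point (X0 : R4 -> R4) : Prop :=
  critical_point X0 /\
  exists A h, [/\ admissible_direction X0 A, hessian_at X0 A h & h < 0].

End Energy.

End Sphere.

(* Main.v *)
(* In the orthogonal frame V = Jp, E1 = J2 p, E2 = J3 p of left-invariant fields
   the Koszul formula gives the connection, so that the energy of
   X = x0 V + x1 E1 + x2 E2 is the integral of a constant plus a sum of squares
   of first-order expressions in the x_k.  For a variation of the Hopf field,
   differentiating mu x0^2 + x1^2 + x2^2 = 1 twice determines x0' and x0'' at
   t = 0, and the terms E1 x2' - E2 x1' and E1 x2'' - E2 x1'' integrate to 0
   because E1 and E2 are divergence free.  With a_k = x_k'(0) the Hessian is the
   integral of
     |V a + (2 - mu) (a2, - a1)|^2 / lambda + |E1 a|^2 + |E2 a|^2 - mu |a|^2 .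
   Writing p = (z, w), the choice a1 = Im z^2, a2 = Re z^2 gives V a = 2 (a2, - a1),
   and |E1 a|^2 + |E2 a|^2 = 8 |z|^2 |w|^2 has the same integral as 4 |a|^2, so
   the Hessian is a positive multiple of 4 - mu + (mu - 4)^2 / lambda. *)
From HB Require Import structures.
Require Import Defs.
From mathcomp Require Import all_boot all_order all_algebra.
From mathcomp Require Import all_classical all_reals all_analysis.
From mathcomp Require Import ring lra.
Set Implicit Arguments.
Unset Strict Implicit.
Unset Printing Implicit Defensive.
Import Order.TTheory GRing.Theory Num.Theory.
Import numFieldNormedType.Exports.
Local Open Scope classical_set_scope.
Local Open Scope ring_scope.

(** * Functions of class C^n *)

Section Ck.
Variable R : realType.
Implicit Types V W : normedModType R.

(** Smoothness is given only through iterated directional derivatives, so linearity of the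
    derivative in its direction, the chain rule along curves and the symmetry of mixed derivatives
    have to be drawn from the mean value theorem. Differentiation under the integral rests on two
    facts: an iterated integral over a compact box is linear, and it is bounded by the supremum of
    the integrand. The test direction is a Fourier mode. With a = a1 + i a2 it is a = i conj(z)^2,
    on which V acts as -2i, while (a2, - a1) is - i a; the first square is thus (mu - 4)^2 |a|^2. On
    the sphere conj(z)^2 is a harmonic with eigenvalue 8, of which V accounts for 2^2, leaving 4 for
    E1 and E2. In degree k the same count gives 2 k - mu + (k + 2 - mu)^2 / lambda; the theorem is
    the case k = 2. The Hessian also asks for one variation with this velocity. Rotating by the
    angle t |a| is awkward at the zeros of a; a rational parametrisation of the unit vectors avoids
    this. *)

Lemma open_near_eq V W (U : set V) (f g : V -> W) x : open U -> U x ->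
  (forall y, U y -> f y = g y) -> \forall y \near x, f y = g y.
Proof. by move=> oU Ux fg; apply: filterS fg _; apply: open_nbhs_nbhs. Qed.

Lemma near_eq_continuous V W (f g : V -> W) x : (\forall y \near x, f y = g y) ->
  {for x, continuous f} -> {for x, continuous g}.
Proof.
move=> fg; rewrite /prop_for /continuous_at (nbhs_singleton fg) => h.
by apply: cvg_trans h; apply: near_eq_cvg.
Qed.

Lemma Ck_continuous V W n (U : set V) (f : V -> W) x :
  Ck n U f -> U x -> {for x, continuous f}.
Proof. by case: n => [|n] [fc _]; exact: fc. Qed.

Lemma CkW V W n (U : set V) (f : V -> W) : Ck n.+1 U f -> Ck n U f.
Proof.
elim: n f => [|n IH] f; first by case=> fc _; split.
case=> fc fd; split=> // v; have [fv Dfv] := fd v; split=> //; exact: IH.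
Qed.

Lemma eq_Ck V W n (U : set V) (f g : V -> W) : open U ->
  (forall x, U x -> f x = g x) -> Ck n U f -> Ck n U g.
Proof.
move=> oU; elim: n f g => [|n IH] f g fg [fc fd].
  split=> // x Ux; exact: near_eq_continuous (open_near_eq oU Ux fg) (fc x Ux).
split=> [x Ux|v].
  exact: near_eq_continuous (open_near_eq oU Ux fg) (fc x Ux).
have [fv Dfv] := fd v; split=> [x Ux|].
  exact: near_eq_derivable (open_near_eq oU Ux fg) (fv x Ux).
apply: IH Dfv => x Ux; exact: near_eq_derive (open_near_eq oU Ux fg).
Qed.

Lemma Ck_cst V W n (U : set V) (w : W) : Ck n U (cst w).
Proof.
elim: n w => [|n IH] w; first by split=> // x _; exact: cst_continuous.
split=> [x _|v]; first exact: cst_continuous.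
split=> [x _|]; first exact: derivable_cst.
by rewrite (_ : 'D_v (cst w) = cst 0)//; apply/funext => x; rewrite derive_cst.
Qed.

Lemma CkD V W n (U : set V) (f g : V -> W) : open U ->
  Ck n U f -> Ck n U g -> Ck n U (f \+ g).
Proof.
move=> oU; elim: n f g => [|n IH] f g [fc fd] [gc gd].
  by split=> // x Ux; apply: continuousD; [exact: fc|exact: gc].
split=> [x Ux|v]; first by apply: continuousD; [exact: fc|exact: gc].
have [fv Dfv] := fd v; have [gv Dgv] := gd v; split=> [x Ux|].
  by apply: derivableD; [exact: fv|exact: gv].
apply: (eq_Ck oU _ (IH _ _ Dfv Dgv)) => x Ux; rewrite /= deriveD//.
- exact: fv.
- exact: gv.
Qed.

Lemma CkM V n (U : set V) (f g : V -> R^o) : open U ->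
  Ck n U f -> Ck n U g -> Ck n U (fun x => f x * g x : R^o).
Proof.
move=> oU; elim: n f g => [|n IH] f g Cf Cg; have [fc fd] := Cf; have [gc gd] := Cg.
  by split=> // x Ux; apply: continuousM; [exact: fc|exact: gc].
split=> [x Ux|v]; first by apply: continuousM; [exact: fc|exact: gc].
have [fv Dfv] := fd v; have [gv Dgv] := gd v; split=> [x Ux|].
  by apply: (@derivableM _ V); [exact: fv|exact: gv].
have h := CkD oU (IH _ _ (CkW Cf) Dgv) (IH _ _ (CkW Cg) Dfv).
apply: (eq_Ck oU _ h) => x Ux /=; rewrite (@deriveM _ V)//.
- exact: fv.
- exact: gv.
Qed.

Lemma Ck_lin V W (W' : normedModType R) n (U : set V) (f : V -> W) (L : {linear W -> W'}) :
  open U -> continuous L -> Ck n U f -> Ck n U (L \o f).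
Proof.
move=> oU Lc; elim: n f => [|n IH] f [fc fd].
  by split=> // x Ux; apply: continuous_comp; [exact: fc|exact: Lc].
split=> [x Ux|v]; first by apply: continuous_comp; [exact: fc|exact: Lc].
have [fv Dfv] := fd v.
have H x : U x -> is_derive x v (L \o f) (L ('D_v f x)).
  move=> Ux; have /cvg_ex[l fl] := fv x Ux.
  have : (fun h => h^-1 *: (((L \o f) \o shift x) (h *: v) - (L \o f) x)) @ 0^'
      --> L ('D_v f x).
    rewrite (_ : (fun h => _) = L \o (fun h => h^-1 *: ((f \o shift x) (h *: v) - f x))).
      by apply: continuous_cvg; [exact: Lc|exact: (fv x Ux)].
    by apply/funext => h; rewrite /= linearZ_LR (raddfB L).
  move=> k; split; first by apply/cvg_ex; exists (L ('D_v f x)).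
  exact/cvg_lim.
split=> [x Ux|]; first by have [] := H x Ux.
by apply: (eq_Ck oU _ (IH _ Dfv)) => x Ux; have [_ ->] := H x Ux.
Qed.

(** [B] is the linear part of [A], so the two difference quotients coincide literally. Lines,
    translations, slices at fixed time and projections are all handled this way. *)
Lemma is_derive_affine (V V' W : normedModType R) (f : V -> W) (A B : V' -> V) x v :
  (forall x h v, A (h *: v + x) = h *: B v + A x) ->
  forall df, is_derive (A x) (B v) f df -> is_derive x v (f \o A) df.
Proof.
move=> AB df [+ <-].
by split; rewrite /derive /derivable (_ : (fun h => h^-1 *: (((f \o A) \o shift x) (h *: v) - (f \o A) x)) =
 (fun h => h^-1 *: ((f \o shift (A x)) (h *: B v) - f (A x))))//; apply/funext => h /=;
  rewrite AB.
Qed.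

Lemma derive_affine (V V' W : normedModType R) (f : V -> W) (A B : V' -> V) v :
  (forall x h v, A (h *: v + x) = h *: B v + A x) ->
  'D_v (f \o A) = ('D_(B v) f) \o A.
Proof.
move=> AB; apply/funext => x; rewrite /derive/=.
rewrite (_ : (fun h => h^-1 *: (((f \o A) \o shift x) (h *: v) - (f \o A) x)) =
  (fun h => h^-1 *: ((f \o shift (A x)) (h *: B v) - f (A x))))//.
by apply/funext => h /=; rewrite AB.
Qed.

Lemma Ck_affine (V V' W : normedModType R) n (U : set V) (U' : set V') (f : V -> W) (A B : V' -> V) :
  (forall x h v, A (h *: v + x) = h *: B v + A x) -> continuous A ->
  (forall x, U' x -> U (A x)) ->
  Ck n U f -> Ck n U' (f \o A).
Proof.
move=> AB Ac UU; elim: n f => [|n IH] f [fc fd].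
  by split=> // x Ux; apply: continuous_comp; [exact: Ac|exact: fc (UU _ Ux)].
split=> [x Ux|v]; first by apply: continuous_comp; [exact: Ac|exact: fc (UU _ Ux)].
have [fv Dfv] := fd (B v); split=> [x Ux|].
  by have /derivableP/(is_derive_affine AB)[] := fv _ (UU x Ux).
by rewrite (derive_affine _ _ AB); exact: IH.
Qed.

Lemma is_derive1_comp (f g : R -> R) (x df dg : R) :
  is_derive x 1 f df -> is_derive (f x) 1 g dg -> is_derive x 1 (g \o f) (dg * df).
Proof.
move=> [fd <-] [gd <-].
have gfd : differentiable (g \o f) x.
  exact: (differentiable_comp ((derivable1_diffP _ _).1 fd) ((derivable1_diffP _ _).1 gd)).
split; first exact/derivable1_diffP.
by rewrite -derive1E (derive1_comp fd gd) !derive1E.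
Qed.

(** Restriction to the line through [x] in direction [v] reduces this to the chain rule in one
    variable. *)
Lemma is_derive_comp V (f : V -> R) (g : R -> R) x v df dg :
  is_derive x v f df -> is_derive (f x) 1 g dg -> is_derive x v (g \o f) (dg * df).
Proof.
have line (k : V -> R) : 'D_v k x = 'D_1 (fun h : R => k (h *: v + x)) 0.
  rewrite /derive; set g1 := fun h => h^-1 *: _; set g2 := fun h => h^-1 *: _.
  suff -> : g1 = g2 by [].
  by rewrite funeqE /g1 /g2 => h /=; rewrite addr0 scale0r add0r [_%:A]mulr1.
move=> [/derivable1P fd <-] gd.
have Df : is_derive (0 : R) 1 (fun h : R => f (h *: v + x)) ('D_v f x).
  by split; [exact: fd|rewrite line].
have [] := is_derive1_comp (g := g) (dg := dg) Df _.
  by rewrite scale0r add0r.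
move=> gfd <-; split; [exact/derivable1P|exact: (line (g \o f))].
Qed.

Lemma Ck_comp V n (U : set V) (O : set R^o) (f : V -> R^o) (g : R^o -> R^o) : open U ->
  (forall x, U x -> O (f x)) -> Ck n O g -> Ck n U f -> Ck n U (g \o f).
Proof.
move=> oU fO; elim: n g => [|n IH] g Cg Cf; have [fc fd] := Cf; have [gc gd] := Cg.
  by split=> // x Ux; apply: continuous_comp; [exact: fc|exact: gc (fO _ Ux)].
split=> [x Ux|v]; first by apply: continuous_comp; [exact: fc|exact: gc (fO _ Ux)].
have [fv Dfv] := fd v; have [gv Dgv] := gd 1.
have H x : U x -> is_derive x v (g \o f) ('D_1 g (f x) * 'D_v f x).
  by move=> Ux; apply: is_derive_comp; apply: derivableP; [exact: fv|exact: gv (fO _ Ux)].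
split=> [x Ux|]; first by have [] := H x Ux.
apply: (eq_Ck oU _ (CkM oU (IH _ Dgv (CkW Cf)) Dfv)) => x Ux.
by have [_ ->] := H x Ux.
Qed.

(** Serves the exponents -1/2 (radial projection) and -1 (the denominator [eta]). The induction
    generalises over [a], because differentiation lowers the exponent by one. *)
Lemma Ck_powR n (a : R) : Ck n ([set x : R^o | 0 < x] : set R^o) ((fun x : R => x `^ a : R^o) : R^o -> R^o).
Proof.
have oU : open ([set x : R^o | 0 < x] : set R^o) by exact: open_gt.
have c x : 0 < x -> {for x, continuous (fun x : R => x `^ a)}.
  by move=> x0; apply/differentiable_continuous/derivable1_diffP/derivable_powR; rewrite in_itv/= x0.
elim: n a c => [|n IH] a c; first by split.
split=> // v.
have H x : 0 < x -> is_derive (x : R^o) v (fun x : R => x `^ a) (v * a * x `^ (a - 1)).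
  move=> x0; have [/derivable1_diffP df dv] := is_derive1_powR a x0.
  split; first exact/diff_derivable.
  rewrite deriveE// -[v in LHS]mulr1 linearZ/= -deriveE// dv.
  by rewrite -mulrA.
split=> [x x0|]; first by have [] := H x x0.
apply: (eq_Ck oU (f := fun x => v * a * x `^ (a - 1))).
  by move=> x x0; have [_ ->] := H x x0.
apply: CkM => //; first exact: Ck_cst.
apply: IH => x x0.
by apply/differentiable_continuous/derivable1_diffP/derivable_powR; rewrite in_itv/= x0.
Qed.

End Ck.

(** * Symmetry of second derivatives and differentiability *)

Section MVT.
Variable R : realType.
Implicit Types V W : normedModType R.

(** The classical theorem for s |-> f (x + s h v) on [0, 1]; the parameter [s] makes one statement
    serve both signs of [h]. *)
Lemma directional_MVT V (f : V -> R^o) (x v : V) (h : R) :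
  (forall s : R, 0 <= s <= 1 -> derivable f ((s * h) *: v + x) v) ->
  exists2 s : R, 0 <= s <= 1 & f (h *: v + x) - f x = h * 'D_v f ((s * h) *: v + x).
Proof.
move=> fd; pose phi (s : R) := f ((s * h) *: v + x).
have dphi (s : R) : 0 <= s <= 1 -> is_derive s 1 phi (h * 'D_v f ((s * h) *: v + x)).
  move=> s01.
  have H : is_derive (s * h) 1 (f \o (fun s : R => s *: v + x)) ('D_v f ((s * h) *: v + x)).
    apply: (@is_derive_affine _ V R R^o f (fun s : R => s *: v + x) (fun s : R => s *: v)).
      by move=> y k w; rewrite scalerDl scalerA addrA.
    by rewrite scale1r; exact/derivableP/fd.
  have I : is_derive s 1 ( *%R^~ h) h.
    have := @is_deriveM R R id (cst h) s 1 1 0 (is_derive_id _ _) (is_derive_cst _ _ _).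
    by rewrite scaler0 add0r [_ *: 1]mulr1.
  by have := is_derive_comp I H; rewrite mulrC.
have := @MVT_segment R phi (fun s => h * 'D_v f ((s * h) *: v + x)) 0 1 ler01.
case.
- by move=> s /itvP s01; apply: dphi; rewrite !s01.
- apply: derivable_within_continuous => s; rewrite in_itv => s01.
  by have [] := dphi s s01.
- move=> s; rewrite in_itv/= => s01; rewrite /phi mul1r mul0r scale0r add0r subr0 mulr1 => E.
  by exists s.
Qed.

(** Two mean values: first along [v] for F y = f (h u + y) - f y, then along [u] for the derivative
    of [f] in direction [v]. *)
Lemma second_difference V (U : set V) (f : V -> R^o) (x u v : V) (h : R) : open U -> 0 < h ->
  Ck 2 U f ->
  (forall a b : R, 0 <= a <= h -> 0 <= b <= h -> U (a *: u + (b *: v + x))) ->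
  exists a b : R, [/\ 0 <= a <= h, 0 <= b <= h &
    f (h *: u + (h *: v + x)) - f (h *: v + x) - f (h *: u + x) + f x
    = h ^+ 2 * 'D_u ('D_v f) (a *: u + (b *: v + x))].
Proof.
move=> oU h0 Cf UU.
have h00 : 0 <= (0 : R) <= h by rewrite lexx ltW.
have hh : 0 <= h <= h by rewrite lexx ltW.
have sh (s : R) : 0 <= s <= 1 -> 0 <= s * h <= h by move=> /andP[s0 s1]; apply/andP; split; nra.
have [_ /(_ v) [fv [_ /(_ u) [Dvu _]]]] := Cf.
pose F y := f (h *: u + y) - f y : R^o.
have FE y : U (h *: u + y) -> U y ->
    is_derive y v F ('D_v f (h *: u + y) - 'D_v f y).
  move=> U1 U2; apply: is_deriveB; last exact/derivableP/fv.
  apply: (@is_derive_affine _ V V R^o f (fun y => h *: u + y) id) => [z k w|].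
    by rewrite addrCA.
  exact/derivableP/fv.
have UF (s : R) : 0 <= s <= 1 -> U (h *: u + ((s * h) *: v + x)).
  by move=> s01; apply: UU => //; exact: sh.
have UF' (s : R) : 0 <= s <= 1 -> U ((s * h) *: v + x).
  by move=> s01; rewrite -[_ + x]add0r -[X in X + _](scale0r u); apply: UU => //; exact: sh.
have [s s01 sE] : exists2 s : R, 0 <= s <= 1 & F (h *: v + x) - F x = h * 'D_v F ((s * h) *: v + x).
  apply: directional_MVT => s s01.
  by have [] := FE _ (UF s s01) (UF' s s01).
have U1 := UF s s01; have U2 := UF' s s01.
have [_ DF] := FE _ U1 U2.
have [a a01 aE] : exists2 s1 : R, 0 <= s1 <= 1 & 'D_v f (h *: u + ((s * h) *: v + x)) - 'D_v f ((s * h) *: v + x) =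
   h * 'D_u ('D_v f) ((s1 * h) *: u + ((s * h) *: v + x)).
  by apply: (@directional_MVT V ('D_v f)) => a a01; apply: Dvu; apply: UU; exact: sh.
exists (a * h), (s * h); split; [exact: sh|exact: sh|].
by rewrite expr2 -mulrA -aE -DF -sE /F; ring.
Qed.

(** The second difference is symmetric in [u] and [v], so for small h the two mixed derivatives
    agree at two points close to [x]; their continuity at [x] does the rest. *)
Lemma derive_comm V (U : set V) (f : V -> R^o) (x u v : V) : open U -> U x ->
  Ck 2 U f -> 'D_u ('D_v f) x = 'D_v ('D_u f) x.
Proof.
move=> oU Ux Cf.
have wk (z y w : R) : 0 <= z <= y -> y <= w -> 0 <= z <= w.
  by move=> /andP[-> /le_trans zy] /zy.
have C u' v' : {for x, continuous ('D_u' ('D_v' f))}.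
  by have [_ /(_ v') [_ [_ /(_ u') [_ [+ _]]]]] := Cf; apply.
have near_pt u' v' (P : set V) : nbhs x P ->
    exists2 d, 0 < d & forall a b : R, 0 <= a <= d -> 0 <= b <= d -> P (a *: u' + (b *: v' + x)).
  move=> xP.
  have c : (fun ab : R * R => ab.1 *: u' + (ab.2 *: v' + x)) @ (0, 0) --> x.
    rewrite -[X in _ --> X]add0r -(scale0r u') -[X in _ --> _ + X]add0r -[X in _ --> _ + (X + _)](scale0r v').
    apply: cvgD; first by apply: cvgZr_tmp; exact: cvg_fst.
    apply: cvgD; last exact: cvg_cst.
    by apply: cvgZr_tmp; exact: cvg_snd.
  have /nbhs_ballP[d /= d0 dP] := c _ xP.
  exists (d / 2); first by rewrite divr_gt0.
  move=> a b a0 b0; apply: (dP (a, b)).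
  by split; rewrite /ball/= sub0r normrN ger0_norm; lra.
apply/eqP; rewrite -subr_eq0 -normr_le0; apply/ler_addgt0Pl => e e0; rewrite addr0.
have H u' v' : nbhs x [set y | U y /\ `|'D_u' ('D_v' f) x - 'D_u' ('D_v' f) y| < e / 2].
  near=> y; split; first by near: y; apply: open_nbhs_nbhs.
  by near: y; move/cvgrPdist_lt : (C u' v'); apply; rewrite divr_gt0.
have [d1 d10 P1] := near_pt u v _ (H u v).
have [d2 d20 P2] := near_pt v u _ (H v u).
pose h := Num.min d1 d2.
have h0 : 0 < h by rewrite lt_min d10.
have hd1 : h <= d1 by rewrite ge_min lexx.
have hd2 : h <= d2 by rewrite ge_min lexx orbT.
have [|a [b [a0 b0 E1]]] := @second_difference V U f x u v h oU h0 Cf.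
  by move=> a b a0 b0; have [] := P1 a b (wk _ _ _ a0 hd1) (wk _ _ _ b0 hd1).
have [|a' [b' [a'0 b'0 E2]]] := @second_difference V U f x v u h oU h0 Cf.
  by move=> c d c0 d0; have [] := P2 c d (wk _ _ _ c0 hd2) (wk _ _ _ d0 hd2).
have E : 'D_u ('D_v f) (a *: u + (b *: v + x)) = 'D_v ('D_u f) (a' *: v + (b' *: u + x)).
  have h2 : h ^+ 2 != 0 by rewrite expf_neq0// gt_eqF.
  apply: (mulfI h2); apply: (etrans (esym E1)); apply: (etrans _ E2).
  have -> : h *: u + (h *: v + x) = h *: v + (h *: u + x) by rewrite addrCA.
  by congr (_ + _); rewrite addrAC.
have a0' := wk _ _ _ a0 hd1.
have b0' := wk _ _ _ b0 hd1.
have a1' := wk _ _ _ a'0 hd2.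
have b1' := wk _ _ _ b'0 hd2.
have [_ L1] := P1 a b a0' b0'; have [_ L2] := P2 a' b' a1' b1'.
rewrite E in L1; move: L1 L2.
move: ('D_v ('D_u f) (a' *: v + (b' *: u + x))) ('D_u ('D_v f) x) ('D_v ('D_u f) x) => y z w.
move=> L1 L2; have := ler_distD y z w; rewrite (distrC y w) => /le_trans; apply.
rewrite (splitr e); apply: lerD; [exact: (ltW L1)|exact: (ltW L2)].
Unshelve. all: by end_near. Qed.

End MVT.

(** * Fréchet differentiability of functions of class C^1 *)

Definition row_form (R : realType) n (c : 'I_n -> R) (h : 'rV[R]_n) : R^o :=
  \sum_(i < n) h ord0 i * c i.

Lemma row_form_is_linear (R : realType) n (c : 'I_n -> R) : linear (row_form c).
Proof.
move=> k u v; rewrite /row_form scaler_sumr -big_split/=; apply: eq_bigr => i _.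
by rewrite !mxE mulrDl -mulrA.
Qed.

HB.instance Definition _ (R : realType) n (c : 'I_n -> R) :=
  GRing.isLinear.Build R 'rV[R]_n R^o _ (row_form c) (row_form_is_linear c).

Lemma continuous_at_sum (R : realType) (T : topologicalType) (V : normedModType R) (I : Type)
    (r : seq I) (P : pred I) (F : I -> T -> V) x : (forall i, P i -> {for x, continuous (F i)}) ->
  {for x, continuous (fun y => \sum_(i <- r | P i) F i y)}.
Proof.
move=> Fc; elim: r => [|i r IH].
  rewrite (_ : (fun y => _) = cst 0); first exact: cst_continuous.
  by apply/funext => y; rewrite big_nil.
case Pi : (P i).
  rewrite (_ : (fun y => _) = F i \+ (fun y => \sum_(i <- r | P i) F i y)).
    by apply: continuousD => //; exact: Fc.
  by apply/funext => y; rewrite big_cons Pi.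
rewrite (_ : (fun y => _) = (fun y => \sum_(i <- r | P i) F i y))//.
by apply/funext => y; rewrite big_cons Pi.
Qed.

Section Frechet.
Variables (R : realType) (n : nat).
Implicit Types f : 'rV[R]_n -> R^o.

Lemma coord_le_norm (h : 'rV[R]_n) i : `|h ord0 i| <= `|h|.
Proof.
rewrite [leRHS]/Num.Def.normr/= mx_normrE.
exact: (le_bigmax _ (fun ij : 'I_1 * 'I_n => `|h ij.1 ij.2|) (ord0, i)).
Qed.

Lemma norm_le_coord (h : 'rV[R]_n) (M : R) : 0 <= M ->
  (forall i, `|h ord0 i| <= M) -> `|h| <= M.
Proof.
move=> M0 hM; rewrite [leLHS]/Num.Def.normr/= mx_normrE.
by apply: bigmax_le => // -[i j] _ /=; rewrite (ord1 i).
Qed.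

Let delta (i : 'I_n) : 'rV[R]_n := delta_mx ord0 i.

Lemma row_form_continuous (c : 'I_n -> R) : continuous (row_form c).
Proof.
rewrite /row_form; move=> x.
apply: continuous_at_sum => i _.
by apply: (@continuousM R); [exact: coord_continuous|exact: cst_continuous].
Qed.

(** Pass from [x] to x + h one coordinate at a time. Each move is a mean value along a basis vector,
    and in the sup norm every intermediate point stays within |h| of [x], where the partial
    derivatives are close to those at [x]. *)
Lemma Ck1_diff_expansion (U : set 'rV[R]_n) f x : open U -> U x -> Ck 1 U f ->
  f \o shift x = cst (f x) + (row_form (fun i => 'D_(delta i) f x)) +o_ (0 : 'rV[R]_n) id.
Proof.
move=> oU Ux [_ Cf].
apply/eqaddoP => _ /posnumP[e].
(* The divisor n + 1 is nonzero also for n = 0, and the sum of n errors of this size stays below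
   e. *)
have e1 : 0 < e%:num / n.+1%:R by rewrite divr_gt0.
have H : \forall y \near x, U y /\ forall i, `|'D_(delta i) f x - 'D_(delta i) f y| < e%:num / n.+1%:R.
  near=> y; split; first by near: y; apply: open_nbhs_nbhs.
  near: y; apply: filter_forall => i.
  by have [_ [/(_ x Ux)/cvgrPdist_lt + _]] := Cf (delta i); apply.
have [d /= d0 dP] := (nbhs_ballP _ _).1 H.
have B : \forall h \near (0 : 'rV[R]_n), `|h| < d.
  have := nbhsx_ballx (0 : 'rV[R]_n) d d0; apply: filterS => h.
  by rewrite -ball_normE/= sub0r normrN.
near=> h.
have hd : `|h| < d by near: h; exact: B.
(* [tr m] keeps the first m coordinates of h, so the increments telescope from 0 to h. *)
pose tr m : 'rV[R]_n := \row_i (if (i < m)%N then h ord0 i else 0).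
have tr0 : tr 0%N = 0 by apply/rowP => i; rewrite !mxE.
have trn : tr n = h by apply/rowP => i; rewrite !mxE ltn_ord.
have trS (i : 'I_n) : tr i.+1 = h ord0 i *: delta i + tr i.
  apply/rowP => j; rewrite !mxE eqxx ltnS leq_eqVlt /= (inj_eq val_inj).
  case: (eqVneq j i) => [->|ji] /=; first by rewrite ltnn mulr1 addr0.
  by rewrite mulr0 add0r.
have key (i : 'I_n) : `|f (tr i.+1 + x) - f (tr i + x) - h ord0 i * 'D_(delta i) f x| <=
    `|h| * (e%:num / n.+1%:R).
  have Hs (s : R) : 0 <= s <= 1 -> ball x d ((s * h ord0 i) *: delta i + (tr i + x)).
    move=> /andP[s0 s1]; rewrite -ball_normE/= addrA opprD addrCA subrr addr0 normrN.
    apply: le_lt_trans hd; apply: norm_le_coord => // j; rewrite !mxE eqxx/=.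
    case: (eqVneq j i) => [->|ji] /=.
      rewrite ltnn mulr1 addr0 normrM (ger0_norm s0).
      apply: le_trans (coord_le_norm h i).
      by rewrite ler_piMl.
    rewrite mulr0 add0r; case: ifP => _; first exact: coord_le_norm.
    by rewrite normr0.
  have [s s01 sE] : exists2 s : R, 0 <= s <= 1 & f (h ord0 i *: delta i + (tr i + x)) - f (tr i + x) =
     h ord0 i * 'D_(delta i) f ((s * h ord0 i) *: delta i + (tr i + x)).
    apply: directional_MVT => s s01.
    by have [+ _] := Cf (delta i); apply; have [] := dP _ (Hs s s01).
  rewrite trS -[_ + tr i + x]addrA sE -mulrBr normrM.
  apply: ler_pM => //; first exact: coord_le_norm.
  by rewrite distrC ltW//; have [_] := dP _ (Hs s s01); apply.
rewrite /= !fctE.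
have -> : f (h + x) - (f x + row_form (fun i => 'D_(delta i) f x) h) =
  \sum_(i < n) (f (tr i.+1 + x) - f (tr i + x) - h ord0 i * 'D_(delta i) f x).
  rewrite sumrB opprD addrA; congr (_ - _).
  rewrite -(big_mkord xpredT (fun i => f (tr i.+1 + x) - f (tr i + x))).
  by rewrite telescope_sumr// trn tr0 add0r.
apply: le_trans (ler_norm_sum _ _ _) _.
apply: (@le_trans _ _ (\sum_(i < n) `|h| * (e%:num / n.+1%:R))); first exact: ler_sum.
rewrite sumr_const card_ord -[leLHS]mulr_natr -mulrA mulrC ler_wpM2r//.
by rewrite -mulrA ler_piMr// mulrC ler_pdivrMr// mul1r ler_nat.
Unshelve. all: by end_near. Qed.

Lemma Ck1_differentiable (U : set 'rV[R]_n) f x : open U -> U x -> Ck 1 U f -> differentiable f x.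
Proof.
move=> oU Ux Cf; have E := Ck1_diff_expansion oU Ux Cf.
have D := diff_unique (@row_form_continuous _) E.
apply/diff_locallyP; rewrite D; split=> //; exact: row_form_continuous.
Qed.

Lemma Ck1_deriveE (U : set 'rV[R]_n) f x v : open U -> U x -> Ck 1 U f ->
  'D_v f x = \sum_(i < n) v ord0 i * 'D_(delta_mx ord0 i) f x.
Proof.
move=> oU Ux Cf; rewrite deriveE; last exact: Ck1_differentiable Ux Cf.
have E := Ck1_diff_expansion oU Ux Cf.
by rewrite (diff_unique (@row_form_continuous _) E).
Qed.

Lemma Ck1_is_derive_curve (U : set 'rV[R]_n) f (c : R -> 'rV[R]_n) (dc : 'rV[R]_n) (r : R) :
  open U -> U (c r) -> Ck 1 U f -> is_derive r 1 c dc ->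
  is_derive r 1 (f \o c) ('D_dc f (c r)).
Proof.
move=> oU Ux Cf [/derivable1_diffP cd <-]; have fd := Ck1_differentiable oU Ux Cf.
have D : differentiable (f \o c) r by apply: differentiable_comp.
split; first exact/derivable1_diffP.
rewrite deriveE// diff_comp//= deriveE//.
by rewrite [in RHS]deriveE.
Qed.

End Frechet.

(** * Differentiation under the integral sign *)

Section Functional.
Variable R : realType.

(** What the proof retains of integration over a compact set. Both properties survive iteration, so
    the iterated integral over the coordinate box inherits them from the one over an interval. *)
Record bounded_functional (X : topologicalType) (K : set X) (J : (X -> R) -> R) : Prop := {
  functional_linear : forall c (f g : X -> R), continuous f -> continuous g ->
    J (fun x => c * f x + g x) = c * J f + J g;
  functional_bounded : exists2 C, 0 <= C & forall (f : X -> R) M, continuous f ->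
    (forall x, K x -> `|f x| <= M) -> `|J f| <= C * M
}.

Lemma continuous_mul (T : topologicalType) (f g : T -> R) :
  continuous f -> continuous g -> continuous (fun x => f x * g x).
Proof. by move=> fc gc x; apply: cvgM; [exact: fc|exact: gc]. Qed.

Lemma continuous_cst_mul (T : topologicalType) c (f : T -> R) :
  continuous f -> continuous (fun x => c * f x).
Proof. by apply: continuous_mul; exact: cst_continuous. Qed.

Lemma continuous_sub (T : topologicalType) (f g : T -> R) :
  continuous f -> continuous g -> continuous (fun x => f x - g x).
Proof. by move=> fc gc x; apply: cvgB; [exact: fc|exact: gc]. Qed.

(** Joint continuity at each point of {t0} x K becomes uniform in x by compactness of K. *)
Lemma tube (T X : topologicalType) (K : set X) (F : T -> X -> R) t0 (e : R) :
  compact K -> 0 < e ->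
  (forall x, K x -> {for (t0, x), continuous (fun tx : T * X => F tx.1 tx.2)}) ->
  \forall t \near t0, forall x, K x -> `|F t0 x - F t x| < e.
Proof.
move=> cK e0 Fc.
apply: (@compact_near_coveringP X K).1 => // x Kx.
have e2 : 0 < e / 2 by rewrite divr_gt0.
have /cvgrPdist_lt/(_ _ e2) [[A B] /= [At Bx] AB] := Fc x Kx.
exists (B, A) => // -[y t] [/= By At']; rewrite (splitr e).
have At0 : A t0 by exact: nbhs_singleton.
have /= h1 := AB (t0, y) (conj At0 By); have /= h2 := AB (t, y) (conj At' By).
apply: le_lt_trans (ler_distD (F t0 x) _ _) _.
by rewrite ltrD// distrC.
Qed.

Section Theory.
Variables (X : topologicalType) (K : set X) (J : (X -> R) -> R).
Hypotheses (cK : compact K) (HJ : bounded_functional K J).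

Lemma functional0 : J (fun=> 0) = 0.
Proof.
have := functional_linear HJ 1 (@cst_continuous X R 0) (@cst_continuous X R 0).
rewrite (_ : (fun x => _) = fun=> 0); last by apply/funext => x; rewrite mul1r addr0.
by rewrite mul1r => /eqP; rewrite -subr_eq subrr => /eqP <-.
Qed.

Lemma functionalZ c (f : X -> R) : continuous f -> J (fun x => c * f x) = c * J f.
Proof.
move=> fc; rewrite -[RHS]addr0 -functional0 -(functional_linear HJ _ fc (@cst_continuous X R 0)).
by congr J; apply/funext => x; rewrite addr0.
Qed.

Lemma functionalD (f g : X -> R) : continuous f -> continuous g -> J (fun x => f x + g x) = J f + J g.
Proof.
move=> fc gc; rewrite -[X in _ = X + _]mul1r -(functional_linear HJ _ fc gc).
by congr J; apply/funext => x; rewrite mul1r.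
Qed.

Lemma functionalB (f g : X -> R) : continuous f -> continuous g -> J (fun x => f x - g x) = J f - J g.
Proof.
move=> fc gc; rewrite addrC -mulN1r -(functional_linear HJ _ gc fc).
by congr J; apply/funext => x; rewrite mulN1r addrC.
Qed.

Lemma functional_continuous (T : topologicalType) (f : T -> X -> R) t0 :
  (\forall t \near t0, continuous (f t)) ->
  (forall x, K x -> {for (t0, x), continuous (fun tx : T * X => f tx.1 tx.2)}) ->
  {for t0, continuous (fun t => J (f t))}.
Proof.
move=> fc jc; apply/cvgrPdist_lt => e e0.
have [C C0 HC] := functional_bounded HJ.
(* C may be 0, hence the divisor C + 1. *)
have e1 : 0 < e / (C + 1) by rewrite divr_gt0// ltr_wpDl.
near=> t; have ft : continuous (f t) by near: t.
rewrite -functionalB//; last exact: nbhs_singleton fc.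
apply: (@le_lt_trans _ _ (C * (e / (C + 1)))).
  apply: HC.
    move=> x; apply: continuousB; last exact: ft.
    exact: (nbhs_singleton fc).
  by near: t; have := tube cK e1 jc; apply: filterS => t h x Kx; apply/ltW/h.
by rewrite mulrA ltr_pdivrMr ?ltr_wpDl// mulrC ltr_pM2l// ltrDl.
Unshelve. all: by end_near. Qed.

(** By the mean value theorem in t, the difference quotient at x equals [df] at an intermediate
    time. The tube lemma compares this with [df t0] uniformly on K, and boundedness of J carries the
    estimate through. *)
Lemma functional_derive (f df : R -> X -> R) (t0 : R) :
  (\forall t \near t0, continuous (f t)) ->
  continuous (df t0) ->
  (\forall t \near t0, forall x, K x -> is_derive (t : R) 1 (f^~ x) (df t x)) ->
  (forall x, K x -> {for (t0, x), continuous (fun tx : R * X => df tx.1 tx.2)}) ->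
  is_derive t0 1 (fun t => J (f t)) (J (df t0)).
Proof.
move=> fc dfc fdf jc; have fc0 := nbhs_singleton fc.
suff H : (fun h => h^-1 *: (((fun t => J (f t)) \o shift t0) (h *: 1) - J (f t0))) @ 0^'
     --> J (df t0).
  split; first by apply/cvg_ex; exists (J (df t0)).
  exact/cvg_lim.
apply/cvgrPdist_le => e e0.
have [C C0 HC] := functional_bounded HJ.
have e1 : 0 < e / (C + 1) by rewrite divr_gt0// ltr_wpDl.
have H : \forall t \near t0, [/\ continuous (f t),
   forall x, K x -> is_derive (t : R) 1 (f^~ x) (df t x) &
   forall x, K x -> `|df t0 x - df t x| < e / (C + 1)].
  near=> t; split; [by near: t|by near: t|].
  by near: t; exact: (tube cK e1 jc).
have [d /= d0 dP] := (nbhs_ballP _ _).1 H.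
near=> h; rewrite /= [h *: 1]mulr1.
have h0 : h != 0 by near: h; exact: nbhs_dnbhs_neq.
have hd : `|h| < d by near: h; exact: dnbhs0_lt.
have Hs (s : R) : 0 <= s <= 1 -> ball t0 d (s * h + t0).
  move=> /andP[s0 s1]; rewrite -ball_normE/= opprD addrCA subrr addr0 normrN.
  by apply: le_lt_trans hd; rewrite normrM (ger0_norm s0) ler_piMl.
have [fch _ _] : [/\ continuous (f (h + t0)),
   forall x, K x -> is_derive (h + t0 : R) 1 (f^~ x) (df (h + t0) x) &
   forall x, K x -> `|df t0 x - df (h + t0) x| < e / (C + 1)].
  by rewrite -[h in h + _]mul1r; apply: dP; apply: Hs; rewrite ler01 lexx.
have -> : J (df t0) - h^-1 *: (J (f (h + t0)) - J (f t0)) =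
    J (fun x => df t0 x - h^-1 * (f (h + t0) x - f t0 x)).
  rewrite functionalB//; last first.
    exact/continuous_cst_mul/continuous_sub.
  rewrite functionalZ ?functionalB//.
  exact: continuous_sub.
apply: (@le_trans _ _ (C * (e / (C + 1)))).
  apply: HC.
    by apply: continuous_sub => //; exact/continuous_cst_mul/continuous_sub.
  move=> x Kx.
  have [s s01 sE] : exists2 s : R, 0 <= s <= 1 &
      f (h *: 1 + t0) x - f t0 x = h * 'D_1 (f^~ x) ((s * h) *: 1 + t0).
    apply: (@directional_MVT R R (f^~ x)) => s s01.
    rewrite [_ *: 1]mulr1; have [_ /(_ x Kx) [+ _] _] := dP _ (Hs s s01).
    exact.
  move: sE; rewrite ![_ *: 1]mulr1 => ->; rewrite mulKf//.
  by have [_ /(_ x Kx) [_ ->] /(_ x Kx)/ltW] := dP _ (Hs s s01).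
apply: ltW.
by rewrite mulrA ltr_pdivrMr ?ltr_wpDl// mulrC ltr_pM2l// ltrDl.
Unshelve. all: by end_near. Qed.

End Theory.

(** The inner functional depends continuously on the outer variable, so the outer one can be applied
    to it; the two bounds multiply. *)
Lemma functional_prod (X Y : topologicalType) (K : set X) (L : set Y) I J :
  compact K -> compact L ->
  bounded_functional K I -> bounded_functional L J ->
  bounded_functional (K `*` L) (fun f : X * Y -> R => I (fun x => J (fun y => f (x, y)))).
Proof.
move=> cK cL HI HJ.
have c2 (f : X * Y -> R) x : continuous f -> continuous (fun y => f (x, y)).
  move=> fc y; apply: (@continuous_comp _ _ _ (fun y => (x, y)) f); last exact: fc.
  by apply: cvg_pair; [exact: cvg_cst|exact: cvg_id].
have c1 (f : X * Y -> R) : continuous f -> continuous (fun x => J (fun y => f (x, y))).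
  move=> fc x; apply: (functional_continuous cL HJ (f := fun x y => f (x, y))).
    by near=> t; exact: c2.
  move=> y _; rewrite (_ : (fun tx : X * Y => f (tx.1, tx.2)) = f); first exact: fc.
  by apply/funext => -[].
split.
  move=> c f g fc gc.
  have cf := c1 _ fc; have cg := c1 _ gc.
  rewrite -(functional_linear HI)//; congr I; apply/funext => x.
  by rewrite -(functional_linear HJ)//; exact: c2.
have [C C0 HC] := functional_bounded HI; have [D D0 HD] := functional_bounded HJ.
exists (C * D); first exact: mulr_ge0.
move=> f M fc fM; rewrite -mulrA; apply: HC; first exact: c1.
move=> x Kx; apply: HD; first exact: c2.
by move=> y Ly; exact: fM.
Unshelve. all: by end_near. Qed.

Lemma itv_functional (a b : R) : a <= b ->
  bounded_functional `[a, b]%classic (fun f => \int[lebesgue_measure]_(x in `[a, b]) f x).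
Proof.
move=> ab.
have ig (f : R -> R) : continuous f -> lebesgue_measure.-integrable `[a, b]%classic (EFin \o f).
  move=> fc; apply: continuous_compact_integrable; first exact: segment_compact.
  exact: continuous_subspaceT.
split.
  move=> c f g fc gc.
  have ifc : lebesgue_measure.-integrable `[a, b]%classic (EFin \o (fun x => c * f x)).
    exact/ig/continuous_cst_mul.
  by rewrite RintegralD ?RintegralZl//; exact: ig.
exists (b - a); first by rewrite subr_ge0.
move=> f M fc fM.
apply: le_trans (le_normr_Rintegral _ (ig _ fc)) _ => //.
apply: (@le_trans _ _ (\int[lebesgue_measure]_(x in `[a, b]) M)).
  apply: le_Rintegral => //.
  - by apply: (ig (fun x => `|f x|)) => x; apply: continuous_comp; [exact: fc|exact: norm_continuous].
  - by apply: (ig (cst M)) => x; exact: cst_continuous.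
rewrite Rintegral_cst//.
rewrite [X in fine X](_ : _ = (b - a)%:E); last first.
  apply: etrans (lebesgue_measure_itv `[a, b]) _; rewrite /= lte_fin EFinB.
  by case: ltgtP ab => // [<- _]; rewrite -EFinB subrr.
by rewrite mulrC.
Qed.

Lemma FTC (a b : R) (F f : R -> R) : a < b -> continuous f ->
  (forall x : R, is_derive x 1 F (f x)) ->
  \int[lebesgue_measure]_(x in `[a, b]) f x = F b - F a.
Proof.
move=> ab fc dF.
have Fc : continuous F.
  by move=> x; apply/differentiable_continuous/derivable1_diffP; have [] := dF x.
rewrite /Rintegral (continuous_FTC2 ab (F := F)) ?EFinB//.
- exact: continuous_subspaceT.
- split.
  + by move=> x _; have [] := dF x.
  + by apply: cvg_at_right_filter; exact: Fc.
  + by apply: cvg_at_left_filter; exact: Fc.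
- by move=> x _; rewrite derive1E; have [_ ->] := dF x.
Qed.

End Functional.

(** * The quaternionic frame of the sphere *)

Section Coord.
Variable R : realType.
Notation R4 := 'rV[R]_4.

(** Indexing by nat through [inord] follows the definition of [J], so that [JE] holds by
    computation. *)
Definition crd (k : nat) (u : R4) : R^o := u ord0 (inord k).

Lemma crd_is_linear k : linear (crd k).
Proof. by move=> a u v; rewrite /crd !mxE. Qed.
HB.instance Definition _ k := GRing.isLinear.Build R R4 R^o _ (crd k) (crd_is_linear k).

Lemma inord4 (i : 'I_4) : [\/ i = inord 0, i = inord 1, i = inord 2 | i = inord 3].
Proof.
by case: i => -[|[|[|[|//]]]] Hi; [constructor 1|constructor 2|constructor 3|constructor 4];
  apply/val_inj; rewrite /= inordK.
Qed.

Lemma row4P (u v : R4) : crd 0 u = crd 0 v -> crd 1 u = crd 1 v -> crd 2 u = crd 2 v ->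
  crd 3 u = crd 3 v -> u = v.
Proof. by move=> h0 h1 h2 h3; apply/rowP => i; case: (inord4 i) => ->. Qed.

Lemma big_ord4 (V : zmodType) (F : 'I_4 -> V) :
  \sum_(i < 4) F i = F (inord 0) + F (inord 1) + F (inord 2) + F (inord 3).
Proof.
rewrite 4!big_ord_recl big_ord0 addr0 !addrA.
by congr (F _ + F _ + F _ + F _); apply/val_inj; rewrite /= inordK.
Qed.

Lemma dotE (u v : R4) : dot u v = crd 0 u * crd 0 v + crd 1 u * crd 1 v +
  crd 2 u * crd 2 v + crd 3 u * crd 3 v.
Proof. by rewrite /dot big_ord4. Qed.

Definition row4 (a b c d : R) : R4 := \row_(i < 4) [:: a; b; c; d]`_i.

Lemma crd_row4 a b c d : (crd 0 (row4 a b c d) = a) * (crd 1 (row4 a b c d) = b) *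
  (crd 2 (row4 a b c d) = c) * (crd 3 (row4 a b c d) = d).
Proof. by rewrite /crd /row4 !mxE !inordK. Qed.

Lemma crdD k u v : crd k (u + v) = crd k u + crd k v. Proof. exact: raddfD. Qed.
Lemma crdB k u v : crd k (u - v) = crd k u - crd k v. Proof. exact: raddfB. Qed.
Lemma crdN k u : crd k (- u) = - crd k u. Proof. exact: raddfN. Qed.
Lemma crdZ k (a : R) u : crd k (a *: u) = a * crd k u. Proof. by rewrite /crd mxE. Qed.
Lemma crd0 k : crd k 0 = 0. Proof. exact: raddf0. Qed.

(** The other quaternion units: with u = (z, w), [J2 u] is (- conj w, conj z), and [J3] is [J] after
    [J2]. Together with [J] they give a global orthonormal frame of linear fields. *)
Definition J2 (u : R4) : R4 := row4 (- crd 2 u) (crd 3 u) (crd 0 u) (- crd 1 u).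
Definition J3 (u : R4) : R4 := row4 (- crd 3 u) (- crd 2 u) (crd 1 u) (crd 0 u).

Lemma JE u : J u = row4 (- crd 1 u) (crd 0 u) (- crd 3 u) (crd 2 u). Proof. by []. Qed.

Definition crdE := (crdD, crdB, crdN, crdZ, crd0, crd_row4).

Lemma J_is_linear : linear (@J R).
Proof. by move=> a u v; rewrite !JE; apply: row4P; rewrite !crdE; ring. Qed.
Lemma J2_is_linear : linear J2.
Proof. by move=> a u v; apply: row4P; rewrite /J2 !crdE; ring. Qed.
Lemma J3_is_linear : linear J3.
Proof. by move=> a u v; apply: row4P; rewrite /J3 !crdE; ring. Qed.
HB.instance Definition _ := GRing.isLinear.Build R R4 R4 _ (@J R) J_is_linear.
HB.instance Definition _ := GRing.isLinear.Build R R4 R4 _ J2 J2_is_linear.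
HB.instance Definition _ := GRing.isLinear.Build R R4 R4 _ J3 J3_is_linear.

Lemma dotC (u v : R4) : dot u v = dot v u. Proof. by rewrite !dotE; ring. Qed.
Lemma dotDl (u v w : R4) : dot (u + v) w = dot u w + dot v w.
Proof. by rewrite !dotE !crdE; ring. Qed.
Lemma dotZl (a : R) (u w : R4) : dot (a *: u) w = a * dot u w.
Proof. by rewrite !dotE !crdE; ring. Qed.
Lemma dotBl (u v w : R4) : dot (u - v) w = dot u w - dot v w.
Proof. by rewrite !dotE !crdE; ring. Qed.
Lemma dotNl (u w : R4) : dot (- u) w = - dot u w.
Proof. by rewrite !dotE !crdE; ring. Qed.
Lemma dotDr (u v w : R4) : dot w (u + v) = dot w u + dot w v.
Proof. by rewrite !dotE !crdE; ring. Qed.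
Lemma dotZr (a : R) (u w : R4) : dot w (a *: u) = a * dot w u.
Proof. by rewrite !dotE !crdE; ring. Qed.
Lemma dot0l (w : R4) : dot 0 w = 0. Proof. by rewrite !dotE !crdE; ring. Qed.

Lemma dot_frame (u : R4) : (dot (J u) (J u) = dot u u) * (dot (J2 u) (J2 u) = dot u u) *
  (dot (J3 u) (J3 u) = dot u u) * (dot u (J u) = 0) * (dot u (J2 u) = 0) * (dot u (J3 u) = 0) *
  (dot (J u) (J2 u) = 0) * (dot (J u) (J3 u) = 0) * (dot (J2 u) (J3 u) = 0) *
  (dot (J u) u = 0) * (dot (J2 u) u = 0) * (dot (J3 u) u = 0) *
  (dot (J2 u) (J u) = 0) * (dot (J3 u) (J u) = 0) * (dot (J3 u) (J2 u) = 0).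
Proof. by rewrite !dotE !JE /J2 /J3 !crdE; do !split; ring. Qed.

Lemma J_mul (u : R4) : (J (J u) = - u) * (J2 (J2 u) = - u) * (J3 (J3 u) = - u) *
  (J (J2 u) = J3 u) * (J2 (J u) = - J3 u) * (J2 (J3 u) = J u) * (J3 (J2 u) = - J u) *
  (J3 (J u) = J2 u) * (J (J3 u) = - J2 u).
Proof. by do !split; apply: row4P; rewrite ?JE /J2 /J3 !crdE; ring. Qed.

(** The factor |p|^2 makes this a polynomial identity at every point, provable by [ring] without the
    equation of the sphere. *)
Lemma frame_expansion (p v : R4) : dot p p *: v =
  dot v p *: p + dot v (J p) *: J p + dot v (J2 p) *: J2 p + dot v (J3 p) *: J3 p.
Proof. by apply: row4P; rewrite !dotE !JE /J2 /J3 !crdE; ring. Qed.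

Lemma tangent_expansion (p v : R4) : S3 p -> tangent p v ->
  v = dot v (J p) *: J p + dot v (J2 p) *: J2 p + dot v (J3 p) *: J3 p.
Proof.
move=> Sp; rewrite /tangent dotC => tv; have := frame_expansion p v.
by rewrite Sp tv scale1r scale0r add0r.
Qed.

(** The Berger metric is the round metric plus (mu - 1) times the square of the 1-form dual to V. *)
Lemma bergerE mu (p u v : R4) : S3 p ->
  berger mu p u v = dot u v + (mu - 1) * (dot u (J p) * dot v (J p)).
Proof.
move=> Sp; rewrite /berger /horizontal /hopf !(dotBl, dotZl) ![dot _ (_ - _)]dotC.
by rewrite !(dotBl, dotZl) dot_frame Sp (dotC (J p)) (dotC v u); ring.
Qed.

Lemma dot_tangent (p u v : R4) : S3 p -> tangent p u ->
  dot u v = dot u (J p) * dot v (J p) + dot u (J2 p) * dot v (J2 p) + dot u (J3 p) * dot v (J3 p).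
Proof.
move=> Sp tu; rewrite [in LHS](tangent_expansion Sp tu) !(dotDl, dotZl).
by rewrite !(dotC v).
Qed.

Lemma berger_frame mu (p u v : R4) : S3 p -> tangent p u ->
  berger mu p u v = mu * (dot u (J p) * dot v (J p)) + dot u (J2 p) * dot v (J2 p)
     + dot u (J3 p) * dot v (J3 p).
Proof. by move=> Sp tu; rewrite bergerE// (dot_tangent v Sp tu); ring. Qed.

Lemma tangent_frame (p : R4) : tangent p (J p) * tangent p (J2 p) * tangent p (J3 p).
Proof. by rewrite /tangent !dot_frame. Qed.

Lemma tangentD (p u v : R4) : tangent p u -> tangent p v -> tangent p (u + v).
Proof. by rewrite /tangent dotDr => -> ->; rewrite addr0. Qed.

Lemma tangentZ (p u : R4) a : tangent p u -> tangent p (a *: u).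
Proof. by rewrite /tangent dotZr => ->; rewrite mulr0. Qed.

Lemma berger_linl mu (p u v w : R4) a : berger mu p (a *: u + v) w = a * berger mu p u w + berger mu p v w.
Proof.
rewrite /berger /horizontal /hopf !dotE !JE !crdE; ring.
Qed.

Lemma berger_linr mu (p u v w : R4) a : berger mu p w (a *: u + v) = a * berger mu p w u + berger mu p w v.
Proof.
rewrite /berger /horizontal /hopf !dotE !JE !crdE; ring.
Qed.

Lemma dot_gt0 (p : R4) : p != 0 -> 0 < dot p p.
Proof.
move=> p0; rewrite lt_neqAle; apply/andP; split; last first.
  by rewrite dotE; do ?apply: addr_ge0; rewrite -expr2 sqr_ge0.
rewrite eq_sym; apply: contra_neq p0; rewrite dotE => h.
apply: row4P; rewrite crd0; apply/eqP; rewrite -sqrf_eq0;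
  move: (sqr_ge0 (crd 0 p)) (sqr_ge0 (crd 1 p)) (sqr_ge0 (crd 2 p)) (sqr_ge0 (crd 3 p));
  move: h; rewrite -!expr2; move: (_ ^+ 2) (_ ^+ 2) (_ ^+ 2) (_ ^+ 2) => a b c d *; apply/eqP; lra.
Qed.

Lemma S3_neq0 (p : R4) : S3 p -> p != 0.
Proof. by move=> Sp; apply/eqP => p0; move: Sp; rewrite p0 /S3/= dot0l => /eqP; rewrite eq_sym oner_eq0. Qed.

Lemma S3_radial (p : R4) : p != 0 -> S3 (radial p).
Proof.
move=> /dot_gt0 p0; rewrite /S3/= /radial dotZl dotZr mulrA -expr2 exprVn sqr_sqrtr ?ltW//.
by rewrite mulVf// gt_eqF.
Qed.

Lemma radial_id (p : R4) : S3 p -> radial p = p.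
Proof. by rewrite /radial => ->; rewrite sqrtr1 invr1 scale1r. Qed.

End Coord.

(** * Smooth maps into R^4 and calculus on the sphere through radial extensions *)

Lemma linear_rV_continuous (R : realType) n (W : normedModType R) (L : {linear 'rV[R]_n -> W}) :
  continuous L.
Proof.
have -> : (L : 'rV[R]_n -> W) = fun u => \sum_i u ord0 i *: L (delta_mx ord0 i).
  apply/funext => u; rewrite {1}(row_sum_delta u) linear_sum.
  by apply: eq_bigr => i _; rewrite linearZ.
move=> u; apply: continuous_at_sum => i _.
apply: (@continuous_comp _ _ _ (fun u : 'rV[R]_n => u ord0 i) (fun c : R => c *: L (delta_mx ord0 i))).
  exact: coord_continuous.
exact: scalel_continuous.
Qed.

Lemma is_derive_lin (R : realType) (V W W' : normedModType R) (f : V -> W) (L : {linear W -> W'}) x v df :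
  continuous L -> is_derive x v f df -> is_derive x v (L \o f) (L df).
Proof.
move=> Lc [/cvg_ex[l fl] <-].
suff k : (fun h => h^-1 *: (((L \o f) \o shift x) (h *: v) - (L \o f) x)) @ 0^'
      --> L ('D_v f x).
  by split; [apply/cvg_ex; exists (L ('D_v f x))|exact/cvg_lim].
rewrite (_ : (fun h => _) = L \o (fun h => h^-1 *: ((f \o shift x) (h *: v) - f x))).
  by apply: continuous_cvg; [exact: Lc|apply/cvg_ex; exists l].
by apply/funext => h; rewrite /= linearZ_LR (raddfB L).
Qed.

Lemma is_derive_mul (R : realType) (V : normedModType R) (f g : V -> R) x v df dg :
  is_derive x v f df -> is_derive x v g dg ->
  is_derive x v (fun y => f y * g y) (df * g x + f x * dg).
Proof.
move=> hf hg; have := is_deriveM hf hg.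
by rewrite [_ *: dg + _]addrC (mulrC df).
Qed.

Section Smooth.
Variable R : realType.
Notation R4 := 'rV[R]_4.
Implicit Types V W : normedModType R.

Lemma Ck_id V n (U : set V) : Ck n U id.
Proof.
case: n => [|n]; first by split=> // x _; exact: cvg_id.
split=> [x _|v]; first exact: cvg_id.
split=> [x _|]; first exact: derivable_id.
by rewrite (_ : 'D_v id = cst v); [exact: Ck_cst|apply/funext => x; rewrite derive_id].
Qed.

Lemma Ck_linear V W n (U : set V) (L : {linear V -> W}) : open U -> continuous L -> Ck n U L.
Proof. by move=> oU Lc; apply: (Ck_lin oU Lc (@Ck_id V n U)). Qed.

(** Multiplication of a fixed vector as a linear map of the scalar; with it a map into R^4 is
    reassembled from its coordinates. *)
Definition scale_by (W : normedModType R) (w : W) (c : R^o) : W := c *: w.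
Lemma scale_by_is_linear W (w : W) : linear (scale_by w).
Proof. by move=> a c d; rewrite /scale_by scalerDl scalerA. Qed.
HB.instance Definition _ W (w : W) := GRing.isLinear.Build R R^o W _ (scale_by w) (scale_by_is_linear w).
Lemma scale_by_continuous W (w : W) : continuous (scale_by w).
Proof. by move=> c; apply: cvgZr_tmp; exact: cvg_id. Qed.

Lemma Ck_sum V W n (U : set V) I (r : seq I) (f : I -> V -> W) : open U ->
  (forall i, Ck n U (f i)) -> Ck n U (fun x => \sum_(i <- r) f i x).
Proof.
move=> oU Cf; elim: r => [|i r IH].
  rewrite (_ : (fun _ => _) = cst 0); first exact: Ck_cst.
  by apply/funext => x; rewrite big_nil.
rewrite (_ : (fun _ => _) = f i \+ (fun x => \sum_(i <- r) f i x)); first exact: CkD.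
by apply/funext => x; rewrite big_cons.
Qed.

Lemma crd_continuous k : continuous (@crd R k).
Proof. exact: linear_rV_continuous. Qed.

Lemma row4_sum (u : R4) : u = \sum_(k < 4) crd k u *: delta_mx ord0 (inord k).
Proof.
rewrite {1}(row_sum_delta u); apply: eq_bigr => i _; rewrite /crd.
by rewrite inord_val.
Qed.

Lemma Ck_row V n (U : set V) (f : V -> R4) : open U ->
  (forall k, (k < 4)%N -> Ck n U (crd k \o f)) -> Ck n U f.
Proof.
move=> oU Cf.
have -> : f = fun x => \sum_(k < 4) scale_by (delta_mx ord0 (inord k) : R4) (crd k (f x)).
  by apply/funext => x; rewrite {1}(row4_sum (f x)).
apply: Ck_sum => // k.
apply: (Ck_lin (L := scale_by (delta_mx ord0 (inord k) : R4)) oU (@scale_by_continuous _ _)).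
exact: Cf.
Qed.

Lemma is_derive_row V (f : V -> R4) x v df :
  (forall k, (k < 4)%N -> is_derive x v (crd k \o f) (crd k df)) -> is_derive x v f df.
Proof.
move=> Cf.
have H (k : 'I_4) : is_derive x v (scale_by (delta_mx ord0 (inord k) : R4) \o (crd k \o f))
    (crd k df *: (delta_mx ord0 (inord k) : R4)).
  apply: (is_derive_lin (L := scale_by (delta_mx ord0 (inord k) : R4))).
    exact: scale_by_continuous.
  exact: Cf.
have := is_derive_sum H; rewrite -row4_sum.
rewrite (_ : \sum_k _ = f)//; apply/funext => y; rewrite fct_sumE [RHS]row4_sum.
by [].
Qed.

Lemma Ck_crd V n (U : set V) k (f : V -> R4) : open U -> Ck n U f -> Ck n U (crd k \o f).
Proof. by move=> oU Cf; apply: (Ck_lin (L := crd k) oU (@crd_continuous k)). Qed.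

Lemma Ck_linear_comp V W n (U : set V) (L : {linear R4 -> W}) (f : V -> R4) :
  open U -> Ck n U f -> Ck n U (L \o f).
Proof. by move=> oU Cf; apply: Ck_lin => //; exact: linear_rV_continuous. Qed.

Lemma Ck_dot V n (U : set V) (f g : V -> R4) : open U -> Ck n U f -> Ck n U g ->
  Ck n U (fun x => dot (f x) (g x) : R^o).
Proof.
move=> oU Cf Cg.
rewrite (_ : (fun x => _) = fun x => \sum_(k < 4) (crd k (f x) * crd k (g x) : R^o)).
  by apply: Ck_sum => // k; apply: CkM => //; exact: Ck_crd.
by apply/funext => x; rewrite /dot; apply: eq_bigr => i _; rewrite /crd inord_val.
Qed.

Lemma Ck_scale V n (U : set V) (f : V -> R^o) (g : V -> R4) : open U -> Ck n U f -> Ck n U g ->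
  Ck n U (fun x => f x *: g x).
Proof.
move=> oU Cf Cg; apply: Ck_row => // k _.
rewrite (_ : _ \o _ = fun x => f x * crd k (g x) : R^o).
  by apply: CkM => //; exact: Ck_crd.
by apply/funext => x; rewrite /= crdZ.
Qed.

Lemma open_neq0 : open [set p : R4 | p != 0].
Proof.
rewrite (_ : [set p | _] = ~` [set 0]).
  by apply: closed_openC; exact: accessible_closed_set1 (hausdorff_accessible _) _.
by apply/seteqP; split=> p /eqP.
Qed.

Lemma radialE (p : R4) : p != 0 -> radial p = (dot p p) `^ (- 2^-1) *: p.
Proof.
by move=> /dot_gt0 p0; rewrite /radial powRN powR12_sqrt// ltW.
Qed.

Lemma Ck_dotpp n : Ck n [set p : R4 | p != 0] (fun p => (dot p p) `^ (- 2^-1) : R^o).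
Proof.
apply: (Ck_comp (O := [set x | 0 < x]) (f := fun p : R4 => dot p p : R^o) open_neq0 _ (Ck_powR n _)).
  by move=> p; exact: dot_gt0.
by apply: (@Ck_dot _ n _ id id open_neq0); exact: Ck_id.
Qed.

Lemma smooth_radial : smooth [set p : R4 | p != 0] (@radial R).
Proof.
move=> n; apply: (eq_Ck open_neq0 (f := fun p => (dot p p) `^ (- 2^-1) *: p)).
  by move=> p p0; rewrite radialE.
apply: Ck_scale; [exact: open_neq0|exact: Ck_dotpp|exact: Ck_id].
Qed.

Lemma is_derive_dot V (f g : V -> R4) x v df dg : is_derive x v f df -> is_derive x v g dg ->
  is_derive x v (fun y => dot (f y) (g y)) (dot df (g x) + dot (f x) dg).
Proof.
move=> hf hg.
rewrite (_ : (fun y => _) = \sum_(k < 4) (fun y => crd k (f y) * crd k (g y))); last first.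
  by apply/funext => y; rewrite fct_sumE /dot; apply: eq_bigr => i _; rewrite /crd inord_val.
rewrite (_ : dot _ _ + _ = \sum_(k < 4) (crd k df * crd k (g x) + crd k (f x) * crd k dg)); last first.
  by rewrite big_split/=; congr (_ + _); rewrite /dot; apply: eq_bigr => i _; rewrite /crd inord_val.
apply: is_derive_sum => k.
by apply: is_derive_mul; apply: (is_derive_lin (L := crd k)) => //; exact: crd_continuous.
Qed.

(** For tangent [v] the derivative of |p|^2 is 2 p.v = 0, so the normalising factor is stationary
    and the radial projection acts on tangent vectors as the identity. *)
Lemma is_derive_radial (p v : R4) : S3 p -> tangent p v -> is_derive p v (@radial R) v.
Proof.
move=> Sp tv; have p0 := S3_neq0 Sp.
apply: (near_eq_is_derive (f := fun p => (dot p p) `^ (- 2^-1) *: p)).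
  apply: (filterS _ (open_nbhs_nbhs (conj open_neq0 p0))) => q q0.
  by rewrite radialE.
have D : is_derive p v (fun p => (dot p p) `^ (- 2^-1)) 0.
  have D0 : is_derive p v (fun p : R4 => dot p p) 0.
    have := is_derive_dot (is_derive_id p v) (is_derive_id p v).
    by rewrite (dotC v) tv addr0.
  have D1 := is_derive1_powR (- 2^-1) (dot_gt0 p0).
  by have := is_derive_comp D0 D1; rewrite mulr0.
apply: is_derive_row => k _.
rewrite (_ : _ \o _ = fun q => (dot q q) `^ (- 2^-1) * crd k q); last first.
  by apply/funext => q /=; rewrite crdZ.
have := is_derive_mul D (is_derive_lin (@crd_continuous k) (is_derive_id p v)).
by rewrite mul0r add0r Sp powR1 mul1r.
Qed.

Lemma smooth_linear (W : normedModType R) (L : {linear R4 -> W}) : smooth_on_S3 L.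
Proof. by move=> n; apply: Ck_linear_comp; [exact: open_neq0|exact: smooth_radial]. Qed.

Lemma dS3_linear (W : normedModType R) (L : {linear R4 -> W}) p v : S3 p -> tangent p v -> dS3 L p v = L v.
Proof.
move=> Sp tv.
by have [_] := is_derive_lin (@linear_rV_continuous _ _ _ L) (is_derive_radial Sp tv).
Qed.

Lemma eq_dS3 (W : normedModType R) (f g : R4 -> W) p v : S3 p ->
  (forall q, S3 q -> f q = g q) -> dS3 f p v = dS3 g p v.
Proof.
move=> Sp fg; apply: near_eq_derive.
apply: (filterS _ (open_nbhs_nbhs (conj open_neq0 (S3_neq0 Sp)))) => q q0 /=.
by rewrite fg//; exact: S3_radial.
Qed.

Lemma dS3_cst (W : normedModType R) (f : R4 -> W) (c : W) p v : S3 p ->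
  (forall q, S3 q -> f q = c) -> dS3 f p v = 0.
Proof. by move=> Sp fc; rewrite (eq_dS3 (g := cst c) v Sp fc) /dS3 derive_cst. Qed.

Lemma vector_field_J : vector_field (@J R).
Proof. by split; [exact: smooth_linear|move=> p _; rewrite /tangent !dot_frame]. Qed.
Lemma vector_field_J2 : vector_field (@J2 R).
Proof. by split; [exact: smooth_linear|move=> p _; rewrite /tangent !dot_frame]. Qed.
Lemma vector_field_J3 : vector_field (@J3 R).
Proof. by split; [exact: smooth_linear|move=> p _; rewrite /tangent !dot_frame]. Qed.

Lemma smooth_dot (X Y : R4 -> R4) : smooth_on_S3 X -> smooth_on_S3 Y ->
  smooth_on_S3 (fun q => dot (X q) (Y q) : R^o).
Proof. by move=> sX sY n; apply: Ck_dot; [exact: open_neq0|exact: sX|exact: sY]. Qed.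

End Smooth.

(** * The Levi-Civita connection of the Berger metric *)

Section VectorFields.
Variable R : realType.
Notation R4 := 'rV[R]_4.

Lemma vector_fieldZ (f : R4 -> R^o) (X : R4 -> R4) : smooth_on_S3 f -> vector_field X ->
  vector_field (fun q => f q *: X q).
Proof.
move=> sf [sX tX]; split=> [n|p Sp]; last by apply: tangentZ; exact: tX.
by apply: Ck_scale; [exact: open_neq0|exact: sf|exact: sX].
Qed.

Lemma vector_fieldD (X Y : R4 -> R4) : vector_field X -> vector_field Y ->
  vector_field (fun q => X q + Y q).
Proof.
move=> [sX tX] [sY tY]; split=> [n|p Sp]; last by apply: tangentD; [exact: tX|exact: tY].
by apply: (CkD (f := X \o _) (g := Y \o _)); [exact: open_neq0|exact: sX|exact: sY].
Qed.

End VectorFields.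

Section Connection.
Variables (R : realType) (mu : R) (nabla : ('rV[R]_4 -> 'rV[R]_4) -> 'rV[R]_4 -> 'rV[R]_4 -> 'rV[R]_4).
Hypotheses (mu_gt0 : 0 < mu) (Hn : levi_civita mu nabla).
Notation R4 := 'rV[R]_4.
Let Hc := levi_civita_connection Hn.

(* The indicator function of S3 has a constant radial extension, so Leibniz' rule
   lets one replace X by a field supported on S3. *)
Lemma nabla_local (X Y : R4 -> R4) p v : vector_field X -> vector_field Y ->
  (forall q, S3 q -> X q = Y q) -> S3 p -> tangent p v -> nabla X p v = nabla Y p v.
Proof.
move=> vX vY XY Sp tv.
pose chi (q : R4) : R^o := if `[< S3 q >] then 1 else 0.
have chi1 q : S3 q -> chi q = 1 by move=> Sq; rewrite /chi asboolT.
have schi : smooth_on_S3 chi.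
  move=> n; apply: (eq_Ck (@open_neq0 R) _ (@Ck_cst R _ R^o n _ (1 : R))) => q q0 /=.
  by rewrite chi1//; exact: S3_radial.
have E Z : vector_field Z -> nabla (fun q => chi q *: Z q) p v = nabla Z p v.
  move=> vZ; rewrite (connection_leibniz Hc)// chi1//.
  by rewrite (dS3_cst v Sp chi1) scale0r add0r scale1r.
rewrite -(E X)// -(E Y)//; congr (nabla _ p v); apply/funext => q.
by rewrite /chi; case: asboolP => [/XY ->//|_]; rewrite !scale0r.
Qed.

(** The mutual products being constant on the sphere, the three derivative terms of the Koszul
    formula vanish. For linear fields the bracket of X and Y is Y X - X Y, which leaves a purely
    algebraic right-hand side. *)
Lemma koszul (X Y Z : {linear R4 -> R4}) (a b c : R) p :
  vector_field X -> vector_field Y -> vector_field Z ->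
  (forall q, S3 q -> berger mu q (X q) (Y q) = a) ->
  (forall q, S3 q -> berger mu q (Y q) (Z q) = b) ->
  (forall q, S3 q -> berger mu q (Z q) (X q) = c) -> S3 p ->
  2 * berger mu p (nabla Y p (X p)) (Z p) =
  berger mu p (Y (X p) - X (Y p)) (Z p) - berger mu p (Z (Y p) - Y (Z p)) (X p)
  + berger mu p (X (Z p) - Z (X p)) (Y p).
Proof.
move=> vX vY vZ hXY hYZ hZX Sp.
have bC u v : berger mu p u v = berger mu p v u.
  by rewrite !bergerE// dotC [dot u (J p) * _]mulrC.
have bB u v w : berger mu p (u - v) w = berger mu p u w - berger mu p v w.
  by rewrite addrC -scaleN1r berger_linl mulN1r addrC.
have T (A B : {linear R4 -> R4}) : vector_field A -> vector_field B ->
    B (A p) - A (B p) = nabla B p (A p) - nabla A p (B p).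
  move=> vA vB; rewrite (levi_civita_torsion_free Hn)// /lie_bracket.
  by rewrite !dS3_linear//; [apply vB|apply vA].
have M (A B C : {linear R4 -> R4}) d : vector_field A -> vector_field B -> vector_field C ->
    (forall q, S3 q -> berger mu q (B q) (C q) = d) ->
    berger mu p (nabla B p (A p)) (C p) + berger mu p (nabla C p (A p)) (B p) = 0.
  move=> vA vB vC hd; rewrite [X in _ + X]bC -(levi_civita_metric Hn)//; last by apply vA.
  exact: (@dS3_cst _ _ _ (d : R^o)).
rewrite (T X Y)// (T Y Z)// (T Z X)// !bB.
have hYX q : S3 q -> berger mu q (Y q) (X q) = a.
  by move=> Sq; rewrite -(hXY q Sq) !bergerE// dotC [dot (X q) (J q) * _]mulrC.
have m1 := M X Y Z b vX vY vZ hYZ.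
have m2 := M Y Z X c vY vZ vX hZX.
have m3 := M Z X Y a vZ vX vY hXY.
(* Torsion-freeness has already replaced the brackets. In the six products that remain, the claim is
   a linear combination of the three metric relations. *)
move: m1 m2 m3.
move: (berger mu p (nabla Y p (X p)) (Z p)) (berger mu p (nabla Z p (X p)) (Y p))
 (berger mu p (nabla Z p (Y p)) (X p)) (berger mu p (nabla X p (Y p)) (Z p))
 (berger mu p (nabla X p (Z p)) (Y p)) (berger mu p (nabla Y p (Z p)) (X p)) => *; lra.
Qed.

Lemma tangent_ext p u w : S3 p -> tangent p u -> tangent p w ->
  berger mu p u (J p) = berger mu p w (J p) ->
  berger mu p u (J2 p) = berger mu p w (J2 p) ->
  berger mu p u (J3 p) = berger mu p w (J3 p) -> u = w.
Proof.
move=> Sp tu tw.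
rewrite !(berger_frame _ _ Sp)// !dot_frame Sp !(mulr0, mulr1, addr0, add0r) => /(mulfI _) h0 h1 h2.
by rewrite (tangent_expansion Sp tu) (tangent_expansion Sp tw) h0 ?h1 ?h2// gt_eqF.
Qed.

Lemma berger_JJ q : S3 q -> berger mu q (J q) (J q) = mu.
Proof. by move=> Sq; rewrite bergerE// !dot_frame Sq; ring. Qed.
Lemma berger_J2J2 q : S3 q -> berger mu q (J2 q) (J2 q) = 1.
Proof. by move=> Sq; rewrite bergerE// !dot_frame Sq; ring. Qed.
Lemma berger_J3J3 q : S3 q -> berger mu q (J3 q) (J3 q) = 1.
Proof. by move=> Sq; rewrite bergerE// !dot_frame Sq; ring. Qed.
Lemma berger_JJ2 q : S3 q -> berger mu q (J q) (J2 q) = 0.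
Proof. by move=> Sq; rewrite bergerE// !dot_frame; ring. Qed.
Lemma berger_J2J q : S3 q -> berger mu q (J2 q) (J q) = 0.
Proof. by move=> Sq; rewrite bergerE// !dot_frame; ring. Qed.
Lemma berger_JJ3 q : S3 q -> berger mu q (J q) (J3 q) = 0.
Proof. by move=> Sq; rewrite bergerE// !dot_frame; ring. Qed.
Lemma berger_J3J q : S3 q -> berger mu q (J3 q) (J q) = 0.
Proof. by move=> Sq; rewrite bergerE// !dot_frame; ring. Qed.
Lemma berger_J2J3 q : S3 q -> berger mu q (J2 q) (J3 q) = 0.
Proof. by move=> Sq; rewrite bergerE// !dot_frame; ring. Qed.
Lemma berger_J3J2 q : S3 q -> berger mu q (J3 q) (J2 q) = 0.
Proof. by move=> Sq; rewrite bergerE// !dot_frame; ring. Qed.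

Let two_neq0 : 2 != 0 :> R. Proof. by rewrite pnatr_eq0. Qed.

Ltac frame_const :=
  first [exact: berger_JJ|exact: berger_J2J2|exact: berger_J3J3|exact: berger_JJ2
        |exact: berger_J2J|exact: berger_JJ3|exact: berger_J3J|exact: berger_J2J3|exact: berger_J3J2].

Ltac frame_field := first [exact: vector_field_J|exact: vector_field_J2|exact: vector_field_J3].

(** A tangent vector is determined by its products with the three frame fields. Each product is
    multiplied by 2 and evaluated with [koszul], whose constants are found by unification. *)
Ltac koszul_frame Y X Sp :=
  apply: (tangent_ext Sp);
  [ by apply: (connection_smooth Hc (X := Y) (Y := X) _ _).2 => //; frame_field
  | by rewrite /tangent ?dotZr ?[dot _ 0]dotC ?dot0l ?dot_frame ?mulr0
  | apply: (mulfI (two_neq0)); etransitivity; [eapply (@koszul X Y (@J R));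
    [frame_field|frame_field|frame_field|frame_const|frame_const|frame_const|exact: Sp]|]
  | apply: (mulfI (two_neq0)); etransitivity; [eapply (@koszul X Y (@J2 R));
    [frame_field|frame_field|frame_field|frame_const|frame_const|frame_const|exact: Sp]|]
  | apply: (mulfI (two_neq0)); etransitivity; [eapply (@koszul X Y (@J3 R));
    [frame_field|frame_field|frame_field|frame_const|frame_const|frame_const|exact: Sp]|] ];
  rewrite /= ?J_mul !(bergerE _ _ _ Sp) !(dotBl, dotDl, dotZl, dotNl, dot0l) !dot_frame ?Sp; ring.

Lemma nabla_J_J p : S3 p -> nabla (@J R) p (J p) = 0.
Proof. move=> Sp; koszul_frame (@J R) (@J R) Sp. Qed.

Lemma nabla_J2_J p : S3 p -> nabla (@J2 R) p (J p) = (mu - 2) *: J3 p.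
Proof. move=> Sp; koszul_frame (@J2 R) (@J R) Sp. Qed.

Lemma nabla_J3_J p : S3 p -> nabla (@J3 R) p (J p) = (2 - mu) *: J2 p.
Proof. move=> Sp; koszul_frame (@J3 R) (@J R) Sp. Qed.

Lemma nabla_J_J2 p : S3 p -> nabla (@J R) p (J2 p) = mu *: J3 p.
Proof. move=> Sp; koszul_frame (@J R) (@J2 R) Sp. Qed.

Lemma nabla_J2_J2 p : S3 p -> nabla (@J2 R) p (J2 p) = 0.
Proof. move=> Sp; koszul_frame (@J2 R) (@J2 R) Sp. Qed.

Lemma nabla_J3_J2 p : S3 p -> nabla (@J3 R) p (J2 p) = (-1) *: J p.
Proof. move=> Sp; koszul_frame (@J3 R) (@J2 R) Sp. Qed.

Lemma nabla_J_J3 p : S3 p -> nabla (@J R) p (J3 p) = (- mu) *: J2 p.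
Proof. move=> Sp; koszul_frame (@J R) (@J3 R) Sp. Qed.

Lemma nabla_J2_J3 p : S3 p -> nabla (@J2 R) p (J3 p) = 1 *: J p.
Proof. move=> Sp; koszul_frame (@J2 R) (@J3 R) Sp. Qed.

Lemma nabla_J3_J3 p : S3 p -> nabla (@J3 R) p (J3 p) = 0.
Proof. move=> Sp; koszul_frame (@J3 R) (@J3 R) Sp. Qed.

End Connection.

(** [x0], [x1], [x2] stand for the round components of X along J p, J2 p, J3 p, and the [V], [A],
    [B] for their derivatives along these three fields. Each line is the squared length of a frame
    vector plus that of the covariant derivative along it. Since J p has squared length lambda for
    the metric that takes the trace, the first line carries 1 / lambda. *)
Definition energy_density (R : realType) (mu lambda : R)
  (x0 x1 x2 V0 V1 V2 A0 A1 A2 B0 B1 B2 : R) : R :=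
  lambda^-1 * (mu + (mu * V0 ^+ 2 + (V1 + (2 - mu) * x2) ^+ 2 + (V2 - (2 - mu) * x1) ^+ 2))
  + (1 + (mu * (A0 - x2) ^+ 2 + A1 ^+ 2 + (A2 + mu * x0) ^+ 2))
  + (1 + (mu * (B0 + x1) ^+ 2 + (B1 - mu * x0) ^+ 2 + B2 ^+ 2)).

(** * Pointwise formula for the trace in the energy *)

Section Trace.
Variables (R : realType) (mu lambda : R)
  (nabla : ('rV[R]_4 -> 'rV[R]_4) -> 'rV[R]_4 -> 'rV[R]_4 -> 'rV[R]_4).
Hypotheses (mu_gt0 : 0 < mu) (lambda_gt0 : 0 < lambda) (Hn : levi_civita mu nabla).
Notation R4 := 'rV[R]_4.
Let Hc := levi_civita_connection Hn.
Variable X : R4 -> R4.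
Hypothesis vX : vector_field X.

Let x0 (q : R4) : R^o := dot (X q) (J q).
Let x1 (q : R4) : R^o := dot (X q) (J2 q).
Let x2 (q : R4) : R^o := dot (X q) (J3 q).

Let sx0 : smooth_on_S3 x0. Proof. by apply: smooth_dot vX.1 _; exact: smooth_linear. Qed.
Let sx1 : smooth_on_S3 x1. Proof. by apply: smooth_dot vX.1 _; exact: smooth_linear. Qed.
Let sx2 : smooth_on_S3 x2. Proof. by apply: smooth_dot vX.1 _; exact: smooth_linear. Qed.

(** Leibniz' rule applied to the frame expansion of X. That expansion equals X only on the sphere,
    which is why [nabla_local] intervenes. *)
Lemma nabla_frame p v : S3 p -> tangent p v -> nabla X p v =
  (dS3 x0 p v *: J p + x0 p *: nabla (@J R) p v)
  + (dS3 x1 p v *: J2 p + x1 p *: nabla (@J2 R) p v)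
  + (dS3 x2 p v *: J3 p + x2 p *: nabla (@J3 R) p v).
Proof.
move=> Sp tv.
have v0 := vector_fieldZ sx0 (vector_field_J R).
have v1 := vector_fieldZ sx1 (vector_field_J2 R).
have v2 := vector_fieldZ sx2 (vector_field_J3 R).
rewrite -(connection_leibniz Hc sx0)//; last exact: vector_field_J.
rewrite -(connection_leibniz Hc sx1)//; last exact: vector_field_J2.
rewrite -(connection_leibniz Hc sx2)//; last exact: vector_field_J3.
rewrite -(connection_add Hc v0 v1)// -(connection_add Hc (vector_fieldD v0 v1) v2)//.
apply: (nabla_local Hn) => //.
  exact/vector_fieldD/v2/vector_fieldD.
by move=> q Sq; rewrite {1}(tangent_expansion Sq (vX.2 q Sq)).
Qed.

Lemma nabla_along_J p : S3 p -> nabla X p (J p) =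
  dS3 x0 p (J p) *: J p + (dS3 x1 p (J p) + (2 - mu) * x2 p) *: J2 p
  + (dS3 x2 p (J p) - (2 - mu) * x1 p) *: J3 p.
Proof.
move=> Sp; rewrite nabla_frame//; last exact: (tangent_frame p).1.1.
rewrite (nabla_J_J mu_gt0 Hn)// (nabla_J2_J mu_gt0 Hn)// (nabla_J3_J mu_gt0 Hn)//.
move: (dS3 x0 p _) (dS3 x1 p _) (dS3 x2 p _) (x0 p) (x1 p) (x2 p) => *.
by apply: row4P; rewrite !crdE; ring.
Qed.

Lemma nabla_along_J2 p : S3 p -> nabla X p (J2 p) =
  (dS3 x0 p (J2 p) - x2 p) *: J p + dS3 x1 p (J2 p) *: J2 p
  + (dS3 x2 p (J2 p) + mu * x0 p) *: J3 p.
Proof.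
move=> Sp; rewrite nabla_frame//; last exact: (tangent_frame p).1.2.
rewrite (nabla_J_J2 mu_gt0 Hn)// (nabla_J2_J2 mu_gt0 Hn)// (nabla_J3_J2 mu_gt0 Hn)//.
move: (dS3 x0 p _) (dS3 x1 p _) (dS3 x2 p _) (x0 p) (x1 p) (x2 p) => *.
by apply: row4P; rewrite !crdE; ring.
Qed.

Lemma nabla_along_J3 p : S3 p -> nabla X p (J3 p) =
  (dS3 x0 p (J3 p) + x1 p) *: J p + (dS3 x1 p (J3 p) - mu * x0 p) *: J2 p
  + dS3 x2 p (J3 p) *: J3 p.
Proof.
move=> Sp; rewrite nabla_frame//; last exact: (tangent_frame p).2.
rewrite (nabla_J_J3 mu_gt0 Hn)// (nabla_J2_J3 mu_gt0 Hn)// (nabla_J3_J3 mu_gt0 Hn)//.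
move: (dS3 x0 p _) (dS3 x1 p _) (dS3 x2 p _) (x0 p) (x1 p) (x2 p) => *.
by apply: row4P; rewrite !crdE; ring.
Qed.

Lemma mul_row_dot (u e : R4) : u *m e^T *m e = dot u e *: e.
Proof.
rewrite [u *m e^T]mx11_scalar mul_scalar_mx; congr (_ *: _).
by rewrite mxE /dot; apply: eq_bigr => i _; rewrite mxE.
Qed.

(** The vectors p, J p, J2 p, J3 p form an orthonormal basis, so the matrices e^T e sum to the
    identity. *)
Lemma trace_frame p (L : 'M[R]_4) : S3 p -> \tr L =
  dot (p *m L) p + dot (J p *m L) (J p) + dot (J2 p *m L) (J2 p) + dot (J3 p *m L) (J3 p).
Proof.
move=> Sp.
pose M := p^T *m p + (J p)^T *m J p + (J2 p)^T *m J2 p + (J3 p)^T *m J3 p.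
have M1 : M = 1%:M.
  apply/row_matrixP => i; rewrite !rowE mulmx1 /M !mulmxDr !mulmxA !mul_row_dot.
  by rewrite -frame_expansion Sp scale1r; apply/rowP => j; rewrite !mxE.
have T (e : R4) : \tr (L *m (e^T *m e)) = dot (e *m L) e.
  rewrite mulmxA mxtrace_mulC mulmxA trace_mx11 mxE /dot.
  by apply: eq_bigr => i _; rewrite [e^T _ _]mxE.
by rewrite -[L in LHS]mulmx1 -M1 /M !mulmxDr !raddfD/= !T.
Qed.

(** The pull-back by X of the Sasaki metric. *)
Let b p u v := berger mu p u v + berger mu p (nabla X p u) (nabla X p v).

Let b_expand p u v : S3 p -> tangent p u -> tangent p v -> b p u v =
  dot u (J p) * (dot v (J p) * b p (J p) (J p) + dot v (J2 p) * b p (J p) (J2 p) + dot v (J3 p) * b p (J p) (J3 p))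
  + dot u (J2 p) * (dot v (J p) * b p (J2 p) (J p) + dot v (J2 p) * b p (J2 p) (J2 p) + dot v (J3 p) * b p (J2 p) (J3 p))
  + dot u (J3 p) * (dot v (J p) * b p (J3 p) (J p) + dot v (J2 p) * b p (J3 p) (J2 p) + dot v (J3 p) * b p (J3 p) (J3 p)).
Proof.
move=> Sp tu tv; have [[t1 t2] t3] := tangent_frame p.
have bl a u' v' w : tangent p u' -> tangent p v' -> b p (a *: u' + v') w = a * b p u' w + b p v' w.
  move=> tu' tv'; rewrite /b (connection_linear Hc)// !berger_linl; ring.
have br a u' v' w : tangent p u' -> tangent p v' -> b p w (a *: u' + v') = a * b p w u' + b p w v'.
  move=> tu' tv'; rewrite /b (connection_linear Hc)// !berger_linr; ring.
have b0l w : b p 0 w = 0.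
  have t0 : tangent p 0 by rewrite /tangent dotC dot0l.
  by have := bl 1 0 0 w t0 t0; rewrite scaler0 addr0 mul1r => /eqP; rewrite -subr_eq subrr => /eqP <-.
have b0r w : b p w 0 = 0.
  have t0 : tangent p 0 by rewrite /tangent dotC dot0l.
  by have := br 1 0 0 w t0 t0; rewrite scaler0 addr0 mul1r => /eqP; rewrite -subr_eq subrr => /eqP <-.
have bZl a u' w : tangent p u' -> b p (a *: u') w = a * b p u' w.
  have t0 : tangent p 0 by rewrite /tangent dotC dot0l.
  by move=> tu'; rewrite -[a *: u']addr0 bl// b0l addr0.
have bZr a u' w : tangent p u' -> b p w (a *: u') = a * b p w u'.
  have t0 : tangent p 0 by rewrite /tangent dotC dot0l.
  by move=> tu'; rewrite -[a *: u']addr0 br// b0r addr0.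
have El w : b p u w = dot u (J p) * b p (J p) w + dot u (J2 p) * b p (J2 p) w + dot u (J3 p) * b p (J3 p) w.
  rewrite [in LHS](tangent_expansion Sp tu) -addrA bl ?bl ?bZl ?addrA//; first exact: tangentZ.
  by apply: tangentD; exact: tangentZ.
have Er w : b p w v = dot v (J p) * b p w (J p) + dot v (J2 p) * b p w (J2 p) + dot v (J3 p) * b p w (J3 p).
  rewrite [in LHS](tangent_expansion Sp tv) -addrA br ?br ?bZr ?addrA//; first exact: tangentZ.
  by apply: tangentD; exact: tangentZ.
by rewrite El !Er.
Qed.

(** [energy_endo] is picked by [xget] with default 0, so its defining property is available only
    once a solution has been exhibited. *)
Lemma energy_endo_exists p : S3 p -> exists L, is_energy_endo mu lambda nabla X p L.
Proof.
move=> Sp; have [[t1 t2] t3] := tangent_frame p.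
(* The image of a frame vector e: [b p e] is represented by the metric with parameter lambda, in
   which J p has squared length lambda, hence the factor on the first component. *)
pose c e := (lambda^-1 * b p e (J p)) *: J p + b p e (J2 p) *: J2 p + b p e (J3 p) *: J3 p.
pose L := (J p)^T *m c (J p) + (J2 p)^T *m c (J2 p) + (J3 p)^T *m c (J3 p).
have tc e : tangent p (c e) by rewrite /c; do ?apply: tangentD; exact: tangentZ.
have mulG (d : R4 -> R4) u : u *m ((J p)^T *m d (J p) + (J2 p)^T *m d (J2 p) + (J3 p)^T *m d (J3 p)) =
    dot u (J p) *: d (J p) + dot u (J2 p) *: d (J2 p) + dot u (J3 p) *: d (J3 p).
  have mc (e w : R4) : u *m (e^T *m w) = dot u e *: w.
    rewrite mulmxA [u *m e^T]mx11_scalar mul_scalar_mx; congr (_ *: _).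
    by rewrite mxE /dot; apply: eq_bigr => i _; rewrite mxE.
  by rewrite !mulmxDr !mc.
have mulL u : u *m L = dot u (J p) *: c (J p) + dot u (J2 p) *: c (J2 p) + dot u (J3 p) *: c (J3 p).
  exact: mulG.
have tL u : tangent p (u *m L) by rewrite mulL; do ?apply: tangentD; exact: tangentZ.
exists L; split=> [|u tu|u v tu tv]; [|exact: tL|].
  by rewrite mulL !dot_frame !scale0r !addr0.
rewrite -[RHS]/(b p u v) b_expand// berger_frame//.
rewrite mulL !(dotDl, dotZl) !dot_frame Sp.
have ll := gt_eqF lambda_gt0.
by field; rewrite ll.
Qed.

Lemma trace_energy_endo p : S3 p -> \tr (energy_endo mu lambda nabla X p) =
  energy_density mu lambda (x0 p) (x1 p) (x2 p)
   (dS3 x0 p (J p)) (dS3 x1 p (J p)) (dS3 x2 p (J p))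
   (dS3 x0 p (J2 p)) (dS3 x1 p (J2 p)) (dS3 x2 p (J2 p))
   (dS3 x0 p (J3 p)) (dS3 x1 p (J3 p)) (dS3 x2 p (J3 p)).
Proof.
move=> Sp; have [[t1 t2] t3] := tangent_frame p.
have [p0 tL bL] : is_energy_endo mu lambda nabla X p (energy_endo mu lambda nabla X p).
  have [L HL] := energy_endo_exists Sp.
  exact: (@xgetPex _ 0 [set L | is_energy_endo mu lambda nabla X p L] (ex_intro _ L HL)).
have l0 : lambda != 0 by rewrite gt_eqF.
rewrite (trace_frame _ Sp) p0 dot0l add0r.
have := bL _ _ t1 t1; have := bL _ _ t2 t2; have := bL _ _ t3 t3.
rewrite !(berger_frame lambda _ Sp); [|exact: tL..].
rewrite !dot_frame Sp !(mulr0, mulr1, add0r, addr0) => -> -> e1.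
have -> : dot (J p *m energy_endo mu lambda nabla X p) (J p) =
    lambda^-1 * (lambda * dot (J p *m energy_endo mu lambda nabla X p) (J p)).
  by rewrite mulKf.
rewrite e1 nabla_along_J// nabla_along_J2// nabla_along_J3//.
rewrite /energy_density.
move: (dS3 x0 p (J p)) (dS3 x1 p (J p)) (dS3 x2 p (J p))
  (dS3 x0 p (J2 p)) (dS3 x1 p (J2 p)) (dS3 x2 p (J2 p))
  (dS3 x0 p (J3 p)) (dS3 x1 p (J3 p)) (dS3 x2 p (J3 p)) (x0 p) (x1 p) (x2 p) => *.
have T a d c : tangent p (a *: J p + d *: J2 p + c *: J3 p).
  by do ?apply: tangentD; exact: tangentZ.
rewrite !(berger_frame mu _ Sp)//; [|exact: T..].
by rewrite !(dotDl, dotZl) !dot_frame Sp; ring.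
Qed.

End Trace.

(** * Integration over the sphere in Hopf coordinates *)

Lemma det3 (R : comRingType) (F : nat -> nat -> R) :
  \det (\matrix_(i < 3, j < 3) F i j) =
  F 0%N 0%N * (F 1%N 1%N * F 2%N 2%N - F 1%N 2%N * F 2%N 1%N)
  - F 0%N 1%N * (F 1%N 0%N * F 2%N 2%N - F 1%N 2%N * F 2%N 0%N)
  + F 0%N 2%N * (F 1%N 0%N * F 2%N 1%N - F 1%N 1%N * F 2%N 0%N).
Proof.
rewrite (expand_det_row _ ord0) !big_ord_recl big_ord0 /cofactor.
rewrite !(expand_det_row _ ord0) !big_ord_recl !big_ord0 /cofactor !det_mx11 !mxE /=.
by rewrite /bump /=; ring.
Qed.

Section HopfCoord.
Variable R : realType.
Notation R4 := 'rV[R]_4.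

Lemma hopf_coordE (s a b : R) :
  hopf_coord s a b = row4 (cos s * cos a) (cos s * sin a) (sin s * cos b) (sin s * sin b).
Proof. by []. Qed.

Lemma cos_mul_cos (x : R) : cos x * cos x = 1 - sin x * sin x.
Proof. by rewrite -!expr2 cos2sin2. Qed.

Lemma S3_hopf_coord (s a b : R) : S3 (hopf_coord s a b).
Proof.
rewrite /S3/= hopf_coordE dotE !crd_row4.
transitivity ((cos s * cos s) * ((cos a * cos a) + sin a * sin a) + sin s * sin s * (cos b * cos b + sin b * sin b)).
  by ring.
by rewrite !cos_mul_cos; ring.
Qed.

Definition hopf_ds (s a b : R) : R4 := row4 (- sin s * cos a) (- sin s * sin a) (cos s * cos b) (cos s * sin b).
Definition hopf_da (s a b : R) : R4 := row4 (- (cos s * sin a)) (cos s * cos a) 0 0.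
Definition hopf_db (s a b : R) : R4 := row4 0 0 (- (sin s * sin b)) (sin s * cos b).

Lemma is_derive_row4 (f0 f1 f2 f3 : R -> R) (x d0 d1 d2 d3 : R) :
  is_derive x 1 f0 d0 -> is_derive x 1 f1 d1 -> is_derive x 1 f2 d2 -> is_derive x 1 f3 d3 ->
  is_derive x 1 (fun x => row4 (f0 x) (f1 x) (f2 x) (f3 x)) (row4 d0 d1 d2 d3).
Proof.
move=> h0 h1 h2 h3; apply: is_derive_row => -[|[|[|[|//]]]] _; rewrite !crd_row4.
- by rewrite (_ : _ \o _ = f0)//; apply/funext => y /=; rewrite crd_row4.
- by rewrite (_ : _ \o _ = f1)//; apply/funext => y /=; rewrite crd_row4.
- by rewrite (_ : _ \o _ = f2)//; apply/funext => y /=; rewrite crd_row4.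
- by rewrite (_ : _ \o _ = f3)//; apply/funext => y /=; rewrite crd_row4.
Qed.

Lemma is_derive_mulr (f : R -> R) (x d c : R) : is_derive x 1 f d -> is_derive x 1 (fun x => f x * c) (d * c).
Proof. by move=> h; have := is_derive_mul h (is_derive_cst c x 1); rewrite mulr0 addr0. Qed.

Lemma is_derive_mull (f : R -> R) (x d c : R) : is_derive x 1 f d -> is_derive x 1 (fun x => c * f x) (c * d).
Proof. by move=> h; have := is_derive_mul (is_derive_cst c x 1) h; rewrite mul0r add0r. Qed.

Lemma is_derive_hopf_s (s a b : R) : is_derive s 1 (fun x => hopf_coord x a b) (hopf_ds s a b).
Proof. by apply: is_derive_row4; apply: is_derive_mulr. Qed.

Lemma is_derive_hopf_a (s a b : R) : is_derive a 1 (fun x => hopf_coord s x b) (hopf_da s a b).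
Proof.
apply: is_derive_row4; try exact: is_derive_cst; by rewrite -?mulrN; apply: is_derive_mull.
Qed.

Lemma is_derive_hopf_b (s a b : R) : is_derive b 1 (fun x => hopf_coord s a x) (hopf_db s a b).
Proof.
apply: is_derive_row4; try exact: is_derive_cst; by rewrite -?mulrN; apply: is_derive_mull.
Qed.

Lemma hopf_dots (s a b : R) : (dot (hopf_ds s a b) (hopf_ds s a b) = 1) *
  (dot (hopf_ds s a b) (J (hopf_coord s a b)) = 0) *
  (dot (hopf_ds s a b) (hopf_da s a b) = 0) * (dot (hopf_ds s a b) (hopf_db s a b) = 0) *
  (dot (hopf_da s a b) (hopf_da s a b) = cos s * cos s) *
  (dot (hopf_da s a b) (hopf_db s a b) = 0) *
  (dot (hopf_db s a b) (hopf_db s a b) = sin s * sin s) *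
  (dot (hopf_da s a b) (J (hopf_coord s a b)) = cos s * cos s) *
  (dot (hopf_db s a b) (J (hopf_coord s a b)) = sin s * sin s).
Proof.
have dot4 x0 x1 x2 x3 y0 y1 y2 y3 : dot (row4 x0 x1 x2 x3) (row4 y0 y1 y2 y3) =
    x0 * y0 + x1 * y1 + x2 * y2 + x3 * y3 :> R by rewrite dotE !crd_row4.
rewrite JE hopf_coordE !crd_row4 /hopf_ds /hopf_da /hopf_db !dot4.
have Ha := cos2Dsin2 a; have Hb := cos2Dsin2 b; have Hs := cos2Dsin2 s.
do !split; try ring.
- transitivity (sin s ^+ 2 * (cos a ^+ 2 + sin a ^+ 2) + cos s ^+ 2 * (cos b ^+ 2 + sin b ^+ 2)).
    by ring.
  by rewrite Ha Hb !mulr1 addrC.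
- by transitivity (cos s * cos s * (cos a ^+ 2 + sin a ^+ 2)); [ring|rewrite Ha mulr1].
- by transitivity (sin s * sin s * (cos b ^+ 2 + sin b ^+ 2)); [ring|rewrite Hb mulr1].
- by transitivity (cos s * cos s * (cos a ^+ 2 + sin a ^+ 2)); [ring|rewrite Ha mulr1].
- by transitivity (sin s * sin s * (cos b ^+ 2 + sin b ^+ 2)); [ring|rewrite Hb mulr1].
Qed.

(** The Gram matrix is diag (1, cos^2, sin^2) plus (lambda - 1) times the square of the covector (0,
    cos^2, sin^2), so its determinant is lambda (sin s cos s)^2. The range of s fixes the sign of
    the root. *)
Lemma volume_densityE (lambda s a b : R) : 0 <= lambda -> 0 <= s <= pi / 2 ->
  volume_density lambda s a b = Num.sqrt lambda * (sin s * cos s).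
Proof.
move=> l0 /andP[s0 s1].
have c0 : 0 <= cos s.
  by apply: cos_ge0_pihalf; rewrite s1 andbT (le_trans _ s0)// oppr_le0 divr_ge0// pi_ge0.
have ss0 : 0 <= sin s.
  apply: sin_ge0_pi; rewrite s0 (le_trans s1)// ler_pdivrMr// ler_peMr ?pi_ge0//.
  by rewrite ler1n.
rewrite /volume_density /hopf_partial.
have -> : derive1 (fun x => hopf_coord x a b) s = hopf_ds s a b.
  by rewrite derive1E; have [_] := is_derive_hopf_s s a b.
have -> : derive1 (fun x => hopf_coord s x b) a = hopf_da s a b.
  by rewrite derive1E; have [_] := is_derive_hopf_a s a b.
have -> : derive1 (fun x => hopf_coord s a x) b = hopf_db s a b.
  by rewrite derive1E; have [_] := is_derive_hopf_b s a b.
set v := [:: _; _; _].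
rewrite (det3 (fun i j => berger lambda (hopf_coord s a b) (nth 0 v i) (nth 0 v j))) /v/=.
rewrite !(bergerE _ _ _ (S3_hopf_coord s a b)).
rewrite !hopf_dots // (dotC (hopf_da s a b) (hopf_ds s a b)).
rewrite (dotC (hopf_db s a b) (hopf_ds s a b)) (dotC (hopf_db s a b) (hopf_da s a b)) !hopf_dots.
transitivity (Num.sqrt (lambda * (sin s * cos s) ^+ 2)); last first.
  by rewrite sqrtrM// sqrtr_sqr ger0_norm// mulr_ge0.
congr Num.sqrt.
transitivity ((sin s * cos s) ^+ 2 * (1 + (lambda - 1) * (cos s ^+ 2 + sin s ^+ 2))).
  by ring.
by rewrite cos2Dsin2; ring.
Qed.

End HopfCoord.

(** * The sphere integral as a functional, and its divergence theorem *)

Section SphereIntegral.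
Variable R : realType.
Notation R4 := 'rV[R]_4.
Notation R3 := (R * (R * R))%type.

Lemma continuous_addf (T : topologicalType) (f g : T -> R) :
  continuous f -> continuous g -> continuous (fun x => f x + g x).
Proof. by move=> fc gc x; apply: cvgD; [exact: fc|exact: gc]. Qed.

Lemma continuous_oppf (T : topologicalType) (f : T -> R) :
  continuous f -> continuous (fun x => - f x).
Proof. by move=> fc x; apply: cvgN; exact: fc. Qed.

Lemma continuous_row4 (T : topologicalType) (f0 f1 f2 f3 : T -> R) :
  continuous f0 -> continuous f1 -> continuous f2 -> continuous f3 ->
  continuous (fun x => row4 (f0 x) (f1 x) (f2 x) (f3 x)).
Proof.
move=> c0 c1 c2 c3.
pose f (i : 'I_4) := nth f0 [:: f0; f1; f2; f3] i.
rewrite (_ : (fun x => _) = fun x => \sum_(i < 4) f i x *: (delta_mx ord0 i : R4)); last first.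
  apply/funext => x; rewrite [LHS]row_sum_delta; apply: eq_bigr => i _; congr (_ *: _).
  by rewrite /row4 mxE /f; case: i => -[|[|[|[|//]]]].
move=> x; apply: continuous_at_sum => i _.
apply: (@continuous_comp _ _ _ (f i) (fun c : R => c *: (delta_mx ord0 i : R4))).
  by rewrite /f; case: i => -[|[|[|[|//]]]] /= ?; [exact: c0|exact: c1|exact: c2|exact: c3].
exact: scalel_continuous.
Qed.

Definition hopf3 (x : R3) : R4 := hopf_coord x.1 x.2.1 x.2.2.

Lemma cos_c1 : continuous (fun x : R3 => cos x.1).
Proof. by move=> x; apply: (@continuous_comp _ _ _ fst cos); [exact: cvg_fst|exact: continuous_cos]. Qed.
Lemma sin_c1 : continuous (fun x : R3 => sin x.1).
Proof. by move=> x; apply: (@continuous_comp _ _ _ fst sin); [exact: cvg_fst|exact: continuous_sin]. Qed.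
Lemma fst_snd_c : continuous (fun x : R3 => x.2.1).
Proof. by move=> x; apply: (@continuous_comp _ _ _ snd fst); [exact: cvg_snd|exact: cvg_fst]. Qed.
Lemma snd_snd_c : continuous (fun x : R3 => x.2.2).
Proof. by move=> x; apply: (@continuous_comp _ _ _ snd snd); [exact: cvg_snd|exact: cvg_snd]. Qed.
Lemma cos_c2 : continuous (fun x : R3 => cos x.2.1).
Proof. by move=> x; apply: (continuous_comp (fst_snd_c (x:=x))); exact: continuous_cos. Qed.
Lemma sin_c2 : continuous (fun x : R3 => sin x.2.1).
Proof. by move=> x; apply: (continuous_comp (fst_snd_c (x:=x))); exact: continuous_sin. Qed.
Lemma cos_c3 : continuous (fun x : R3 => cos x.2.2).
Proof. by move=> x; apply: (continuous_comp (snd_snd_c (x:=x))); exact: continuous_cos. Qed.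
Lemma sin_c3 : continuous (fun x : R3 => sin x.2.2).
Proof. by move=> x; apply: (continuous_comp (snd_snd_c (x:=x))); exact: continuous_sin. Qed.

Ltac cont := repeat match goal with
  | |- continuous (fun x => cos x.1) => exact: cos_c1
  | |- continuous (fun x => sin x.1) => exact: sin_c1
  | |- continuous (fun x => cos x.2.1) => exact: cos_c2
  | |- continuous (fun x => sin x.2.1) => exact: sin_c2
  | |- continuous (fun x => cos x.2.2) => exact: cos_c3
  | |- continuous (fun x => sin x.2.2) => exact: sin_c3
  | |- continuous (fun _ => ?c) => exact: cst_continuous
  | |- continuous (fun x => @?f x * @?g x) => apply: (@continuous_mul _ _ f g)
  | |- continuous (fun x => @?f x - @?g x) => apply: (@continuous_sub _ _ f g)
  | |- continuous (fun x => @?f x + @?g x) => apply: (@continuous_addf _ f g)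
  | |- continuous (fun x => - @?f x) => apply: (@continuous_oppf _ f)
  | H : continuous ?f |- continuous ?g => constr_eq f g; exact: H
  | H : continuous ?f |- continuous (fun x => ?g x) => constr_eq f g; exact: H
  end.

Lemma hopf3_continuous : continuous hopf3.
Proof. by apply: continuous_row4; cont. Qed.

Lemma hopf3_neq0 x : hopf3 x != 0.
Proof. exact/S3_neq0/S3_hopf_coord. Qed.

Lemma continuous_comp_hopf3 (g : R4 -> R) :
  (forall p, p != 0 -> {for p, continuous g}) -> continuous (g \o hopf3).
Proof.
move=> gc x; apply: continuous_comp; first exact: hopf3_continuous.
exact/gc/hopf3_neq0.
Qed.

Definition box : set R3 := `[0, pi / 2] `*` (`[0, pi *+ 2] `*` `[0, pi *+ 2]).
Definition int_b (f : R -> R) : R := \int[lebesgue_measure]_(b in `[0, pi *+ 2]) f b.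
Definition int_ab (f : R * R -> R) : R := \int[lebesgue_measure]_(a in `[0, pi *+ 2]) int_b (fun b => f (a, b)).
Definition int_box (f : R3 -> R) : R := \int[lebesgue_measure]_(s in `[0, pi / 2]) int_ab (fun y => f (s, y)).
(** The round volume; the Berger one differs from it by the constant factor sqrt lambda. *)
Definition sphere_int (f : R3 -> R) : R := int_box (fun x => f x * (sin x.1 * cos x.1)).

Lemma pi_half_gt0 : 0 < pi / 2 :> R. Proof. by rewrite divr_gt0// pi_gt0. Qed.
Lemma pi2_gt0 : 0 < pi *+ 2 :> R. Proof. by rewrite mulrn_wgt0// pi_gt0. Qed.

Lemma compact_circle2 : compact (`[0, pi *+ 2]%classic `*` `[0, pi *+ 2]%classic : set (R * R)).
Proof. by apply: compact_setX; exact: segment_compact. Qed.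

Lemma compact_box : compact box.
Proof. by apply: compact_setX; [exact: segment_compact|exact: compact_circle2]. Qed.

Lemma int_b_functional : bounded_functional `[0, pi *+ 2]%classic int_b.
Proof. exact/itv_functional/ltW/pi2_gt0. Qed.

Lemma int_ab_functional : bounded_functional (`[0, pi *+ 2]%classic `*` `[0, pi *+ 2]%classic) int_ab.
Proof.
apply: (functional_prod _ _ (itv_functional (ltW pi2_gt0)) int_b_functional); exact: segment_compact.
Qed.

Lemma int_box_functional : bounded_functional box int_box.
Proof.
apply: (functional_prod _ compact_circle2 (itv_functional (ltW pi_half_gt0)) int_ab_functional).
exact: segment_compact.
Qed.

Lemma sphere_int_functional : bounded_functional box sphere_int.
Proof.
have H := int_box_functional; split.
  move=> c f g fc gc; rewrite /sphere_int -(functional_linear H); try cont.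
  by congr int_box; apply/funext => x; rewrite mulrDl -(mulrA c).
have [C C0 HC] := functional_bounded H; exists C; [exact: C0|move=> f M fc fM].
apply: HC; first by cont.
move=> x Kx; rewrite normrM -[M]mulr1; apply: ler_pM => //; first exact: fM.
rewrite normrM -[X in _ <= X]mulr1; apply: ler_pM => //; rewrite ler_norml.
  by rewrite sin_geN1 sin_le1.
by rewrite cos_geN1 cos_le1.
Qed.

Lemma integral_S3E (lambda : R) (f g : R4 -> R) : 0 <= lambda -> (forall p, S3 p -> f p = g p) ->
  continuous (g \o hopf3) -> integral_S3 lambda f = Num.sqrt lambda * sphere_int (g \o hopf3).
Proof.
move=> l0 fg gc; rewrite -(functionalZ sphere_int_functional _ gc).
rewrite /integral_S3 /sphere_int /int_box.
apply: eq_Rintegral => s; rewrite inE/= in_itv/= => s01.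
apply: eq_Rintegral => a _; apply: eq_Rintegral => b _ /=.
rewrite volume_densityE// fg//; last exact: S3_hopf_coord.
by rewrite mulrCA mulrA.
Qed.

Lemma continuous_section (X Y : topologicalType) (f : X * Y -> R) x :
  continuous f -> continuous (fun y => f (x, y)).
Proof.
move=> fc y; apply: (@continuous_comp _ _ _ (fun y => (x, y)) f); last exact: fc.
by apply: cvg_pair; [exact: cvg_cst|exact: cvg_id].
Qed.

Arguments continuous_section {X Y f} x _.

(** An exact s-derivative: P is moved inside as the derivative of an integral over (a, b), and the
    fundamental theorem is applied in the outermost variable. The analogues for a and b act at their
    own level of the iterated integral, with periodicity in place of vanishing at the ends. *)
Lemma int_box_ds (F P : R3 -> R) : continuous F -> continuous P ->
  (forall (s : R) y, is_derive s 1 (fun s => F (s, y)) (P (s, y))) ->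
  (forall y, F (0, y) = 0) -> (forall y, F (pi / 2, y) = 0) -> int_box P = 0.
Proof.
move=> Fc Pc dF F0 F1; rewrite /int_box.
have PE : (fun tx : R * (R * R) => P (tx.1, tx.2)) = P by apply/funext => -[].
rewrite (@FTC R 0 (pi / 2) (fun s => int_ab (fun y => F (s, y))) (fun s => int_ab (fun y => P (s, y)))
  pi_half_gt0 _ _).
- rewrite (_ : (fun y => F (pi / 2, y)) = fun=> 0); last exact/funext.
  rewrite (_ : (fun y => F (0, y)) = fun=> 0); last exact/funext.
  exact: subrr.
- move=> s; apply: (functional_continuous compact_circle2 int_ab_functional (f := fun s y => P (s, y))).
    by near=> t; exact: continuous_section.
  by move=> y _; rewrite PE; exact: Pc.
- move=> s; apply: (functional_derive compact_circle2 int_ab_functional (f := fun s y => F (s, y)) (df := fun s y => P (s, y))).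
  + by near=> t; exact: continuous_section.
  + exact: continuous_section.
  + by near=> t => y _; exact: dF.
  + by move=> y _; rewrite PE; exact: Pc.
Unshelve. all: by end_near. Qed.

Lemma int_box_da (F P : R3 -> R) : continuous F -> continuous P ->
  (forall s a b : R, is_derive a 1 (fun a => F (s, (a, b))) (P (s, (a, b)))) ->
  (forall s b, F (s, (0, b)) = F (s, (pi *+ 2, b))) -> int_box P = 0.
Proof.
move=> Fc Pc dF F0; rewrite /int_box -[RHS](functional0 int_box_functional).
apply: eq_Rintegral => s _; rewrite /int_ab.
have H0 : int_b (fun=> 0) = 0 := functional0 int_b_functional.
under [in RHS]eq_Rintegral do rewrite H0.
have Fs := continuous_section s Fc; have Ps := continuous_section s Pc.
have PE : (fun tx : R * R => P (s, (tx.1, tx.2))) = fun y => P (s, y) by apply/funext => -[].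
have cb : compact (`[0, pi *+ 2]%classic : set R) by exact: segment_compact.
rewrite (@FTC R 0 (pi *+ 2) (fun a => int_b (fun b => F (s, (a, b)))) (fun a => int_b (fun b => P (s, (a, b))))
  pi2_gt0 _ _).
- rewrite (_ : (fun b => F (s, (0, b))) = (fun b => F (s, (pi *+ 2, b)))); last exact/funext.
  by rewrite subrr (functional0 (itv_functional (ltW pi2_gt0))).
- move=> a; apply: (functional_continuous cb int_b_functional (f := fun a b => P (s, (a, b)))).
    by near=> t; exact: (continuous_section t Ps).
  by move=> y _; rewrite PE; exact: Ps.
- move=> a; apply: (functional_derive cb int_b_functional (f := fun a b => F (s, (a, b))) (df := fun a b => P (s, (a, b)))).
  + by near=> t; exact: (continuous_section t Fs).
  + exact: (continuous_section a Ps).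
  + by near=> t => y _; exact: dF.
  + by move=> y _; rewrite PE; exact: Ps.
Unshelve. all: by end_near. Qed.

Lemma int_box_db (F P : R3 -> R) : continuous P ->
  (forall s a b : R, is_derive b 1 (fun b => F (s, (a, b))) (P (s, (a, b)))) ->
  (forall s a, F (s, (a, 0)) = F (s, (a, pi *+ 2))) -> int_box P = 0.
Proof.
move=> Pc dF F0; rewrite /int_box -[RHS](functional0 int_box_functional).
apply: eq_Rintegral => s _; apply: eq_Rintegral => a _.
rewrite (functional0 int_b_functional) /int_b (@FTC R 0 (pi *+ 2) (fun b => F (s, (a, b))) (fun b => P (s, (a, b))) pi2_gt0 _ _).
- by rewrite F0 subrr.
- exact: (continuous_section a (continuous_section s Pc)).
Qed.

Lemma Ck1_derive4 (g : R4 -> R^o) p v : p != 0 -> Ck 1 [set p | p != 0] g ->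
  'D_v g p = crd 0 v * 'D_(delta_mx ord0 (inord 0)) g p + crd 1 v * 'D_(delta_mx ord0 (inord 1)) g p
    + crd 2 v * 'D_(delta_mx ord0 (inord 2)) g p + crd 3 v * 'D_(delta_mx ord0 (inord 3)) g p.
Proof. by move=> p0 Cg; rewrite (Ck1_deriveE v (@open_neq0 R) p0 Cg) big_ord4. Qed.

(** The direction moves with the point, so the derivative is expanded over the fixed basis
    directions, along which continuity is part of the hypothesis on [g]. *)
Lemma Ck1_derive_continuous (g : R4 -> R^o) (v0 v1 v2 v3 : R3 -> R) :
  Ck 1 [set p | p != 0] g ->
  continuous v0 -> continuous v1 -> continuous v2 -> continuous v3 ->
  continuous (fun x => 'D_(row4 (v0 x) (v1 x) (v2 x) (v3 x)) g (hopf3 x) : R).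
Proof.
move=> Cg c0 c1 c2 c3.
have cD v : continuous (fun x => 'D_v g (hopf3 x) : R).
  apply: (continuous_comp_hopf3 (g := 'D_v g)) => p p0.
  by have [_ /(_ v) [_ [+ _]]] := Cg; apply.
have comb (w0 w1 w2 w3 : R3 -> R) : continuous w0 -> continuous w1 -> continuous w2 -> continuous w3 ->
    continuous (fun x => v0 x * w0 x + v1 x * w1 x + v2 x * w2 x + v3 x * w3 x).
  by move=> w0c w1c w2c w3c; cont.
have := comb _ _ _ _ (cD (delta_mx ord0 (inord 0))) (cD (delta_mx ord0 (inord 1)))
  (cD (delta_mx ord0 (inord 2))) (cD (delta_mx ord0 (inord 3))).
rewrite (_ : (fun x => _ + _) = fun x => 'D_(row4 (v0 x) (v1 x) (v2 x) (v3 x)) g (hopf3 x))//.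
by apply/funext => x; rewrite [RHS](Ck1_derive4 _ (hopf3_neq0 x) Cg) !crd_row4.
Qed.

(* In Hopf coordinates J2 is cos u d_s + tan s sin u d_a - cot s sin u d_b with
   u = a + b, and J3 is obtained by the shift u - pi / 2; the volume density
   sin s cos s cancels the poles. *)
Lemma field_hopf (s a b c d : R) (al := c * (cos a * cos b - sin a * sin b) + d * (sin a * cos b + cos a * sin b))
  (be := c * (sin a * cos b + cos a * sin b) - d * (cos a * cos b - sin a * sin b)) :
  (sin s * cos s) *: (c *: J2 (hopf_coord s a b) + d *: J3 (hopf_coord s a b)) =
  (sin s * cos s * al) *: hopf_ds s a b + (sin s * sin s * be) *: hopf_da s a b
  - (cos s * cos s * be) *: hopf_db s a b.
Proof.
have Ha := cos2Dsin2 a; have Hb := cos2Dsin2 b.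
rewrite /J2 /J3 hopf_coordE /hopf_ds /hopf_da /hopf_db /al /be {al be}.
apply: row4P; rewrite !crdE.
- transitivity ((sin s * cos s) * (- c * (sin s * cos b) - d * (sin s * sin b)) * (cos a ^+ 2 + sin a ^+ 2)).
    by rewrite Ha; ring.
  by ring.
- transitivity ((sin s * cos s) * (c * (sin s * sin b) - d * (sin s * cos b)) * (cos a ^+ 2 + sin a ^+ 2)).
    by rewrite Ha; ring.
  by ring.
- transitivity ((sin s * cos s) * (c * (cos s * cos a) + d * (cos s * sin a)) * (cos b ^+ 2 + sin b ^+ 2)).
    by rewrite Hb; ring.
  by ring.
- transitivity ((sin s * cos s) * (- c * (cos s * sin a) + d * (cos s * cos a)) * (cos b ^+ 2 + sin b ^+ 2)).
    by rewrite Hb; ring.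
  by ring.
Qed.

(** Multiplied by the density, the integrand is P1 + P2 - P3, exact derivatives of F1 in s, F2 in a
    and F3 in b. As [al] is the derivative of [be] in a and in b, the terms without a derivative of
    g have coefficient (cos^2 - sin^2) + sin^2 - cos^2 = 0, which expresses that the field is
    divergence free. *)
Lemma sphere_divergence (g : R4 -> R^o) (c d : R) : Ck 1 [set p | p != 0] g ->
  sphere_int (fun x => 'D_(c *: J2 (hopf3 x) + d *: J3 (hopf3 x)) g (hopf3 x)) = 0.
Proof.
move=> Cg.
pose al (x : R3) := c * (cos x.2.1 * cos x.2.2 - sin x.2.1 * sin x.2.2) + d * (sin x.2.1 * cos x.2.2 + cos x.2.1 * sin x.2.2).
pose be (x : R3) := c * (sin x.2.1 * cos x.2.2 + cos x.2.1 * sin x.2.2) - d * (cos x.2.1 * cos x.2.2 - sin x.2.1 * sin x.2.2).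
pose gh x : R := g (hopf3 x).
pose gs x : R := 'D_(hopf_ds x.1 x.2.1 x.2.2) g (hopf3 x).
pose ga x : R := 'D_(hopf_da x.1 x.2.1 x.2.2) g (hopf3 x).
pose gb x : R := 'D_(hopf_db x.1 x.2.1 x.2.2) g (hopf3 x).
have alc : continuous al by rewrite /al; cont.
have bec : continuous be by rewrite /be; cont.
have ghc : continuous gh.
  by apply: continuous_comp_hopf3 => p p0; exact: Ck_continuous Cg p0.
have gsc : continuous gs by apply: Ck1_derive_continuous => //; cont.
have gac : continuous ga by apply: Ck1_derive_continuous => //; cont.
have gbc : continuous gb by apply: Ck1_derive_continuous => //; cont.
pose F1 x := sin x.1 * cos x.1 * (al x * gh x).
pose P1 (x : R3) := (cos x.1 * cos x.1 - sin x.1 * sin x.1) * (al x * gh x) + sin x.1 * cos x.1 * (al x * gs x).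
pose F2 x := sin x.1 * sin x.1 * (be x * gh x).
pose P2 (x : R3) := sin x.1 * sin x.1 * (al x * gh x + be x * ga x).
pose F3 x := cos x.1 * cos x.1 * (be x * gh x).
pose P3 (x : R3) := cos x.1 * cos x.1 * (al x * gh x + be x * gb x).
have F1c : continuous F1 by rewrite /F1; cont.
have F2c : continuous F2 by rewrite /F2; cont.
have F3c : continuous F3 by rewrite /F3; cont.
have P1c : continuous P1 by rewrite /P1; cont.
have P2c : continuous P2 by rewrite /P2; cont.
have P3c : continuous P3 by rewrite /P3; cont.
have I1 : int_box P1 = 0.
  apply: (int_box_ds F1c P1c).
  - move=> s [a b]; rewrite /F1 /P1 /al /gh /gs /hopf3/=.
    have dg := @Ck1_is_derive_curve R 4 _ g (fun x => hopf_coord x a b) _ s (@open_neq0 R)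
      (hopf3_neq0 (s, (a, b))) Cg (is_derive_hopf_s s a b).
    have D := is_derive_mul (is_derive_mul (is_derive_sin s) (is_derive_cos s))
      (is_derive_mull (al (s, (a, b))) dg).
    by apply: (is_derive_eq D); rewrite /al/=; ring.
  - by move=> y; rewrite /F1/= sin0 mul0r mul0r.
  - by move=> y; rewrite /F1/= cos_pihalf mulr0 mul0r.
have I2 : int_box P2 = 0.
  apply: (int_box_da F2c P2c).
  - move=> s a b; rewrite /F2 /P2 /al /be /gh /ga /hopf3/=.
    have dg := @Ck1_is_derive_curve R 4 _ g (fun x => hopf_coord s x b) _ a (@open_neq0 R)
      (hopf3_neq0 (s, (a, b))) Cg (is_derive_hopf_a s a b).
    have D := is_derive_mull (sin s * sin s) (is_derive_mul (is_deriveB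
      (is_derive_mull c (is_deriveD (is_derive_mulr (cos b) (is_derive_sin a)) (is_derive_mulr (sin b) (is_derive_cos a))))
      (is_derive_mull d (is_deriveB (is_derive_mulr (cos b) (is_derive_cos a)) (is_derive_mulr (sin b) (is_derive_sin a))))) dg).
    by apply: (is_derive_eq D); rewrite !fctE /=; ring.
  - by move=> s b; rewrite /F2 /be /gh /hopf3 /= !hopf_coordE cos0 sin0 cos2pi sin2pi.
have I3 : int_box P3 = 0.
  apply: (int_box_db (F := F3) P3c).
  - move=> s a b; rewrite /F3 /P3 /al /be /gh /gb /hopf3/=.
    have dg := @Ck1_is_derive_curve R 4 _ g (fun x => hopf_coord s a x) _ b (@open_neq0 R)
      (hopf3_neq0 (s, (a, b))) Cg (is_derive_hopf_b s a b).
    have D := is_derive_mull (cos s * cos s) (is_derive_mul (is_deriveB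
      (is_derive_mull c (is_deriveD (is_derive_mull (sin a) (is_derive_cos b)) (is_derive_mull (cos a) (is_derive_sin b))))
      (is_derive_mull d (is_deriveB (is_derive_mull (cos a) (is_derive_cos b)) (is_derive_mull (sin a) (is_derive_sin b))))) dg).
    by apply: (is_derive_eq D); rewrite !fctE /=; ring.
  - by move=> s a; rewrite /F3 /be /gh /hopf3 /= !hopf_coordE cos0 sin0 cos2pi sin2pi.
rewrite /sphere_int (_ : (fun x => _) = fun x => P1 x + (P2 x - P3 x)).
  have EB : int_box (fun x => P2 x - P3 x) = 0.
    apply: (etrans (functionalB int_box_functional P2c P3c)).
    by apply: (etrans (congr2 (fun u v => u - v) I2 I3)); rewrite subrr.
  apply: (etrans (functionalD int_box_functional P1c (continuous_sub P2c P3c))).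
  by rewrite EB addr0; exact: I1.
apply/funext => x; rewrite /P1 /P2 /P3 /gs /ga /gb.
(* The partial derivatives of g become opaque numbers, so what remains is linear in them and follows
   from the coordinates of [field_hopf]. *)
have [d0 [d1 [d2 [d3 DE]]]] : exists d0 d1 d2 d3 : R, forall v, 'D_v g (hopf3 x) =
    crd 0 v * d0 + crd 1 v * d1 + crd 2 v * d2 + crd 3 v * d3.
  by do 4 eexists; move=> v; exact: (Ck1_derive4 v (hopf3_neq0 x) Cg).
rewrite !DE.
have E := field_hopf x.1 x.2.1 x.2.2 c d; rewrite -/(hopf3 x) -/(al x) -/(be x) in E.
have Ek k := congr1 (crd k) E.
have E0 := Ek 0%N; have E1 := Ek 1%N; have E2 := Ek 2%N; have E3 := Ek 3%N.
rewrite !(crdB, crdD, crdZ) in E0 E1 E2 E3.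
rewrite !(crdD, crdZ).
move: (crd 0 (J2 _)) (crd 1 (J2 _)) (crd 2 (J2 _)) (crd 3 (J2 _))
  (crd 0 (J3 _)) (crd 1 (J3 _)) (crd 2 (J3 _)) (crd 3 (J3 _)) E0 E1 E2 E3.
move=> u0 u1 u2 u3 w0 w1 w2 w3 E0 E1 E2 E3.
transitivity ((sin x.1 * cos x.1 * (c * u0 + d * w0)) * d0
  + (sin x.1 * cos x.1 * (c * u1 + d * w1)) * d1
  + (sin x.1 * cos x.1 * (c * u2 + d * w2)) * d2
  + (sin x.1 * cos x.1 * (c * u3 + d * w3)) * d3).
  by ring.
rewrite E0 E1 E2 E3; move: (gh x) (al x) (be x) (sin x.1) (cos x.1) => *.
by ring.
Qed.

End SphereIntegral.

(** * Time-dependent functions on the sphere *)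

Lemma continuous_pair_l (X Y : topologicalType) (x : X) : continuous (fun y : Y => (x, y)).
Proof. by move=> y; apply: cvg_pair; [exact: cvg_cst|exact: cvg_id]. Qed.

Lemma continuous_pair_fst (X Y Z : topologicalType) (h : Y -> Z) :
  continuous h -> continuous (fun xy : X * Y => (xy.1, h xy.2)).
Proof.
move=> hc -[x y]; apply: cvg_pair; first exact: cvg_fst.
by apply: (@continuous_comp _ _ _ snd h); [exact: cvg_snd|exact: hc].
Qed.

Section TimeDependent.
Variables (R : realType) (e : R).
Notation R4 := 'rV[R]_4.
Notation V := (R^o * R4)%type.

Definition slab : set V := [set tp | `|tp.1| < e /\ tp.2 != 0].

Lemma open_slab : open slab.
Proof.
rewrite (_ : slab = fst @^-1` [set t : R^o | `|t| < e] `&` snd @^-1` [set p : R4 | p != 0]) //.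
apply: openI.
  apply: open_comp; first by move=> x _; exact: cvg_fst.
  rewrite (_ : [set t : R^o | `|t| < e] = (fun t : R => `|t|) @^-1` [set y | y < e])//.
  by apply: open_comp; [move=> x _; exact: norm_continuous|exact: open_lt].
by apply: open_comp; [move=> x _; exact: cvg_snd|exact: open_neq0].
Qed.

Definition smooth_slab (G : V -> R^o) : Prop := forall n, Ck n slab G.

Definition dt (G : V -> R^o) : V -> R^o := 'D_((1 : R^o), (0 : R4)) G.
Definition dspace (v : R4) (G : V -> R^o) : V -> R^o := 'D_((0 : R^o), v) G.
Definition dx (m : nat) (G : V -> R^o) : V -> R^o := dspace (delta_mx ord0 (inord m)) G.
Definition slice (G : V -> R^o) (t : R^o) (p : R4) : R^o := G (t, p).

Lemma smooth_slab_derive (G : V -> R^o) v : smooth_slab G -> smooth_slab ('D_v G).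
Proof. by move=> sG n; have [_ /(_ v) []] := sG n.+1. Qed.

Lemma smooth_slab_dt G : smooth_slab G -> smooth_slab (dt G).
Proof. exact: smooth_slab_derive. Qed.

Lemma is_derive_dt G t p : smooth_slab G -> slab (t, p) ->
  is_derive t 1 (fun t : R => G (t, p)) (dt G (t, p)).
Proof.
move=> sG tp; apply: (@is_derive_affine R V R R^o G (fun t => (t, p)) (fun t => (t, 0))).
  by move=> x h v; congr (_, _); rewrite /= scaler0 add0r.
by apply: derivableP; have [_ /(_ (1, 0)) [+ _]] := sG 1%N; apply.
Qed.

Lemma slice_smooth G t n : `|t| < e -> smooth_slab G -> Ck n [set p : R4 | p != 0] (slice G t).
Proof.
move=> te sG; apply: (@Ck_affine R V R4 R^o n slab _ G (fun p => (t, p)) (fun p => (0, p))).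
- by move=> x h v; congr (_, _); rewrite /= scaler0 add0r.
- exact: (@continuous_pair_l R^o R4).
- by move=> p p0; split.
- exact: sG.
Qed.

Lemma slice_derive G t v p : 'D_v (slice G t) p = dspace v G (t, p).
Proof.
apply: (congr1 (fun f => f p) (@derive_affine R V R4 R^o G (fun p => (t, p)) (fun p => (0, p)) v _)).
by move=> x h w; congr (_, _); rewrite /= scaler0 add0r.
Qed.

(* Written with the derivatives in the fixed basis directions, so that joint
   continuity in (t, p) and commutation with [dt] hold termwise. *)
Definition along (L : R4 -> R4) (G : V -> R^o) (tp : V) : R :=
  crd 0 (L tp.2) * dx 0 G tp + crd 1 (L tp.2) * dx 1 G tp
  + crd 2 (L tp.2) * dx 2 G tp + crd 3 (L tp.2) * dx 3 G tp.

Lemma alongE (v : R4) (L : R4 -> R4) G t p : v = L p -> smooth_slab G -> slab (t, p) ->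
  'D_v (slice G t) p = along L G (t, p).
Proof.
move=> -> sG [/= te p0]; rewrite (Ck1_derive4 (L p) p0 (slice_smooth 1 te sG)).
by rewrite !slice_derive.
Qed.

(** The coefficients do not depend on t; on the partial derivatives, time and space differentiation
    are exchanged by [derive_comm]. *)
Lemma is_derive_along (L : R4 -> R4) G t p : smooth_slab G -> slab (t, p) ->
  is_derive t 1 (fun t : R => along L G (t, p)) (along L (dt G) (t, p)).
Proof.
move=> sG tp.
have H m : is_derive t 1 (fun t : R => dx m G (t, p)) (dx m (dt G) (t, p)).
  have := is_derive_dt (smooth_slab_derive ((0 : R^o), (delta_mx ord0 (inord m) : R4)) sG) tp.
  by rewrite /dt /dx /dspace (derive_comm _ _ open_slab tp (sG 2%N)).
have H' m (c : R) := is_derive_mull c (H m).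
have D := is_deriveD (is_deriveD (is_deriveD (H' 0%N (crd 0 (L p))) (H' 1%N (crd 1 (L p))))
  (H' 2%N (crd 2 (L p)))) (H' 3%N (crd 3 (L p))).
refine D.
Qed.

Lemma continuous_along (L : {linear R4 -> R4}) G tp : smooth_slab G -> slab tp ->
  {for tp, continuous (along L G : V -> R)}.
Proof.
move=> sG Utp.
have H m : {for tp, continuous (fun tp : V => crd m (L tp.2) * dx m G tp : R)}.
  apply: (@continuousM R V (fun tp => crd m (L tp.2)) (dx m G)).
    apply: (@continuous_comp _ _ _ (fun tp : V => L tp.2) (crd m)); last exact: crd_continuous.
    apply: (@continuous_comp _ _ _ snd L); last exact: linear_rV_continuous.
    exact: cvg_snd.
  exact: (Ck_continuous (smooth_slab_derive _ sG 0%N)).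
exact: (cvgD (cvgD (cvgD (H 0%N) (H 1%N)) (H 2%N)) (H 3%N)).
Qed.

Lemma continuous_at_hopf (f : V -> R) t (x : R * (R * R)) : `|t| < e ->
  (forall tp, slab tp -> {for tp, continuous f}) ->
  {for (t, x), continuous (fun tx : R * (R * (R * R)) => f (tx.1, hopf3 tx.2))}.
Proof.
move=> te fc.
apply: (@continuous_comp _ _ _ (fun tx : R * (R * (R * R)) => (tx.1, hopf3 tx.2)) f).
  exact/continuous_pair_fst/hopf3_continuous.
by apply: fc; split => //; exact: hopf3_neq0.
Qed.

Lemma continuous_slice_hopf (f : V -> R) t : `|t| < e ->
  (forall tp, slab tp -> {for tp, continuous f}) ->
  continuous (fun x : R * (R * R) => f (t, hopf3 x)).
Proof.
move=> te fc x.
apply: (@continuous_comp _ _ _ (fun x => (t, x)) (fun tx : R * (R * (R * R)) => f (tx.1, hopf3 tx.2))).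
  exact: continuous_pair_l.
exact: continuous_at_hopf.
Qed.

Lemma sphere_int_derive (f df : V -> R) (t : R) : `|t| < e ->
  (forall tp, slab tp -> {for tp, continuous f}) ->
  (forall tp, slab tp -> {for tp, continuous df}) ->
  (forall s p, slab (s, p) -> is_derive s 1 (fun s : R => f (s, p)) (df (s, p))) ->
  is_derive t 1 (fun t => sphere_int (fun x => f (t, hopf3 x))) (sphere_int (fun x => df (t, hopf3 x))).
Proof.
move=> te fc dfc fdf.
have near_e : \forall s \near t, `|s| < e.
  apply: (@open_nbhs_nbhs R t [set s | `|s| < e]); split=> //.
  rewrite (_ : [set s : R | `|s| < e] = (fun t : R => `|t|) @^-1` [set y | y < e])//.
  by apply: open_comp; [move=> x _; exact: norm_continuous|exact: open_lt].
apply: (functional_derive (@compact_box R) (@sphere_int_functional R)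
   (f := fun t x => f (t, hopf3 x)) (df := fun t x => df (t, hopf3 x))).
- by apply: filterS near_e => s se; exact: continuous_slice_hopf.
- exact: continuous_slice_hopf.
- apply: filterS near_e => s se x _; apply: fdf; split=> //; exact: hopf3_neq0.
- by move=> x _; exact: continuous_at_hopf.
Qed.

End TimeDependent.

(** * First and second variation of the energy *)

Section Quadratic.
Variables (R : realType) (e mu lambda : R).
Notation R4 := 'rV[R]_4.
Notation V := (R^o * R4)%type.
Implicit Types F G : nat -> V -> R^o.

(** The nine frame components of the covariant derivative, three each along J p, J2 p and J3 p. They
    are linear in F, so time differentiation merely replaces F by [dtf F]. *)
Definition zcomp (j : nat) F (tp : V) : R :=
  match j with
  | 0%N => along (@J R) (F 0%N) tp
  | 1%N => along (@J R) (F 1%N) tp + (2 - mu) * F 2%N tp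
  | 2%N => along (@J R) (F 2%N) tp - (2 - mu) * F 1%N tp
  | 3%N => along (@J2 R) (F 0%N) tp - F 2%N tp
  | 4%N => along (@J2 R) (F 1%N) tp
  | 5%N => along (@J2 R) (F 2%N) tp + mu * F 0%N tp
  | 6%N => along (@J3 R) (F 0%N) tp + F 1%N tp
  | 7%N => along (@J3 R) (F 1%N) tp - mu * F 0%N tp
  | _ => along (@J3 R) (F 2%N) tp
  end.

(** Components along J p have squared length mu, and derivatives in direction J p carry 1 / lambda.
    The indices 7 and 8 get the default 1. *)
Definition zweight (j : nat) : R :=
  nth 1 [:: mu / lambda; lambda^-1; lambda^-1; mu; 1; 1; mu] j.

(** The energy density without its constant, polarised so that time derivatives obey a product
    rule. *)
Definition quad F G (tp : V) : R := \sum_(j < 9) zweight j * (zcomp j F tp * zcomp j G tp).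

Definition smooth_family F := forall k, smooth_slab e (F k).
Definition dtf F : nat -> V -> R^o := fun k => dt (F k).

Lemma smooth_family_dtf F : smooth_family F -> smooth_family (dtf F).
Proof. by move=> sF k; exact: smooth_slab_dt. Qed.

Lemma is_derive_zcomp j F t p : smooth_family F -> slab e (t, p) ->
  is_derive t 1 (fun t : R => zcomp j F (t, p)) (zcomp j (dtf F) (t, p)).
Proof.
move=> sF tp.
have a L k := is_derive_along L (sF k) tp.
have b k := is_derive_dt (sF k) tp.
have c r k := is_derive_mull r (b k).
case: j => [|[|[|[|[|[|[|[|j]]]]]]]] /=.
- exact: a.
- exact: (is_deriveD (a _ _) (c _ _)).
- exact: (is_deriveB (a _ _) (c _ _)).
- exact: (is_deriveB (a _ _) (b _)).
- exact: a.
- exact: (is_deriveD (a _ _) (c _ _)).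
- exact: (is_deriveD (a _ _) (b _)).
- exact: (is_deriveB (a _ _) (c _ _)).
- exact: a.
Qed.

Lemma continuous_zcomp j F tp : smooth_family F -> slab e tp -> {for tp, continuous (zcomp j F)}.
Proof.
move=> sF Utp.
have a (L : {linear R4 -> R4}) k := @continuous_along R e L (F k) tp (sF k) Utp.
have b k : {for tp, continuous (F k : V -> R)} := Ck_continuous (sF k 0%N) Utp.
have c r k : {for tp, continuous (fun tp => r * F k tp : R)}.
  by apply: (@continuousM R V (cst r) (F k)); [exact: cst_continuous|exact: b].
case: j => [|[|[|[|[|[|[|[|j]]]]]]]] /=.
- exact: a.
- exact: (cvgD (a _ _) (c _ _)).
- exact: (cvgB (a _ _) (c _ _)).
- exact: (cvgB (a _ _) (b _)).
- exact: a.
- exact: (cvgD (a _ _) (c _ _)).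
- exact: (cvgD (a _ _) (b _)).
- exact: (cvgB (a _ _) (c _ _)).
- exact: a.
Qed.

Lemma is_derive_quad F G t p : smooth_family F -> smooth_family G -> slab e (t, p) ->
  is_derive t 1 (fun t : R => quad F G (t, p)) (quad (dtf F) G (t, p) + quad F (dtf G) (t, p)).
Proof.
move=> sF sG tp.
have H (j : 'I_9) := is_derive_mull (zweight j) (is_derive_mul
  (is_derive_zcomp j sF tp) (is_derive_zcomp j sG tp)).
have := is_derive_sum H.
rewrite (_ : \sum_(j < 9) _ = fun t : R => quad F G (t, p)); last first.
  by apply/funext => s; rewrite fct_sumE.
rewrite (_ : \sum_(j < 9) _ = quad (dtf F) G (t, p) + quad F (dtf G) (t, p))//.
by rewrite /quad -big_split/=; apply: eq_bigr => j _; rewrite -mulrDr.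
Qed.

Lemma continuous_quad F G tp : smooth_family F -> smooth_family G -> slab e tp ->
  {for tp, continuous (quad F G)}.
Proof.
move=> sF sG Utp; rewrite /quad; apply: (@continuous_at_sum R V R^o) => j _.
apply: (@continuousM R V (cst (zweight j)) (fun tp => zcomp j F tp * zcomp j G tp)).
  exact: cst_continuous.
by apply: (@continuousM R V (zcomp j F) (zcomp j G)); exact: continuous_zcomp.
Qed.

Lemma quad_sym F G tp : quad F G tp = quad G F tp.
Proof. by apply: eq_bigr => j _; rewrite (mulrC (zcomp j F tp)). Qed.

Lemma quadE F G tp : quad F G tp =
  mu / lambda * (zcomp 0 F tp * zcomp 0 G tp)
  + lambda^-1 * (zcomp 1 F tp * zcomp 1 G tp) + lambda^-1 * (zcomp 2 F tp * zcomp 2 G tp)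
  + mu * (zcomp 3 F tp * zcomp 3 G tp) + (zcomp 4 F tp * zcomp 4 G tp) + (zcomp 5 F tp * zcomp 5 G tp)
  + mu * (zcomp 6 F tp * zcomp 6 G tp) + (zcomp 7 F tp * zcomp 7 G tp) + (zcomp 8 F tp * zcomp 8 G tp).
Proof. by rewrite /quad 9!big_ord_recl big_ord0 /zweight /= addr0 !addrA !mul1r. Qed.

Lemma energy_density_quad F tp :
  energy_density mu lambda (F 0%N tp) (F 1%N tp) (F 2%N tp)
    (along (@J R) (F 0%N) tp) (along (@J R) (F 1%N) tp) (along (@J R) (F 2%N) tp)
    (along (@J2 R) (F 0%N) tp) (along (@J2 R) (F 1%N) tp) (along (@J2 R) (F 2%N) tp)
    (along (@J3 R) (F 0%N) tp) (along (@J3 R) (F 1%N) tp) (along (@J3 R) (F 2%N) tp)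
  = (mu / lambda + 2) + quad F F tp.
Proof.
rewrite quadE /energy_density /=.
move: (F 0%N tp) (F 1%N tp) (F 2%N tp)
    (along (@J R) (F 0%N) tp) (along (@J R) (F 1%N) tp) (along (@J R) (F 2%N) tp)
    (along (@J2 R) (F 0%N) tp) (along (@J2 R) (F 1%N) tp) (along (@J2 R) (F 2%N) tp)
    (along (@J3 R) (F 0%N) tp) (along (@J3 R) (F 1%N) tp) (along (@J3 R) (F 2%N) tp)=> *.
by ring.
Qed.

End Quadratic.

Section Energy.
Variables (R : realType) (e mu lambda : R) (nabla : ('rV[R]_4 -> 'rV[R]_4) -> 'rV[R]_4 -> 'rV[R]_4 -> 'rV[R]_4).
Notation R4 := 'rV[R]_4.
Notation V := (R^o * R4)%type.
Hypotheses (mu_gt0 : 0 < mu) (lambda_gt0 : 0 < lambda) (Hn : levi_civita mu nabla).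
Variable X : R -> R4 -> R4.
Hypothesis e_gt0 : 0 < e.
Hypothesis sX : smooth (slab e) (fun tp => X tp.1 (radial tp.2)).
Hypothesis uX : forall t, `|t| < e -> unit_field mu (X t).

Definition frame (k : nat) : {linear R4 -> R4} :=
  match k with 0%N => @J R | 1%N => @J2 R | _ => @J3 R end.

(** Precomposing with the radial projection makes the space derivatives of a slice those of [dS3].
    The product is the round one, so the Hopf field has first component 1 / sqrt mu. *)
Definition frame_comp (k : nat) (tp : V) : R^o :=
  dot (X tp.1 (radial tp.2)) (frame k (radial tp.2)).

Lemma smooth_frame_comp : smooth_family e frame_comp.
Proof.
move=> k n; apply: Ck_dot; [exact: open_slab|exact: sX|].
apply: (@Ck_linear_comp R V R4 n _ (frame k) (fun tp : V => radial tp.2)); first exact: open_slab.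
apply: (@Ck_affine R R4 V R4 n [set p | p != 0] (slab e) (@radial R) snd snd).
- by move=> x h v.
- by move=> x; exact: cvg_snd.
- by move=> tp [].
- exact: smooth_radial.
Qed.

Lemma energy_density_comp t p : `|t| < e -> S3 p ->
  \tr (energy_endo mu lambda nabla (X t) p) = (mu / lambda + 2) + quad mu lambda frame_comp frame_comp (t, p).
Proof.
move=> te Sp; have tp : slab e (t, p) by split=> //; exact: S3_neq0.
rewrite (trace_energy_endo mu_gt0 lambda_gt0 Hn (uX te).1 Sp) -energy_density_quad.
have a k (L : R4 -> R4) := alongE (erefl (L p)) (smooth_frame_comp k) tp.
rewrite -!a /frame_comp /=.
by rewrite radial_id.
Qed.

Lemma energyE (t : R) : `|t| < e -> energy mu lambda nabla (X t) =
  2^-1 * (Num.sqrt lambda * sphere_int (fun x => (mu / lambda + 2) + quad mu lambda frame_comp frame_comp (t, hopf3 x))).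
Proof.
move=> te; congr (_ * _).
apply: (integral_S3E (g := fun p => (mu / lambda + 2) + quad mu lambda frame_comp frame_comp (t, p))).
- exact: ltW.
- by move=> p Sp; exact: energy_density_comp.
- apply: (continuous_slice_hopf (e := e) (f := fun tp : V => (mu / lambda + 2) + quad mu lambda frame_comp frame_comp tp)) => //.
  move=> tp Utp; apply: (@cvgD _ _ _ _ _ (cst (mu / lambda + 2))); first exact: cst_continuous.
  exact: (@continuous_quad R e mu lambda _ _ tp smooth_frame_comp smooth_frame_comp Utp).
Qed.

Lemma near_small (t : R) : `|t| < e -> \forall s \near t, `|s| < e.
Proof.
move=> te; apply: (@open_nbhs_nbhs R t [set s | `|s| < e]); split=> //.
rewrite (_ : [set s : R | `|s| < e] = (fun t : R => `|t|) @^-1` [set y | y < e])//.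
by apply: open_comp; [move=> x _; exact: norm_continuous|exact: open_lt].
Qed.

Lemma energy_derive (t : R) : `|t| < e -> is_derive t 1 (fun t => energy mu lambda nabla (X t))
  (Num.sqrt lambda * sphere_int (fun x => quad mu lambda frame_comp (dtf frame_comp) (t, hopf3 x))).
Proof.
move=> te; have sc := smooth_frame_comp; have sc1 := smooth_family_dtf sc.
have D : is_derive t 1 (fun t => sphere_int (fun x => (mu / lambda + 2) + quad mu lambda frame_comp frame_comp (t, hopf3 x)))
    (sphere_int (fun x => 2 * quad mu lambda frame_comp (dtf frame_comp) (t, hopf3 x))).
  apply: (sphere_int_derive (e := e) (f := fun tp : V => (mu / lambda + 2) + quad mu lambda frame_comp frame_comp tp)
     (df := fun tp => 2 * quad mu lambda frame_comp (dtf frame_comp) tp)); first exact: te.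
  - move=> tp Utp; apply: (@cvgD _ _ _ _ _ (cst (mu / lambda + 2))); first exact: cst_continuous.
    exact: (@continuous_quad R e mu lambda _ _ tp sc sc Utp).
  - move=> tp Utp; apply: (@continuousM R V (cst 2) (quad mu lambda frame_comp (dtf frame_comp))).
      exact: cst_continuous.
    exact: (@continuous_quad R e mu lambda _ _ tp sc sc1 Utp).
  - move=> s p sp.
    have := is_deriveD (is_derive_cst (mu / lambda + 2) s 1) (is_derive_quad mu lambda sc sc sp).
    by rewrite add0r (quad_sym _ _ (dtf frame_comp)) mulrDl mul1r.
rewrite (functionalZ (@sphere_int_functional R)) in D; last first.
  exact: (continuous_slice_hopf te (fun tp Utp => @continuous_quad R e mu lambda _ _ tp sc sc1 Utp)).
apply: (near_eq_is_derive (f := fun t => 2^-1 * (Num.sqrt lambda *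
    sphere_int (fun x => (mu / lambda + 2) + quad mu lambda frame_comp frame_comp (t, hopf3 x))))).
  by apply: filterS (near_small te) => s se; rewrite energyE.
apply: (is_derive_eq (is_derive_mull 2^-1 (is_derive_mull (Num.sqrt lambda) D))).
by rewrite mulrCA mulKf// pnatr_eq0.
Qed.

Lemma energy_derive2 : is_derive (0 : R) 1 (derive1 (fun t => energy mu lambda nabla (X t)))
  (Num.sqrt lambda * sphere_int (fun x => quad mu lambda (dtf frame_comp) (dtf frame_comp) (0, hopf3 x)
     + quad mu lambda frame_comp (dtf (dtf frame_comp)) (0, hopf3 x))).
Proof.
have sc := smooth_frame_comp; have sc1 := smooth_family_dtf sc; have sc2 := smooth_family_dtf sc1.
have e0 : `|0 : R| < e by rewrite normr0.
have D : is_derive (0 : R) 1 (fun t => sphere_int (fun x => quad mu lambda frame_comp (dtf frame_comp) (t, hopf3 x)))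
  (sphere_int (fun x => quad mu lambda (dtf frame_comp) (dtf frame_comp) (0, hopf3 x)
     + quad mu lambda frame_comp (dtf (dtf frame_comp)) (0, hopf3 x))).
  apply: (sphere_int_derive (e := e) (f := quad mu lambda frame_comp (dtf frame_comp))
     (df := fun tp => quad mu lambda (dtf frame_comp) (dtf frame_comp) tp
       + quad mu lambda frame_comp (dtf (dtf frame_comp)) tp)); first exact: e0.
  - by move=> tp Utp; exact: (@continuous_quad R e mu lambda _ _ tp sc sc1 Utp).
  - move=> tp Utp.
    exact: (cvgD (@continuous_quad R e mu lambda _ _ tp sc1 sc1 Utp) (@continuous_quad R e mu lambda _ _ tp sc sc2 Utp)).
  - by move=> s p sp; exact: (is_derive_quad mu lambda sc sc1 sp).
apply: (near_eq_is_derive (f := fun t => Num.sqrt lambda *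
    sphere_int (fun x => quad mu lambda frame_comp (dtf frame_comp) (t, hopf3 x)))).
  apply: filterS (near_small e0) => s se; rewrite derive1E.
  by have [_ ->] := energy_derive se.
Qed.

Lemma along_cst L G t p c : smooth_slab e G -> slab e (t, p) ->
  (forall q, q != 0 -> G (t, q) = c) -> along L G (t, p) = 0.
Proof.
move=> sG tp Gc; rewrite -(alongE (erefl (L p)) sG tp).
rewrite (near_eq_derive (g := cst (c : R^o))) ?derive_cst//.
by apply: (filterS _ (open_nbhs_nbhs (conj (@open_neq0 R) tp.2))) => q q0; exact: Gc.
Qed.

Lemma sphere_int_along (L : {linear R4 -> R4}) (c d : R) G t : `|t| < e -> smooth_slab e G ->
  (forall p, L p = c *: J2 p + d *: J3 p) ->
  sphere_int (fun x => along L G (t, hopf3 x)) = 0.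
Proof.
move=> te sG LE; rewrite -(sphere_divergence c d (slice_smooth 1 te sG)).
congr sphere_int; apply/funext => x; rewrite -LE.
by rewrite -(alongE (erefl (L (hopf3 x))) sG)//; split=> //; exact: hopf3_neq0.
Qed.

Hypothesis X0 : forall p, S3 p -> X 0 p = hopf_unit mu p.

Let s0 p : p != 0 -> slab e (0, p). Proof. by move=> p0; split; rewrite //= normr0. Qed.

Lemma frame_comp_at0 p : p != 0 ->
  (frame_comp 0 (0, p) = (Num.sqrt mu)^-1) * (frame_comp 1 (0, p) = 0) * (frame_comp 2 (0, p) = 0).
Proof.
move=> p0; rewrite /frame_comp/= X0; last exact: S3_radial.
by rewrite /hopf_unit /hopf !dotZl !dot_frame (S3_radial p0) mulr1 mulr0.
Qed.

(** For the Hopf field the components are constant, so only the entries 5 and 7 of [zcomp] survive,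
    with values sqrt mu and - sqrt mu. *)
Lemma quad_comp_at0 G p : p != 0 -> quad mu lambda frame_comp G (0, p) =
  Num.sqrt mu * (along (@J2 R) (G 2%N) (0, p) - along (@J3 R) (G 1%N) (0, p) + 2 * mu * G 0%N (0, p)).
Proof.
move=> p0; have sc := smooth_frame_comp; have p0' := s0 p0.
have a0 L : along L (frame_comp 0) (0, p) = 0.
  by apply: (along_cst L (sc 0%N) p0') => q q0; rewrite !(frame_comp_at0 q0).
have a1 L : along L (frame_comp 1) (0, p) = 0.
  by apply: (along_cst L (sc 1%N) p0') => q q0; rewrite !(frame_comp_at0 q0).
have a2 L : along L (frame_comp 2) (0, p) = 0.
  by apply: (along_cst L (sc 2%N) p0') => q q0; rewrite !(frame_comp_at0 q0).
have mE : mu * (Num.sqrt mu)^-1 = Num.sqrt mu.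
  by rewrite -{1}(sqr_sqrtr (ltW mu_gt0)) expr2 mulfK// gt_eqF// sqrtr_gt0.
rewrite quadE /= !(a0, a1, a2) !(frame_comp_at0 p0) mE.
move: (along (@J2 R) (G 2%N) _) (along (@J3 R) (G 1%N) _) (G 0%N _) => *.
by ring.
Qed.

Lemma frame_comp_unit t p : slab e (t, p) ->
  mu * (frame_comp 0 (t, p) * frame_comp 0 (t, p)) + frame_comp 1 (t, p) * frame_comp 1 (t, p)
    + frame_comp 2 (t, p) * frame_comp 2 (t, p) = 1.
Proof.
move=> [/= te p0]; have Sp := S3_radial p0.
rewrite -((uX te).2 _ Sp) (berger_frame _ _ Sp)//.
exact: ((uX te).1.2 _ Sp).
Qed.

Lemma is_derive_near_cst (f : R -> R) (t d c : R) : is_derive t 1 f d -> (\forall s \near t, f s = c) -> d = 0.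
Proof. by move=> [_ <-] fc; rewrite (near_eq_derive (g := cst c)) ?derive_cst. Qed.

(** Stated at every time, not only at 0, since it is differentiated once more. *)
Lemma frame_comp_unit_dt t p : slab e (t, p) ->
  mu * (frame_comp 0 (t, p) * dt (frame_comp 0) (t, p)) + frame_comp 1 (t, p) * dt (frame_comp 1) (t, p)
    + frame_comp 2 (t, p) * dt (frame_comp 2) (t, p) = 0.
Proof.
move=> tp; have d k := is_derive_dt (smooth_frame_comp k) tp.
have m k := is_derive_mul (d k) (d k).
have D := is_deriveD (is_deriveD (is_derive_mull mu (m 0%N)) (m 1%N)) (m 2%N).
have := is_derive_near_cst (c := 1) D _.
have N : \forall s \near t, mu * (frame_comp 0 (s, p) * frame_comp 0 (s, p))
    + frame_comp 1 (s, p) * frame_comp 1 (s, p) + frame_comp 2 (s, p) * frame_comp 2 (s, p) = 1.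
  by apply: filterS (near_small tp.1) => s se; apply: frame_comp_unit; split=> //; exact: tp.2.
move=> /(_ N).
move: (frame_comp 0 (t, p)) (frame_comp 1 (t, p)) (frame_comp 2 (t, p))
  (dt (frame_comp 0) _) (dt (frame_comp 1) _) (dt (frame_comp 2) _).
move=> a b c a' b' c' E; lra.
Qed.

Lemma frame_comp_unit_dt2 t p : slab e (t, p) ->
  mu * (dt (frame_comp 0) (t, p) ^+ 2 + frame_comp 0 (t, p) * dt (dt (frame_comp 0)) (t, p))
  + (dt (frame_comp 1) (t, p) ^+ 2 + frame_comp 1 (t, p) * dt (dt (frame_comp 1)) (t, p))
  + (dt (frame_comp 2) (t, p) ^+ 2 + frame_comp 2 (t, p) * dt (dt (frame_comp 2)) (t, p)) = 0.
Proof.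
move=> tp; have d k := is_derive_dt (smooth_frame_comp k) tp.
have d' k := is_derive_dt (smooth_slab_dt (smooth_frame_comp k)) tp.
have m k := is_derive_mul (d k) (d' k).
have D := is_deriveD (is_deriveD (is_derive_mull mu (m 0%N)) (m 1%N)) (m 2%N).
have := is_derive_near_cst (c := 0) D _.
have N : \forall s \near t, mu * (frame_comp 0 (s, p) * dt (frame_comp 0) (s, p)) + frame_comp 1 (s, p) * dt (frame_comp 1) (s, p)
    + frame_comp 2 (s, p) * dt (frame_comp 2) (s, p) = 0.
  by apply: filterS (near_small tp.1) => s se; apply: frame_comp_unit_dt; split=> //; exact: tp.2.
by move=> /(_ N); rewrite -!expr2.
Qed.

Lemma dt_frame_comp0_at0 p : p != 0 -> dt (frame_comp 0) (0, p) = 0.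
Proof.
move=> p0; have := frame_comp_unit_dt (s0 p0); rewrite !(frame_comp_at0 p0) !mul0r !addr0.
move=> /eqP; rewrite mulf_eq0 gt_eqF//= mulf_eq0 invr_eq0 gt_eqF ?sqrtr_gt0//= => /eqP.
exact.
Qed.

Lemma dt2_frame_comp0_at0 p : p != 0 -> Num.sqrt mu * dt (dt (frame_comp 0)) (0, p) =
  - (dt (frame_comp 1) (0, p) ^+ 2 + dt (frame_comp 2) (0, p) ^+ 2).
Proof.
move=> p0; have := frame_comp_unit_dt2 (s0 p0).
have := (dt_frame_comp0_at0 p0); move: (frame_comp_at0 p0).
move: (frame_comp 0 (0, p)) (frame_comp 1 (0, p)) (frame_comp 2 (0, p)) (dt (frame_comp 0) (0, p)) (dt (frame_comp 1) (0, p))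
  (dt (frame_comp 2) (0, p)) (dt (dt (frame_comp 0)) (0, p)) (dt (dt (frame_comp 1)) (0, p)) (dt (dt (frame_comp 2)) (0, p)).
move=> a b c a' b' c' a2 b2 c2 [[-> ->] ->] ->; rewrite !mul0r !addr0 expr0n/= add0r mulrA.
have -> : mu * (Num.sqrt mu)^-1 = Num.sqrt mu.
  by rewrite -{1}(sqr_sqrtr (ltW mu_gt0)) expr2 mulfK// gt_eqF// sqrtr_gt0.
by rewrite -addrA => /eqP; rewrite addr_eq0 => /eqP.
Qed.

Let e0 : `|0 : R| < e. Proof. by rewrite normr0. Qed.

Lemma sphere_int_slice G : smooth_slab e G -> continuous (fun x => G (0, hopf3 x) : R).
Proof. by move=> sG; apply: (continuous_slice_hopf e0) => tp Utp; exact: (Ck_continuous (sG 0%N) Utp). Qed.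

Lemma continuous_along_hopf (L : {linear R4 -> R4}) G : smooth_slab e G ->
  continuous (fun x => along L G (0, hopf3 x)).
Proof. by move=> sG; apply: (continuous_slice_hopf e0) => tp Utp; exact: (continuous_along (L := L) sG Utp). Qed.

Lemma sphere_int_curl G : smooth_family e G ->
  sphere_int (fun x => Num.sqrt mu * (along (@J2 R) (G 2%N) (0, hopf3 x) - along (@J3 R) (G 1%N) (0, hopf3 x))) = 0.
Proof.
move=> sG; have F := @sphere_int_functional R.
have c2 := @continuous_along_hopf (@J2 R) _ (sG 2%N); have c3 := @continuous_along_hopf (@J3 R) _ (sG 1%N).
have i2 : sphere_int (fun x => along (@J2 R) (G 2%N) (0, hopf3 x)) = 0.
  by apply: (sphere_int_along (L := @J2 R) (c := 1) (d := 0) e0 (sG 2%N)) => p; rewrite scale1r scale0r addr0.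
have i3 : sphere_int (fun x => along (@J3 R) (G 1%N) (0, hopf3 x)) = 0.
  by apply: (sphere_int_along (L := @J3 R) (c := 0) (d := 1) e0 (sG 1%N)) => p; rewrite scale1r scale0r add0r.
have E := functionalZ F (Num.sqrt mu) (continuous_sub c2 c3).
have E' := functionalB F c2 c3.
by rewrite E E' i2 i3 subrr mulr0.
Qed.

Lemma energy_critical : is_derive (0 : R) 1 (fun t => energy mu lambda nabla (X t)) 0.
Proof.
apply: (is_derive_eq (energy_derive e0)).
rewrite (_ : (fun x => _) = fun x => Num.sqrt mu * (along (@J2 R) (dtf frame_comp 2%N) (0, hopf3 x)
   - along (@J3 R) (dtf frame_comp 1%N) (0, hopf3 x))).
  by rewrite (sphere_int_curl (smooth_family_dtf smooth_frame_comp)) mulr0.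
apply/funext => x; rewrite quad_comp_at0; last exact: hopf3_neq0.
by rewrite [dtf frame_comp 0 _](dt_frame_comp0_at0 (hopf3_neq0 x)) mulr0 addr0.
Qed.

(** Second time derivatives enter through [quad_comp_at0] alone: a curl that integrates to 0, and 2
    mu sqrt mu x0'', which the unit constraint turns into - 2 mu |a|^2. Half of this is later
    compensated by the J p components of the derivatives along J2 p and J3 p, which contribute mu
    |a|^2 to [quad]. *)
Lemma energy_hessian : is_derive (0 : R) 1 (derive1 (fun t => energy mu lambda nabla (X t)))
  (Num.sqrt lambda * sphere_int (fun x => quad mu lambda (dtf frame_comp) (dtf frame_comp) (0, hopf3 x)
     - 2 * mu * (dt (frame_comp 1) (0, hopf3 x) * dt (frame_comp 1) (0, hopf3 x)
       + dt (frame_comp 2) (0, hopf3 x) * dt (frame_comp 2) (0, hopf3 x)))).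
Proof.
have sc := smooth_frame_comp; have sc1 := smooth_family_dtf sc; have sc2 := smooth_family_dtf sc1.
apply: (is_derive_eq energy_derive2); apply: (congr1 (fun u => Num.sqrt lambda * u)).
set f := (fun x => _ - _).
rewrite (_ : (fun x => _) = fun x => f x + Num.sqrt mu * (along (@J2 R) (dtf (dtf frame_comp) 2%N) (0, hopf3 x)
   - along (@J3 R) (dtf (dtf frame_comp) 1%N) (0, hopf3 x))).
  rewrite (functionalD (@sphere_int_functional R)).
  - by rewrite (sphere_int_curl sc2) addr0.
  - have cq := continuous_slice_hopf e0 (fun tp Utp => @continuous_quad R e mu lambda _ _ tp sc1 sc1 Utp).
    have c1 := sphere_int_slice (sc1 1%N); have c2 := sphere_int_slice (sc1 2%N).
    apply: (continuous_sub cq); apply: continuous_cst_mul.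
    exact: (continuous_addf (continuous_mul c1 c1) (continuous_mul c2 c2)).
  - apply: continuous_cst_mul; apply: continuous_sub.
      exact: (@continuous_along_hopf (@J2 R) _ (sc2 2%N)).
    exact: (@continuous_along_hopf (@J3 R) _ (sc2 1%N)).
apply/funext => x; rewrite quad_comp_at0; last exact: hopf3_neq0.
have E := dt2_frame_comp0_at0 (hopf3_neq0 x); rewrite /f /dtf !expr2 in E *.
move: E; move: (quad _ _ _ _ _) (along (@J2 R) _ _) (along (@J3 R) _ _)
  (dt (dt (frame_comp 0)) _) (dt (frame_comp 1) _) (dt (frame_comp 2) _).
move=> q u v w a b E.
have -> : Num.sqrt mu * (u - v + 2 * mu * w) = Num.sqrt mu * (u - v) + 2 * mu * (Num.sqrt mu * w) by ring.
by rewrite E; ring.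
Qed.

End Energy.

(** * The destabilizing direction *)

Section Direction.
Variable R : realType.
Notation R4 := 'rV[R]_4.

Definition im_sq (p : R4) : R^o := 2 * (crd 0 p * crd 1 p).
Definition re_sq (p : R4) : R^o := crd 0 p * crd 0 p - crd 1 p * crd 1 p.
Definition direction (p : R4) : R4 := im_sq p *: J2 p + re_sq p *: J3 p.

Lemma Ck_crd_comp (V : normedModType R) n (U : set V) k (f : V -> R4) : open U -> Ck n U f ->
  Ck n U (fun x => crd k (f x)).
Proof. exact: Ck_crd. Qed.

Lemma Ck_sub (V : normedModType R) n (U : set V) (f g : V -> R^o) : open U ->
  Ck n U f -> Ck n U g -> Ck n U (fun x => f x - g x : R^o).
Proof.
move=> oU Cf Cg; have C1 : Ck n U (cst (-1 : R^o)) by exact: Ck_cst.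
apply: (eq_Ck oU _ (CkD oU Cf (CkM oU C1 Cg))) => x _ /=.
by rewrite mulN1r.
Qed.

Lemma Ck_im_sq (V : normedModType R) n (U : set V) (f : V -> R4) : open U -> Ck n U f ->
  Ck n U (fun x => im_sq (f x)).
Proof.
move=> oU Cf; apply: (CkM (f := cst 2)) => //; first exact: Ck_cst.
by apply: CkM => //; exact: Ck_crd_comp.
Qed.

Lemma Ck_re_sq (V : normedModType R) n (U : set V) (f : V -> R4) : open U -> Ck n U f ->
  Ck n U (fun x => re_sq (f x)).
Proof. by move=> oU Cf; apply: Ck_sub => //; apply: CkM => //; exact: Ck_crd_comp. Qed.

Lemma vector_field_direction : vector_field direction.
Proof.
apply: vector_fieldD; apply: vector_fieldZ.
- by move=> n; apply: Ck_im_sq; [exact: open_neq0|exact: smooth_radial].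
- exact: vector_field_J2.
- by move=> n; apply: Ck_re_sq; [exact: open_neq0|exact: smooth_radial].
- exact: vector_field_J3.
Qed.

Lemma direction_admissible mu : admissible_direction mu (hopf_unit mu) direction.
Proof.
split; first exact: vector_field_direction.
move=> p Sp; rewrite berger_frame//; last exact: vector_field_direction.2.
by rewrite /direction /hopf_unit /hopf !(dotDl, dotZl) !dot_frame; ring.
Qed.

Lemma is_derive_im_sq_radial (p v : R4) : S3 p -> tangent p v ->
  is_derive p v (im_sq \o @radial R) (2 * (crd 0 v * crd 1 p + crd 0 p * crd 1 v)).
Proof.
move=> Sp tv; have D k := is_derive_lin (@crd_continuous R k) (is_derive_radial Sp tv).
have := is_derive_mul (is_derive_cst (2 : R) p v) (is_derive_mul (D 0%N) (D 1%N)).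
by rewrite mul0r add0r /= radial_id.
Qed.

Lemma is_derive_re_sq_radial (p v : R4) : S3 p -> tangent p v ->
  is_derive p v (re_sq \o @radial R) (2 * (crd 0 p * crd 0 v - crd 1 p * crd 1 v)).
Proof.
move=> Sp tv; have D k := is_derive_lin (@crd_continuous R k) (is_derive_radial Sp tv).
have := is_deriveB (is_derive_mul (D 0%N) (D 0%N)) (is_derive_mul (D 1%N) (D 1%N)).
move=> H; apply: (is_derive_eq H); rewrite /= radial_id//.
by ring.
Qed.

End Direction.

(** * The value of the Hessian *)

Section HessianValue.
Variable R : realType.

Lemma int_ab_cst (c : R) : int_ab (fun=> c) = c * (pi *+ 2) ^+ 2.
Proof.
have F := pi2_gt0 R.
have ib (d : R) : int_b (fun=> d) = d * (pi *+ 2).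
  have D (x : R) : is_derive x 1 (fun x => d * x) d.
    by have := is_derive_mull d (is_derive_id x 1); rewrite mulr1.
  apply: (etrans (FTC F (@cst_continuous R R d) D)).
  by rewrite mulr0 subr0.
rewrite /int_ab; under eq_Rintegral do rewrite ib.
by have := ib (c * (pi *+ 2)); rewrite /int_b => ->; rewrite expr2 mulrA.
Qed.

Lemma sphere_int_latitude (h H : R -> R) : continuous h ->
  (forall s : R, is_derive s 1 H (h s * (sin s * cos s))) ->
  sphere_int (fun x => h x.1) = (pi *+ 2) ^+ 2 * (H (pi / 2) - H 0).
Proof.
move=> hc dH; rewrite /sphere_int /int_box.
under eq_Rintegral do rewrite /= int_ab_cst.
have c : continuous (fun s => h s * (sin s * cos s) * (pi *+ 2) ^+ 2).
  apply: continuous_mul; last exact: cst_continuous.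
  by apply: continuous_mul => //; apply: continuous_mul; [exact: continuous_sin|exact: continuous_cos].
have D (s : R) := is_derive_mulr ((pi *+ 2) ^+ 2) (dH s).
by apply: (etrans (FTC (pi_half_gt0 R) c D)); ring.
Qed.

Lemma sphere_int_value (k : R) :
  sphere_int (fun x => k * (cos x.1 ^+ 2 * cos x.1 ^+ 2) + 8 * (cos x.1 ^+ 2 * sin x.1 ^+ 2)) =
  (pi *+ 2) ^+ 2 * ((k + 4) / 6).
Proof.
pose h (s : R) := k * (cos s ^+ 2 * cos s ^+ 2) + 8 * (cos s ^+ 2 * sin s ^+ 2).
(* Antiderivative obtained from cos^5 sin for the first term and from 8 sin^3 cos (1 - sin^2) for
   the second. *)
pose H (s : R) := - k / 6 * (cos s * cos s * (cos s * cos s) * (cos s * cos s))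
  + 2 * (sin s * sin s * (sin s * sin s)) - 4 / 3 * (sin s * sin s * (sin s * sin s) * (sin s * sin s)).
have cc : continuous (@cos R) := @continuous_cos R.
have sc : continuous (@sin R) := @continuous_sin R.
have c2 : continuous (fun s : R => cos s ^+ 2) by exact: continuous_mul.
have s2 : continuous (fun s : R => sin s ^+ 2) by exact: continuous_mul.
have hc : continuous h.
  apply: continuous_addf; apply: continuous_cst_mul; exact: continuous_mul.
have dH (s : R) : is_derive s 1 H (h s * (sin s * cos s)).
  have C2 := is_derive_mul (is_derive_cos s) (is_derive_cos s).
  have S2 := is_derive_mul (is_derive_sin s) (is_derive_sin s).
  have C6 := is_derive_mul (is_derive_mul C2 C2) C2.
  have S4 := is_derive_mul S2 S2.
  have S6 := is_derive_mul S4 S2.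
  have D := is_deriveB (is_deriveD (is_derive_mull (- k / 6) C6) (is_derive_mull 2 S4)) (is_derive_mull (4 / 3) S6).
  apply: (is_derive_eq D); rewrite /h.
  transitivity (k * (cos s ^+ 5 * sin s) + 8 * (sin s ^+ 3 * cos s) * (1 - sin s ^+ 2)); first by field.
  by rewrite -cos2sin2; ring.
apply: (etrans (sphere_int_latitude hc dH)).
by rewrite /H cos_pihalf sin_pihalf cos0 sin0; congr (_ * _); field.
Qed.

End HessianValue.

Section Hessian.
Variables (R : realType) (e mu lambda : R) (nabla : ('rV[R]_4 -> 'rV[R]_4) -> 'rV[R]_4 -> 'rV[R]_4 -> 'rV[R]_4).
Notation R4 := 'rV[R]_4.
Notation V := (R^o * R4)%type.
Hypotheses (mu_gt0 : 0 < mu) (lambda_gt0 : 0 < lambda) (Hn : levi_civita mu nabla).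
Variable X : R -> R4 -> R4.
Hypothesis e_gt0 : 0 < e.
Hypothesis sX : smooth (slab e) (fun tp => X tp.1 (radial tp.2)).
Hypothesis uX : forall t, `|t| < e -> unit_field mu (X t).
Hypothesis X0 : forall p, S3 p -> X 0 p = hopf_unit mu p.

Lemma dt_frame_comp_at0 (A : R4 -> R4) k p : p != 0 ->
  (forall q, S3 q -> is_derive (0 : R) 1 (X ^~ q) (A q)) ->
  dt (frame_comp X k) (0, p) = dot (A (radial p)) (frame R k (radial p)).
Proof.
move=> p0 dX; have s0 : slab e (0, p) by split; rewrite //= normr0.
have [_ <-] := is_derive_dt (smooth_frame_comp sX k) s0.
have [_ D] := is_derive_dot (dX _ (S3_radial p0)) (is_derive_cst (frame R k (radial p)) (0 : R) 1).
by rewrite [dot _ 0]dotC dot0l addr0 in D; exact: D.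
Qed.

Hypothesis dX : forall p, S3 p -> is_derive (0 : R) 1 (X ^~ p) (direction p).

Let dt1 p : p != 0 -> dt (frame_comp X 1) (0, p) = im_sq (radial p).
Proof.
move=> p0; rewrite (dt_frame_comp_at0 1 p0 dX) /direction /= !(dotDl, dotZl) !dot_frame (S3_radial p0).
by rewrite mulr1 mulr0 addr0.
Qed.

Let dt2 p : p != 0 -> dt (frame_comp X 2) (0, p) = re_sq (radial p).
Proof.
move=> p0; rewrite (dt_frame_comp_at0 2 p0 dX) /direction /= !(dotDl, dotZl) !dot_frame (S3_radial p0).
by rewrite mulr1 mulr0 add0r.
Qed.

Lemma along_at0 (L : R4 -> R4) (G : V -> R^o) (g : R4 -> R^o) p d : smooth_slab e G -> S3 p ->
  (forall q, q != 0 -> G (0, q) = (g \o @radial R) q) -> is_derive p (L p) (g \o @radial R) d ->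
  along L G (0, p) = d.
Proof.
move=> sG Sp Gg [_ <-]; have p0 := S3_neq0 Sp.
have s0 : slab e (0, p) by split; rewrite //= normr0.
rewrite -(alongE (erefl (L p)) sG s0); apply: near_eq_derive.
by apply: (filterS _ (open_nbhs_nbhs (conj (@open_neq0 R) p0))) => q q0; exact: Gg.
Qed.

(** Here |a|^2 = |z|^4. The derivative along J p yields (mu - 4)^2 / lambda, the entries 3 and 6 of
    [zcomp] yield mu, and the derivatives of a along J2 p and J3 p contribute 4 |z|^2 |w|^2 each. *)
Lemma hessian_integrand p : S3 p ->
  quad mu lambda (dtf (frame_comp X)) (dtf (frame_comp X)) (0, p)
     - 2 * mu * (dt (frame_comp X 1) (0, p) * dt (frame_comp X 1) (0, p)
       + dt (frame_comp X 2) (0, p) * dt (frame_comp X 2) (0, p)) =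
  ((mu - 4) ^+ 2 / lambda - mu) * ((crd 0 p ^+ 2 + crd 1 p ^+ 2) * (crd 0 p ^+ 2 + crd 1 p ^+ 2))
  + 8 * ((crd 0 p ^+ 2 + crd 1 p ^+ 2) * (crd 2 p ^+ 2 + crd 3 p ^+ 2)).
Proof.
move=> Sp; have p0 := S3_neq0 Sp.
have sc1 := smooth_family_dtf (smooth_frame_comp sX).
have [[t1 t2] t3] := tangent_frame p.
have F0 q : q != 0 -> dtf (frame_comp X) 0 (0, q) = 0 := dt_frame_comp0_at0 mu_gt0 e_gt0 sX uX X0 (p := q).
have s0 : slab e (0, p) by split; rewrite //= normr0.
have a0 L : along L (dtf (frame_comp X) 0) (0, p) = 0 := along_cst L (sc1 0%N) s0 F0.
have a1 (L : R4 -> R4) (tL : tangent p (L p)) := along_at0 (sc1 1%N) Sp dt1 (is_derive_im_sq_radial Sp tL).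
have a2 (L : R4 -> R4) (tL : tangent p (L p)) := along_at0 (sc1 2%N) Sp dt2 (is_derive_re_sq_radial Sp tL).
have d1 : dtf (frame_comp X) 1 (0, p) = im_sq p by rewrite [LHS](dt1 p0) radial_id.
have d2 : dtf (frame_comp X) 2 (0, p) = re_sq p by rewrite [LHS](dt2 p0) radial_id.
rewrite -[dt (frame_comp X 1)]/(dtf (frame_comp X) 1) -[dt (frame_comp X 2)]/(dtf (frame_comp X) 2) d1 d2.
rewrite quadE /= !a0 (a1 _ t1) (a1 _ t2) (a1 _ t3) (a2 _ t1) (a2 _ t2) (a2 _ t3) d1 d2 (F0 _ p0).
rewrite /im_sq /re_sq JE /J2 /J3 !crd_row4.
move: (crd 0 p) (crd 1 p) (crd 2 p) (crd 3 p) => x0 x1 x2 x3.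
have l0 : lambda != 0 by rewrite gt_eqF.
by field.
Qed.

Lemma hessian_value : is_derive (0 : R) 1 (derive1 (fun t => energy mu lambda nabla (X t)))
  (Num.sqrt lambda * ((pi *+ 2) ^+ 2 * ((4 - mu + (mu - 4) ^+ 2 / lambda) / 6))).
Proof.
apply: (is_derive_eq (energy_hessian mu_gt0 lambda_gt0 Hn e_gt0 sX uX X0)).
apply: (congr1 (fun u => Num.sqrt lambda * u)).
rewrite (_ : (fun x => _) = fun x => ((mu - 4) ^+ 2 / lambda - mu) * (cos x.1 ^+ 2 * cos x.1 ^+ 2)
   + 8 * (cos x.1 ^+ 2 * sin x.1 ^+ 2)).
  by rewrite sphere_int_value -[_ - mu + 4]addrA (addrC (- mu)) (addrC ((mu - 4) ^+ 2 / lambda)).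
apply/funext => x; rewrite hessian_integrand; last exact: S3_hopf_coord.
rewrite /hopf3 hopf_coordE !crd_row4 !exprMn -!mulrDr !cos2Dsin2.
by rewrite !mulr1.
Qed.

End Hessian.

(** * A variation in the destabilizing direction *)

Section Rotation.
Variables (R : realType) (mu : R).
Hypothesis mu_gt0 : 0 < mu.
Notation R4 := 'rV[R]_4.
Notation V := (R^o * R4)%type.

(** With u = t a / 2 and [rho] = |u|^2, [rotation] is inverse stereographic projection of u into the
    sphere of unit tangent vectors: (1 - |u|^2) / (1 + |u|^2) along the Hopf field and 2 u / (1 +
    |u|^2) across it. It is smooth also where a vanishes. *)
Definition rho (t : R) (q : R4) : R := t * t * (4^-1 * (im_sq q * im_sq q + re_sq q * re_sq q)).
(** The inverse is written as a power so that [Ck_powR] gives its smoothness. *)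
Definition eta (t : R) (q : R4) : R := (1 + rho t q) `^ (-1).
Definition rotation (t : R) (q : R4) : R4 :=
  ((Num.sqrt mu)^-1 * ((1 - rho t q) * eta t q)) *: J q
  + (t * (im_sq q * eta t q)) *: J2 q + (t * (re_sq q * eta t q)) *: J3 q.

Lemma rho_ge0 t q : 0 <= rho t q.
Proof.
rewrite /rho; apply: mulr_ge0; first by rewrite -expr2 sqr_ge0.
by apply: mulr_ge0; rewrite ?invr_ge0// addr_ge0// -expr2 sqr_ge0.
Qed.

Lemma etaK t q : eta t q * (1 + rho t q) = 1.
Proof.
have h : 0 < 1 + rho t q by rewrite ltr_pwDl// rho_ge0.
by rewrite /eta powR_inv1 ?ltW// mulVf// gt_eqF.
Qed.

(** General [tau] and [p] serve both the field at a fixed time and joint smoothness in time and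
    space. *)
Lemma Ck_rotation (W : normedModType R) n (U : set W) (tau : W -> R^o) (p : W -> R4) :
  open U -> Ck n U tau -> Ck n U p -> Ck n U (fun x => rotation (tau x) (p x)).
Proof.
move=> oU Ct Cp.
have Ci := Ck_im_sq oU Cp; have Cr := Ck_re_sq oU Cp.
have Cc (c : R) : Ck n U (cst (c : R^o)) by exact: Ck_cst.
have Crho : Ck n U (fun x => rho (tau x) (p x) : R^o).
  apply: (CkM oU (CkM oU Ct Ct)); apply: (CkM oU (Cc 4^-1)).
  exact: (CkD oU (CkM oU Ci Ci) (CkM oU Cr Cr)).
have Ceta : Ck n U (fun x => eta (tau x) (p x) : R^o).
  apply: (Ck_comp (O := [set x : R^o | 0 < x]) (f := fun x => 1 + rho (tau x) (p x) : R^o) oU _ (Ck_powR n (-1))).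
    by move=> x _; rewrite /= ltr_pwDl// rho_ge0.
  exact: (CkD oU (Cc 1) Crho).
have CL (L : {linear R4 -> R4}) : Ck n U (fun x => L (p x)) by exact: (Ck_linear_comp L oU Cp).
apply: (CkD (f := fun x => _ + _) oU).
  apply: (CkD oU); apply: (Ck_scale oU) (CL _).
    exact: (CkM oU (Cc _) (CkM oU (Ck_sub oU (Cc 1) Crho) Ceta)).
  exact: (CkM oU Ct (CkM oU Ci Ceta)).
exact: (Ck_scale oU (CkM oU Ct (CkM oU Cr Ceta)) (CL (@J3 R))).
Qed.

Lemma rotation_unit t : unit_field mu (rotation t).
Proof.
have T p : S3 p -> tangent p (rotation t p).
  by move=> _; do ?apply: tangentD; apply: tangentZ; case: (tangent_frame p) => [[]].
split.
  split=> // n; apply: (Ck_rotation (tau := cst (t : R^o)) (p := @radial R)).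
  - exact: open_neq0.
  - exact: Ck_cst.
  - exact: smooth_radial.
move=> p Sp; rewrite (berger_frame _ _ Sp); last exact: T.
rewrite /rotation !(dotDl, dotZl) !dot_frame Sp.
have E := etaK t p.
have m : mu * ((Num.sqrt mu)^-1 * (Num.sqrt mu)^-1) = 1.
  by rewrite -invfM -expr2 sqr_sqrtr ?ltW// mulfV// gt_eqF.
have r : t * t * (im_sq p * im_sq p + re_sq p * re_sq p) = 4 * rho t p.
  by rewrite /rho; field.
(* What remains is the identity (1 - r)^2 + 4 r = (1 + r)^2. *)
move: (im_sq p) (re_sq p) (rho t p) (eta t p) (Num.sqrt mu)^-1 E m r => a b r h s E m r4.
transitivity ((mu * (s * s)) * ((1 - r) * h) ^+ 2 + (t * t * (a * a + b * b)) * h ^+ 2); first by ring.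
rewrite m r4; transitivity ((h * (1 + r)) ^+ 2); first by ring.
by rewrite E expr1n.
Qed.

Lemma rotation0 q : rotation 0 q = hopf_unit mu q.
Proof.
rewrite /rotation /eta /rho !mul0r !scale0r !addr0 subr0 powR1 !mulr1.
by [].
Qed.

Lemma is_derive_rotation q : is_derive (0 : R) 1 (rotation ^~ q) (direction q).
Proof.
set c := 4^-1 * (im_sq q * im_sq q + re_sq q * re_sq q).
have Dr : is_derive (0 : R) 1 (fun t => rho t q) 0.
  have := is_derive_mulr c (is_derive_mul (is_derive_id (0 : R) 1) (is_derive_id (0 : R) 1)).
  by rewrite mulr0 mul0r addr0 mul0r.
have D1r : is_derive (0 : R) 1 (fun t => 1 + rho t q) 0.
  by have := is_deriveD (is_derive_cst (1 : R) (0 : R) 1) Dr; rewrite addr0.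
have r0 : rho 0 q = 0 by rewrite /rho !mul0r.
have De : is_derive (0 : R) 1 (fun t => eta t q) 0.
  have h : 0 < 1 + rho 0 q by rewrite r0 addr0.
  by have := is_derive_comp D1r (is_derive1_powR (-1) h); rewrite mulr0.
have e0 : eta 0 q = 1 by rewrite /eta r0 addr0 powR1.
have Dx0 : is_derive (0 : R) 1 (fun t => (Num.sqrt mu)^-1 * ((1 - rho t q) * eta t q)) 0.
  have D1 := is_deriveB (is_derive_cst (1 : R) (0 : R) 1) Dr.
  have := is_derive_mull (Num.sqrt mu)^-1 (is_derive_mul D1 De).
  by rewrite subr0 mul0r mulr0 addr0 mulr0.
have Dx (a : R) : is_derive (0 : R) 1 (fun t => t * (a * eta t q)) a.
  have := is_derive_mul (is_derive_id (0 : R) 1) (is_derive_mull a De).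
  by rewrite e0 mul0r addr0 mul1r mulr1.
apply: is_derive_row => k _.
have D := is_deriveD (is_deriveD (is_derive_mulr (crd k (J q)) Dx0)
  (is_derive_mulr (crd k (J2 q)) (Dx (im_sq q)))) (is_derive_mulr (crd k (J3 q)) (Dx (re_sq q))).
rewrite mul0r add0r in D.
rewrite /direction crdD !crdZ (_ : crd k \o _ = (fun t => (Num.sqrt mu)^-1 * ((1 - rho t q) * eta t q) * crd k (J q))
  + (fun t => t * (im_sq q * eta t q) * crd k (J2 q)) + (fun t => t * (re_sq q * eta t q) * crd k (J3 q)))//.
by apply/funext => t; rewrite /= /rotation !crdD !crdZ.
Qed.

Lemma variation_rotation : Defs.variation mu (hopf_unit mu) (@direction R) rotation.
Proof.
exists 1; split=> //.
- move=> n; apply: (Ck_rotation (tau := fun tp : V => tp.1) (p := fun tp : V => radial tp.2)).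
  + exact: (@open_slab R 1).
  + apply: (@Ck_linear R V R^o n _ fst); [exact: (@open_slab R 1)|].
    by move=> x; exact: cvg_fst.
  + apply: (@Ck_affine R R4 V R4 n [set p | p != 0] _ (@radial R) snd snd).
    * by move=> x h v.
    * by move=> x; exact: cvg_snd.
    * by move=> tp [].
    * exact: smooth_radial.
- by move=> t _; exact: rotation_unit.
- by move=> p _; split; [exact: rotation0|exact: is_derive_rotation].
Qed.

End Rotation.

Theorem proposition4p4 (R : realType) (mu lambda : R)
    (nabla : ('rV[R]_4 -> 'rV[R]_4) -> 'rV[R]_4 -> 'rV[R]_4 -> 'rV[R]_4)
    (mu_gt0 : 0 < mu) (lambda_gt0 : 0 < lambda)
    (nabla_LC : levi_civita mu nabla) :
  (4 - mu + (mu - 4) ^+ 2 / lambda < 0 <-> mu - 4 < lambda /\ 4 < mu) /\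
  (4 - mu + (mu - 4) ^+ 2 / lambda < 0 ->
     unstable_critical_point mu lambda nabla (hopf_unit mu)).
Proof.
split.
  (* In factored form the sign is that of (mu - 4) (mu - 4 - lambda); as lambda > 0, the product is
     negative exactly for 0 < mu - 4 < lambda. *)
  have -> : 4 - mu + (mu - 4) ^+ 2 / lambda = (mu - 4) * (mu - 4 - lambda) / lambda.
    by field; rewrite gt_eqF.
  rewrite pmulr_llt0 ?invr_gt0//; split.
    by move=> h; split; nra.
  by case=> h1 h2; nra.
move=> h; split.
  split.
    (* The Hopf field is the rotation at time 0, so its smoothness and unit length come from the
       variation. *)
    have [e [e0 _ u _]] := variation_rotation mu_gt0.
    have u0 := u 0; rewrite normr0 in u0.
    have := u0 e0.
    by rewrite (_ : rotation mu 0 = hopf_unit mu)//; apply/funext => q; exact: rotation0.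
  move=> A X [e [e0 sX uX X0]].
  apply: (energy_critical mu_gt0 lambda_gt0 nabla_LC e0 sX uX).
  by move=> p /X0 [].
exists (@direction R), (Num.sqrt lambda * ((pi *+ 2) ^+ 2 * ((4 - mu + (mu - 4) ^+ 2 / lambda) / 6))).
split.
- exact: direction_admissible.
- split; first by exists (rotation mu); exact: variation_rotation.
  move=> X [e [e0 sX uX X0]].
  have X00 p : S3 p -> X 0 p = hopf_unit mu p by move=> /X0 [].
  have dX p : S3 p -> is_derive (0 : R) 1 (X ^~ p) (direction p) by move=> /X0 [].
  split; last exact: (hessian_value mu_gt0 lambda_gt0 nabla_LC e0 sX uX X00 dX).
  have z : `|0 : R| < e by rewrite normr0.
  apply: filterS (near_small z) => t te.
  by have [] := energy_derive mu_gt0 lambda_gt0 nabla_LC sX uX te.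
- rewrite pmulr_rlt0 ?sqrtr_gt0// pmulr_rlt0 ?exprn_gt0 ?pi2_gt0//.
  by rewrite pmulr_llt0// invr_gt0.
Qed.
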